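(* Let $N\geq 4$, $K\geq 2$, $1\leq l\leq K-1$, $K+1\leq r\leq N-1$ be integers. For $1\leq k\leq N$ let $G_k:\mathbb{R}\to\mathbb{R}$ with $G_k\in L^1(\mathbb{R})$, let $a_k\geq 0$ be constants, and for $1\leq k\leq K$ let $b_k\in\mathbb{R}$, $b_k\neq 0$. Let $F_k(u,x):\mathbb{R}^N\times\mathbb{R}\to\mathbb{R}$, $1\leq k\leq N$, satisfy the Carath\'eodory condition, and suppose that $$\sqrt{\sum_{k=1}^N F_k^2(u,x)}\leq \mathcal{K}|u|_{\mathbb{R}^N}+h(x)\quad\text{for } u\in\mathbb{R}^N,\ x\in\mathbb{R},$$ with a constant $\mathcal{K}>0$ and a function $h:\mathbb{R}\to\mathbb{R}^+$, $h\in L^2(\mathbb{R})$, and that $$\sqrt{\sum_{k=1}^N \big(F_k(u^{(1)},x)-F_k(u^{(2)},x)\big)^2}\leq L|u^{(1)}-u^{(2)}|_{\mathbb{R}^N}\quad\text{for all } u^{(1)},u^{(2)}\in\mathbb{R}^N,\ x\in\mathbb{R},$$ with a constant $L>0$. Assume: (a) $a_k>0$ for $1\leq k\leq l$; (b) $a_k=0$ for $l+1\leq k\leq K$, and for these $k$ also $xG_k(x)\in L^1(\mathbb{R})$ and $\int_{\mathbb{R}}G_k(x)\,dx=0$; (c) $a_k>0$ for $K+1\leq k\leq r$, and for these $k$ also $xG_k(x)\in L^1(\mathbb{R})$ and $\int_{\mathbb{R}}G_k(x)e^{\mp i\sqrt{a_k}x}\,dx=0$ (both signs); (d) $a_k=0$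 for $r+1\leq k\leq N$, and for these $k$ also $x^2G_k(x)\in L^1(\mathbb{R})$, $\int_{\mathbb{R}}G_k(x)\,dx=0$ and $\int_{\mathbb{R}}xG_k(x)\,dx=0$; and $2\sqrt{\pi}\,Q L<1$, where $Q$ is defined in the context below. For $v=(v_1,\dots,v_N)\in H^2(\mathbb{R},\mathbb{R}^N)$ let $T_{a,b}v=u$ be defined by the system $$-u_k''-b_ku_k'-a_ku_k=\int_{\mathbb{R}}G_k(x-y)F_k(v_1(y),\dots,v_N(y),y)\,dy,\quad 1\leq k\leq K,$$ $$-u_k''-a_ku_k=\int_{\mathbb{R}}G_k(x-y)F_k(v_1(y),\dots,v_N(y),y)\,dy,\quad K+1\leq k\leq N.$$ Then the map $v\mapsto T_{a,b}v=u$ on $H^2(\mathbb{R},\mathbb{R}^N)$ has a unique fixed point $v^{(a,b)}$, which is the only solution in $H^2(\mathbb{R},\mathbb{R}^N)$ of the system $$u_k''+b_ku_k'+a_ku_k+\int_{\mathbb{R}}G_k(x-y)F_k(u_1(y),\dots,u_N(y),y)\,dy=0,\quad 1\leq k\leq K,$$ $$u_k''+a_ku_k+\int_{\mathbb{R}}G_k(x-y)F_k(u_1(y),\dots,u_N(y),y)\,dy=0,\quad K+1\leq k\leq N.$$ The fixed point $v^{(a,b)}$ is nontrivial provided that for some $1\leq k\leq N$ the intersection $\operatorname{supp}\widehat{F_k(0,x)}\cap\operatorname{supp}\widehat{G_k}$ is a set of nonzero Lebesgue measure in $\mathbb{R}$.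
   Context: For $u=(u_1,\dots,u_N)\in\mathbb{R}^N$, $|u|_{\mathbb{R}^N}=\sqrt{\sum_k u_k^2}$. The space $H^2(\mathbb{R},\mathbb{R}^N)$ consists of vector functions with real components in $H^2(\mathbb{R})$, with norm $\|u\|^2_{H^2(\mathbb{R},\mathbb{R}^N)}=\sum_{k=1}^N\big(\|u_k\|^2_{L^2(\mathbb{R})}+\|u_k''\|^2_{L^2(\mathbb{R})}\big)$. The Fourier transform is $\widehat{G}(p)=\frac{1}{\sqrt{2\pi}}\int_{\mathbb{R}}G(x)e^{-ipx}dx$. Define $N_{a,b,k}=\max\Big\{\Big\|\frac{\widehat{G_k}(p)}{p^2-a_k-ib_kp}\Big\|_{L^\infty(\mathbb{R})},\Big\|\frac{p^2\widehat{G_k}(p)}{p^2-a_k-ib_kp}\Big\|_{L^\infty(\mathbb{R})}\Big\}$ for $1\leq k\leq K$, $M_{a,k}=\max\Big\{\Big\|\frac{\widehat{G_k}(p)}{p^2-a_k}\Big\|_{L^\infty(\mathbb{R})},\Big\|\frac{p^2\widehat{G_k}(p)}{p^2-a_k}\Big\|_{L^\infty(\mathbb{R})}\Big\}$ for $K+1\leq k\leq N$, and $Q=\max\{\max_{1\leq k\leq K}N_{a,b,k},\ \max_{K+1\leq k\leq N}M_{a,k}\}$ (finite under the hypotheses).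
   Formalization: In the nontriviality claim, supp is read as the set where the Fourier transform is nonzero, not its closure; with closed supports the claim fails (transform of F_k(0,x) the indicator of a symmetric fat Cantor set, transform of G_k vanishing exactly on it). *)

(* Defs.v *)
From HB Require Import structures.
From mathcomp Require Import all_boot all_order all_algebra.
From mathcomp Require Import all_classical all_reals all_analysis ess_sup_inf.
Set Implicit Arguments. Unset Strict Implicit. Unset Printing Implicit Defensive.
Import Order.TTheory GRing.Theory Num.Theory.
Import numFieldNormedType.Exports.
Local Open Scope classical_set_scope.
Local Open Scope ring_scope.

Notation leb := (@lebesgue_measure _).

Definition L1 {R : realType} (f : R -> R) : Prop :=
  (@lebesgue_measure R).-integrable setT (fun x => (f x)%:E).

Definition L2 {R : realType} (f : R -> R) : Prop :=
  measurable_fun setT f /\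
  (\int[@lebesgue_measure R]_(x in setT) ((f x) ^+ 2)%:E < +oo)%E.

Definition enorm {R : realType} {N : nat} (w : 'I_N -> R) : R :=
  Num.sqrt (\sum_(k < N) (w k) ^+ 2).

(* u ∈ H^2(R): u, u', u'' ∈ L^2(R), where (u, u1, u2) is the continuous
   representative u, with u' = u1 (locally absolutely continuous, via the
   fundamental theorem of calculus), and u1' = u2 almost everywhere. *)
Definition is_H2 {R : realType} (u u1 u2 : R -> R) : Prop :=
  [/\ L2 u, L2 u1, L2 u2,
   (forall x y : R, x <= y ->
      (@lebesgue_measure R).-integrable `[x, y] (fun t => (u1 t)%:E) /\
      u y - u x = \int[@lebesgue_measure R]_(t in `[x, y]) u1 t) &
   (forall x y : R, x <= y ->
      (@lebesgue_measure R).-integrable `[x, y] (fun t => (u2 t)%:E) /\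
      u1 y - u1 x = \int[@lebesgue_measure R]_(t in `[x, y]) u2 t)].

Definition H2N {R : realType} {N : nat} (u : R -> 'I_N -> R) : Prop :=
  forall k : 'I_N, exists u1 u2, is_H2 (fun x => u x k) u1 u2.

Definition conv {R : realType} {N : nat} (G : 'I_N -> R -> R)
  (F : 'I_N -> ('I_N -> R) -> R -> R) (v : R -> 'I_N -> R) (k : 'I_N) (x : R) : R :=
  \int[@lebesgue_measure R]_(y in setT) (G k (x - y) * F k (v y) y).

(* Real and imaginary parts of the Fourier transform of an L^1 function:
   \hat G(p) = (2π)^{-1/2} ∫ G(x) e^{-ipx} dx *)
Definition FTre {R : realType} (G : R -> R) (p : R) : R :=
  (Num.sqrt (2 * pi))^-1 * \int[@lebesgue_measure R]_(x in setT) (G x * cos (p * x)).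
Definition FTim {R : realType} (G : R -> R) (p : R) : R :=
  - ((Num.sqrt (2 * pi))^-1 * \int[@lebesgue_measure R]_(x in setT) (G x * sin (p * x))).
Definition FTabs {R : realType} (G : R -> R) (p : R) : R :=
  Num.sqrt (FTre G p ^+ 2 + FTim G p ^+ 2).

(* L^2 (Plancherel) Fourier transform: (gr, gi) are real and imaginary parts
   of \hat f, the L^2-limit of the truncated transforms
   (2π)^{-1/2} ∫_{-n}^{n} f(x) e^{-ipx} dx. *)
Definition trFTre {R : realType} (f : R -> R) (n : nat) (p : R) : R :=
  (Num.sqrt (2 * pi))^-1 *
  \int[@lebesgue_measure R]_(x in `[- n%:R, n%:R]) (f x * cos (p * x)).
Definition trFTim {R : realType} (f : R -> R) (n : nat) (p : R) : R :=
  - ((Num.sqrt (2 * pi))^-1 *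
  \int[@lebesgue_measure R]_(x in `[- n%:R, n%:R]) (f x * sin (p * x))).
Definition FT2 {R : realType} (f gr gi : R -> R) : Prop :=
  [/\ L2 gr, L2 gi &
   (fun n : nat => (\int[@lebesgue_measure R]_(p in setT)
        (((trFTre f n p - gr p) ^+ 2 + (trFTim f n p - gi p) ^+ 2)%:E))%E)
     @ \oo --> 0%E].

Definition caratheodory {R : realType} {N : nat} (f : ('I_N -> R) -> R -> R) : Prop :=
  (forall u : 'I_N -> R, measurable_fun setT (f u)) /\
  {ae @lebesgue_measure R, forall x : R,
     forall (u : 'I_N -> R) (eps : R), 0 < eps ->
       exists2 d : R, 0 < d &
         forall w : 'I_N -> R, enorm (fun j => w j - u j) < d ->
           `|f w x - f u x| < eps}.

(* The ratio |\hat G_k(p)| / |p^2 - a_k - i b_k p| (k ≤ K, 1-based) and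
   |\hat G_k(p)| / |p^2 - a_k| (k ≥ K+1). *)
Definition ratio {R : realType} {N : nat} (K : nat) (G : 'I_N -> R -> R)
  (a b : 'I_N -> R) (k : 'I_N) (p : R) : R :=
  if (k < K)%N then
    FTabs (G k) p / Num.sqrt ((p ^+ 2 - a k) ^+ 2 + (b k * p) ^+ 2)
  else FTabs (G k) p / `|p ^+ 2 - a k|.

Definition NMk {R : realType} {N : nat} (K : nat) (G : 'I_N -> R -> R)
  (a b : 'I_N -> R) (k : 'I_N) : \bar R :=
  maxe (ess_sup (@lebesgue_measure R) (fun p => (ratio K G a b k p)%:E))
       (ess_sup (@lebesgue_measure R) (fun p => (p ^+ 2 * ratio K G a b k p)%:E)).

Definition Qconst {R : realType} {N : nat} (K : nat) (G : 'I_N -> R -> R)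
  (a b : 'I_N -> R) : \bar R :=
  \big[maxe/-oo%E]_(k < N) NMk K G a b k.

Definition Tsys {R : realType} {N : nat} (K : nat) (a b : 'I_N -> R)
  (G : 'I_N -> R -> R) (F : 'I_N -> ('I_N -> R) -> R -> R)
  (v u : R -> 'I_N -> R) : Prop :=
  forall k : 'I_N, exists u1 u2, is_H2 (fun x => u x k) u1 u2 /\
    {ae @lebesgue_measure R, forall x : R,
       - u2 x - (if (k < K)%N then b k * u1 x else 0) - a k * u x k
       = conv G F v k x}.

Definition Sys {R : realType} {N : nat} (K : nat) (a b : 'I_N -> R)
  (G : 'I_N -> R -> R) (F : 'I_N -> ('I_N -> R) -> R -> R)
  (u : R -> 'I_N -> R) : Prop :=
  forall k : 'I_N, exists u1 u2, is_H2 (fun x => u x k) u1 u2 /\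
    {ae @lebesgue_measure R, forall x : R,
       u2 x + (if (k < K)%N then b k * u1 x else 0) + a k * u x k
       + conv G F u k x = 0}.

(* Main.v *)
(** The difference of two solutions of [u'' + b u' + a u = - G * f] is an [H^2]
    solution of the homogeneous equation, hence zero. To solve the equation, pass
    to the Hartley transform [Hf = Re \hat f - Im \hat f], which keeps everything
    real: convolution with [G] becomes [\hat G], so dividing by
    [p^2 - a - i b p] costs at most the constant [Q], because both
    [\hat G / (p^2 - a - i b p)] and [p^2] times it are bounded. Only the
    inequality of Bessel is needed for [H], and it follows by inserting the weight
    [exp (- e |p|)], whose cosine transform is the Poisson kernel. This gives
    [||u||^2 <= 2 pi Q^2 ||f||^2] in [L^2] and a bound of [sup |u|] by [||f||].
    Hence [v |-> u] is Lipschitz in [L^2] with constant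
    [sqrt (2 pi) Q L < 1 / sqrt 2]; a fixed point of it is automatically in [H^2],
    so Picard iteration is run in [L^2] only. If the fixed point is 0 then
    [G_k * F_k(0, .) = 0] almost everywhere, so the product of the two Fourier
    transforms vanishes almost everywhere. *)

Require Import Defs.
From HB Require Import structures.
From mathcomp Require Import all_boot all_order all_algebra.
From mathcomp Require Import all_classical all_reals all_analysis ess_sup_inf measurable_realfun.
From mathcomp Require Import ring lra.
Set Implicit Arguments. Unset Strict Implicit. Unset Printing Implicit Defensive.
Import Order.TTheory GRing.Theory Num.Theory.
Import numFieldNormedType.Exports.
Local Open Scope classical_set_scope.
Local Open Scope ring_scope.

(** The transform is only ever applied to integrable functions, where it is an honest integral;
    formally it is its own inverse, so one operator serves in both directions. A real transform does
    not turn a convolution into a product, because a shift mixes the values at [p] and [- p]. A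
    complex multiplier [A - i B] with [A] even and [B] odd therefore acts as
    [A p * phi p + B p * phi (- p)], and sharp estimates pair [p] with [- p]. Membership in H^2 is
    expressed by integrals over intervals, so no inversion theorem is required: a candidate [u] is
    written down as a transform, and its equation is tested against indicators of intervals, the
    only functions against which a Parseval identity is proved. Data that are merely
    square-integrable are reached by truncation. There the bounds on [|u|] and [|u'|] at every point
    give pointwise limits, without subsequences or completeness of a function space; the same device
    carries the Picard iteration. *)

Local Notation Int := (Rintegral (@lebesgue_measure _) setT).
(** * Integrable and square-integrable functions *)

Section L1_calculus.
Context {R : realType}.
Implicit Types f g k : R -> R.
Local Notation mu := (@lebesgue_measure R).

Lemma ae_imp (P Q : R -> Prop) :
  {ae mu, forall x, P x} -> (forall x, P x -> Q x) -> {ae mu, forall x, Q x}.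
Proof.
by move=> h PQ; apply: (@filterS _ _ (ae_filter_ringOfSetsType mu) P).
Qed.

Lemma ae_imp2 (P1 P2 Q : R -> Prop) :
  {ae mu, forall x, P1 x} -> {ae mu, forall x, P2 x} ->
  (forall x, P1 x -> P2 x -> Q x) -> {ae mu, forall x, Q x}.
Proof.
by move=> h1 h2 PQ; apply: (@filterS2 _ _ (ae_filter_ringOfSetsType mu) P1 P2).
Qed.

Lemma ae_all (P : R -> Prop) : (forall x, P x) -> {ae mu, forall x, P x}.
Proof. by move=> h; apply: (@filterE _ _ (ae_filter_ringOfSetsType mu)). Qed.

Lemma L1_meas f : L1 f -> measurable_fun setT f.
Proof. by move=> /measurable_int/measurable_EFinP. Qed.

Lemma L1P f : measurable_fun setT f ->
  (\int[mu]_(x in setT) `|f x|%:E < +oo)%E -> L1 f.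
Proof.
by move=> mf f1; apply/integrableP; split; [exact/measurable_EFinP|].
Qed.

Lemma L1_lty f : L1 f -> (\int[mu]_(x in setT) `|f x|%:E < +oo)%E.
Proof. by move=> /integrableP[]. Qed.

Lemma L1_le f g : measurable_fun setT f -> (forall x, `|f x| <= g x) ->
  L1 g -> L1 f.
Proof.
move=> mf fg; apply: le_integrable => //; first exact/measurable_EFinP.
by move=> x _; rewrite /= lee_fin (le_trans (fg x))// ler_norm.
Qed.

Lemma L1D f g : L1 f -> L1 g -> L1 (fun x => f x + g x).
Proof. by move=> f1 g1; exact: (integrableD _ f1 g1). Qed.

Lemma L1B f g : L1 f -> L1 g -> L1 (fun x => f x - g x).
Proof. by move=> f1 g1; exact: (integrableB _ f1 g1). Qed.

Lemma L1Zl (c : R) f : L1 f -> L1 (fun x => c * f x).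
Proof. by move=> f1; exact: (integrableZl _ _ f1). Qed.

Lemma L1_norm f : L1 f -> L1 (fun x => `|f x|).
Proof. by move=> f1; exact: (integrable_norm f1). Qed.

Lemma L1M_bounded f k (C : R) : measurable_fun setT k ->
  (forall x, `|k x| <= C) -> L1 f -> L1 (fun x => f x * k x).
Proof.
move=> mk kC f1; apply: (@L1_le _ (fun x => C * `|f x|)).
- by apply: measurable_funM => //; exact: L1_meas.
- by move=> x; rewrite normrM mulrC ler_wpM2r.
- exact/L1Zl/L1_norm.
Qed.

Lemma EFin_Int f : L1 f -> ((Int f)%:E = \int[mu]_(x in setT) (f x)%:E)%E.
Proof. by move=> f1; rewrite fineK//; exact: integrable_fin_num. Qed.

Lemma IntD f g : L1 f -> L1 g -> Int (fun x => f x + g x) = Int f + Int g.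
Proof. by move=> f1 g1; exact: RintegralD. Qed.

Lemma IntB f g : L1 f -> L1 g -> Int (fun x => f x - g x) = Int f - Int g.
Proof. by move=> f1 g1; exact: RintegralB. Qed.

Lemma IntZl (c : R) f : L1 f -> Int (fun x => c * f x) = c * Int f.
Proof. by move=> f1; exact: RintegralZl. Qed.

Lemma eq_Int f g : f =1 g -> Int f = Int g.
Proof. by move=> fg; apply: eq_Rintegral => x _; exact: fg. Qed.

Lemma le_Int f g : L1 f -> L1 g -> (forall x, f x <= g x) -> Int f <= Int g.
Proof. by move=> f1 g1 fg; apply: le_Rintegral => // x _; exact: fg. Qed.

Lemma Int_ge0 f : (forall x, 0 <= f x) -> 0 <= Int f.
Proof. by move=> f0; apply: Rintegral_ge0 => x _; exact: f0. Qed.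

Lemma norm_Int f : L1 f -> `|Int f| <= Int (fun x => `|f x|).
Proof. by move=> f1; exact: le_normr_Rintegral. Qed.

Lemma Int0 : Int (fun=> 0 : R) = 0.
Proof. by rewrite /Rintegral integral0. Qed.

Lemma ge0_L1 f (C : R) : measurable_fun setT f -> (forall x, 0 <= f x) ->
  (\int[mu]_(x in setT) (f x)%:E <= C%:E)%E -> L1 f /\ Int f <= C.
Proof.
move=> mf f0 fC; have f1 : L1 f.
  apply: L1P => //; apply: le_lt_trans (ltry C); apply: le_trans fC.
  by under eq_integral do rewrite ger0_norm//.
by split => //; rewrite -lee_fin EFin_Int.
Qed.

Lemma ae_eq_L1 f g : measurable_fun setT g ->
  {ae mu, forall x, f x = g x} -> L1 f -> L1 g.
Proof.
move=> mg fg f1; apply: L1P => //.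
rewrite (_ : (\int[mu]_x _)%E = (\int[mu]_x `|f x|%:E)%E); first exact: L1_lty.
apply: ae_eq_integral => //.
- by apply/measurable_EFinP; exact: measurableT_comp.
- by apply/measurable_EFinP; apply: measurableT_comp => //; exact: L1_meas.
- by apply: (ae_imp fg) => x -> _.
Qed.

Lemma ae_eq_Int f g : measurable_fun setT f -> measurable_fun setT g ->
  {ae mu, forall x, f x = g x} -> Int f = Int g.
Proof.
move=> mf mg fg; congr fine; apply: ae_eq_integral => //;
  try exact/measurable_EFinP.
by apply: (ae_imp fg) => x -> _.
Qed.

Lemma Int_eq0 f : L1 f -> (forall x, 0 <= f x) -> Int f = 0 ->
  {ae mu, forall x, f x = 0}.
Proof.
move=> f1 f0 If.
have mf : measurable_fun setT (fun x => (f x)%:E).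
  by apply/measurable_EFinP; exact: L1_meas.
have /(ae_eq_integral_abs mu measurableT mf) : (\int[mu]_(x in setT) `|(f x)%:E| = 0)%E.
  by under eq_integral do rewrite gee0_abs ?lee_fin//; rewrite -EFin_Int// If.
by move/ae_imp; apply => x /(_ I) /= [].
Qed.

Lemma dominated_Int (f_ : nat -> R -> R) f g :
  (forall n, measurable_fun setT (f_ n)) ->
  (forall x, f_ n x @[n --> \oo] --> f x) -> L1 g ->
  (forall n x, `|f_ n x| <= g x) -> L1 f /\ Int (f_ n) @[n --> \oo] --> Int f.
Proof.
move=> mf_ ff g1 fg.
have mf : measurable_fun setT f by apply: measurable_fun_cvg mf_ _ => x _.
have f1 : L1 f.
  apply: (L1_le mf _ g1) => x.
  by apply: (ler_cvg_to (cvg_norm (ff x)) (cvg_cst (g x))); apply: nearW.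
split => //; apply: fine_cvg; rewrite -/(Int f) EFin_Int//.
apply: (@dominated_cvg _ _ _ mu _ measurableT _ _ (EFin \o g)) => //.
- by move=> n; have /measurable_EFinP := mf_ n.
- by move=> x _; apply: cvg_EFin; [by apply: nearW|exact: ff].
- by move=> n x _; rewrite /= lee_fin.
Qed.

(** Used for limits that have no dominating function: a uniform bound on the integrals yields
    integrability of the limit together with the bound. *)
Lemma fatou_Int (f_ : nat -> R -> R) f (C : R) :
  (forall n, L1 (f_ n)) -> (forall n x, 0 <= f_ n x) ->
  (forall x, f_ n x @[n --> \oo] --> f x) -> (forall n, Int (f_ n) <= C) ->
  L1 f /\ Int f <= C.
Proof.
move=> f1 f0 ff fC.
have mf : measurable_fun setT f.
  by apply: (@measurable_fun_cvg _ _ _ _ f_) => [n|x _//]; exact: L1_meas.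
apply: ge0_L1 => // [x|].
  by apply: (ler_cvg_to (cvg_cst 0) (ff x)); apply: nearW.
have E x : limn_einf (fun n => (f_ n x)%:E) = (f x)%:E.
  apply: (cvg_limn_einf_sup _).1.
  by apply: cvg_EFin; [apply: nearW|exact: ff].
under eq_integral do rewrite -E.
apply: le_trans.
  apply: fatou => //= n; first by apply/measurable_EFinP; exact: L1_meas.
  by move=> x _; rewrite lee_fin.
rewrite limn_einf_lim; apply: lime_le; first exact: is_cvg_einfs.
apply: nearW => n; apply: (@le_trans _ _ (\int[mu]_(x in setT) (f_ n x)%:E)%E).
  by apply: ereal_inf_lbound; exists n => /=.
by rewrite -EFin_Int// lee_fin.
Qed.

End L1_calculus.

(** * Translation and reflection of Lebesgue measure *)

Section lebesgue_translation.
Context {R : realType}.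
Local Notation mu := (@lebesgue_measure R).
Local Open Scope ereal_scope.

(** The pushforward agrees with [mu] on half-open intervals, and these determine Lebesgue
    measure. *)
Lemma lebesgue_measure_shift (c : R) (A : set R) : measurable A ->
  pushforward mu ((fun x => x + c)%R : _ -> measurableTypeR R) A = mu A.
Proof.
have mc : measurable_fun setT ((fun x => x + c)%R : measurableTypeR R -> measurableTypeR R).
  exact: measurable_funD.
move=> mA; apply/esym/lebesgue_measure_unique => //= _ [[a b]] _ <-.
rewrite /pushforward/=.
rewrite (_ : _ @^-1` _ = `](a - c)%R, (b - c)%R]%classic); last first.
  by apply/seteqP; split => x /=; rewrite !in_itv/= ltrBlDr lerBrDr.
rewrite !lebesgue_measure_itv/= !lte_fin ltrD2r.
by rewrite -!EFinB opprB addrA subrK.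
Qed.

Lemma ge0_integral_shift (c : R) (f : R -> \bar R) : measurable_fun setT f ->
  (forall x, 0 <= f x) ->
  \int[mu]_(x in setT) f (x + c)%R = \int[mu]_(x in setT) f x.
Proof.
move=> mf f0.
have mc : measurable_fun setT ((fun x => x + c)%R : measurableTypeR R -> measurableTypeR R).
  exact: measurable_funD.
transitivity (\int[pushforward mu ((fun x => x + c)%R : _ -> measurableTypeR R)]_(x in setT) f x).
  by rewrite ge0_integral_pushforward.
by apply: eq_measure_integral => A mA _; exact: lebesgue_measure_shift.
Qed.

Lemma ge0_integral_opp (f : R -> \bar R) : measurable_fun setT f ->
  (forall x, 0 <= f x) ->
  \int[mu]_(x in setT) f (- x)%R = \int[mu]_(x in setT) f x.
Proof.
move=> mf f0.
transitivity (\int[pushforward mu (-%R : _ -> measurableTypeR R)]_(x in setT) f x).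
  by rewrite ge0_integral_pushforward.
by apply: eq_measure_integral => A mA _; exact: lebesgue_measureN.
Qed.

End lebesgue_translation.

Section Int_translation.
Context {R : realType}.
Implicit Types f : R -> R.
Local Notation mu := (@lebesgue_measure R).

(** Positive and negative parts are moved separately, so the two sides agree even when the integral
    diverges. *)
Lemma Int_shift (c : R) f : measurable_fun setT f -> Int (fun x => f (x + c)) = Int f.
Proof.
move=> mf; congr fine; rewrite [LHS]integralE [RHS]integralE.
have mf' : measurable_fun setT (EFin \o f) by exact/measurable_EFinP.
congr (_ - _)%E.
- rewrite -[RHS](ge0_integral_shift c (measurable_funepos mf') (funepos_ge0 _)).
  by apply: eq_integral => x _; rewrite !funeposE.
- rewrite -[RHS](ge0_integral_shift c (measurable_funeneg mf') (funeneg_ge0 _)).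
  by apply: eq_integral => x _; rewrite !funenegE.
Qed.

Lemma Int_opp f : measurable_fun setT f -> Int (fun x => f (- x)) = Int f.
Proof.
move=> mf; congr fine; rewrite [LHS]integralE [RHS]integralE.
have mf' : measurable_fun setT (EFin \o f) by exact/measurable_EFinP.
congr (_ - _)%E.
- rewrite -[RHS](ge0_integral_opp (measurable_funepos mf') (funepos_ge0 _)).
  by apply: eq_integral => x _; rewrite !funeposE.
- rewrite -[RHS](ge0_integral_opp (measurable_funeneg mf') (funeneg_ge0 _)).
  by apply: eq_integral => x _; rewrite !funenegE.
Qed.

Lemma L1_opp f : L1 f -> L1 (fun x => f (- x)).
Proof.
move=> f1; apply: L1P; first by apply: measurableT_comp => //; exact: L1_meas.
rewrite (ge0_integral_opp (f := fun x => `|f x|%:E)) //; first exact: L1_lty.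
by apply/measurable_EFinP; apply: measurableT_comp => //; exact: L1_meas.
Qed.

Lemma L1_shift (c : R) f : L1 f -> L1 (fun x => f (x + c)).
Proof.
move=> f1; apply: L1P.
  by apply: measurableT_comp; [exact: L1_meas|exact: measurable_funD].
rewrite (ge0_integral_shift c (f := fun x => `|f x|%:E)) //; first exact: L1_lty.
by apply/measurable_EFinP; apply: measurableT_comp => //; exact: L1_meas.
Qed.

Lemma L1_reflect (c : R) f : L1 f -> L1 (fun x => f (c - x)).
Proof.
move=> /(L1_shift c)/L1_opp; rewrite (_ : (fun _ => _) = fun x => f (c - x))//.
by apply: funext => x; rewrite addrC.
Qed.

End Int_translation.

Section set_integrals.
Context {R : realType}.
Implicit Types (f : R -> R) (D : set R).
Local Notation mu := (@lebesgue_measure R).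

(** Integrals over an interval become integrals over the line against an indicator, to which Fubini,
    Cauchy-Schwarz and the transform apply. *)
Lemma Rintegral_indic D f :
  \int[mu]_(x in D) f x = Int (fun x => f x * \1_D x).
Proof.
rewrite Rintegral_mkcond; apply: eq_Int => x.
by rewrite patchE indicE; case: ifPn => _; rewrite ?mulr1 ?mulr0.
Qed.

Lemma integrable_indicE D f : measurable D ->
  mu.-integrable D (fun x => (f x)%:E) <-> L1 (fun x => f x * \1_D x).
Proof.
move=> mD; rewrite /L1.
have := @integrable_mkcond _ _ _ mu D (fun x => (f x)%:E) mD.
have -> : (fun x : R => (f x * \1_D x)%:E) = (fun x : R => (f x)%:E) \_ D.
  by apply: funext => x; rewrite patchE indicE; case: ifPn => _; rewrite ?mulr1 ?mulr0.
by [].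
Qed.

Lemma L1_indic_itv (x y : R) : L1 (\1_`[x, y] : R -> R).
Proof. exact: integrable_indic_itv. Qed.

Lemma Int_indic_itv (x y : R) : x <= y -> Int (\1_`[x, y] : R -> R) = y - x.
Proof.
move=> xy; rewrite /Rintegral integral_indic// setIT.
by rewrite [X in fine X]lebesgue_measure_itv/= lte_fin; case: ltgtP xy => // -> _ /=; rewrite subrr.
Qed.

End set_integrals.

(** * Fubini's theorem for real-valued integrals *)

Section fubini_Int.
Context {R : realType}.
Local Notation mu := (@lebesgue_measure R).
Implicit Types (f g : R -> R) (K : R -> R -> R).

Definition jmeasurable (K : R -> R -> R) := measurable_fun setT (fun z : R * R => K z.1 z.2).

Lemma jmeasurableC K : jmeasurable K -> jmeasurable (fun x y => K y x).
Proof.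
move=> mK; apply: (measurableT_comp mK (g := fun z : R * R => (z.2, z.1))).
exact/measurable_fun_pair.
Qed.

Lemma jmeasurable_l K x : jmeasurable K -> measurable_fun setT (K x).
Proof.
move=> mK; apply: (measurableT_comp mK (g := fun y : R => (x, y))).
exact/measurable_fun_pair.
Qed.

Lemma measurable_Int K : jmeasurable K ->
  measurable_fun setT (fun x => Int (K x)).
Proof.
move=> mK; rewrite /Rintegral.
apply: measurableT_comp => //.
under eq_fun do rewrite integralE.
have mK' : measurable_fun setT (fun z : R * R => (K z.1 z.2)%:E) by exact/measurable_EFinP.
apply: emeasurable_funB.
- have h := measurable_fun_fubini_tonelli_F (m2 := mu) _ (measurable_funepos mK') (funepos_ge0 _).
  by apply: eq_measurable_fun h => x _; apply: eq_integral => y _; rewrite !funeposE.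
- have h := measurable_fun_fubini_tonelli_F (m2 := mu) _ (measurable_funeneg mK') (funeneg_ge0 _).
  by apply: eq_measurable_fun h => x _; apply: eq_integral => y _; rewrite !funenegE.
Qed.

Lemma measurable_Int_norm K : jmeasurable K ->
  measurable_fun setT (fun x => \int[mu]_(y in setT) `|K x y|%:E)%E.
Proof.
move=> mK.
apply: (measurable_fun_fubini_tonelli_F (m2 := mu) (fun z : R * R => `|K z.1 z.2|%:E)%E) => //.
by apply/measurable_EFinP; apply: measurableT_comp.
Qed.

Lemma Fubini_Int K : jmeasurable K ->
  (\int[mu]_(x in setT) \int[mu]_(y in setT) `|K x y|%:E < +oo)%E ->
  [/\ L1 (fun x => Int (K x)),
      {ae mu, forall x, L1 (K x)} &
      Int (fun x => Int (K x)) = Int (fun y => Int (K ^~ y))].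
Proof.
move=> mK K1.
have mK' : measurable_fun setT (fun z : R * R => (K z.1 z.2)%:E) by exact/measurable_EFinP.
have iK : (mu \x mu)%E.-integrable setT (fun z : R * R => (K z.1 z.2)%:E).
  exact/integrable12ltyP.
have aeL : {ae mu, forall x, L1 (K x)}.
  by have := ae_integrable1 iK.
have aeL2 : {ae mu, forall y, L1 (K ^~ y)}.
  by have := ae_integrable2 iK.
have iF := integrable_fubini_F iK.
(* [Int] discards infinite values through [fine], so it agrees with the extended integral only where
   the slice is integrable, that is for almost every [x]. *)
have e1 : (\int[mu]_(x in setT) (Int (K x))%:E = \int[mu]_(x in setT) \int[mu]_(y in setT) (K x y)%:E)%E.
  apply: ae_eq_integral => //.
  - by apply/measurable_EFinP; exact: measurable_Int.
  - exact: (measurable_int _ iF).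
  - by apply: (ae_imp aeL) => x /EFin_Int ->.
have e2 : (\int[mu]_(y in setT) (Int (K ^~ y))%:E = \int[mu]_(y in setT) \int[mu]_(x in setT) (K x y)%:E)%E.
  apply: ae_eq_integral => //.
  - by apply/measurable_EFinP; apply: measurable_Int; exact: jmeasurableC.
  - exact: (measurable_fubini_G iK).
  - by apply: (ae_imp aeL2) => x /EFin_Int ->.
split => //.
- apply: L1P; first exact: measurable_Int.
  apply: le_lt_trans K1; apply: ae_ge0_le_integral => //.
  + apply/measurable_EFinP; apply: measurableT_comp => //; exact: measurable_Int.
  + by move=> x _; apply: integral_ge0 => y _; rewrite lee_fin.
  + exact: measurable_Int_norm.
  + apply: (ae_imp aeL) => x Kx _; have := norm_Int Kx; rewrite -lee_fin => /le_trans; apply.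
    by rewrite EFin_Int//; exact: L1_norm.
- rewrite /Rintegral; congr fine; rewrite -/(Rintegral _ _) e1 e2.
  exact: (Fubini iK).
Qed.

(** The double integral of absolute values is at most [C] times the product of the two [L1] norms.
    With [K] the kernel [cas], this is how transforms are moved from one factor to another. *)
Lemma Fubini_bounded f g K (C : R) : L1 f -> L1 g -> jmeasurable K ->
  (forall x y, `|K x y| <= C) ->
  Int (fun x => f x * Int (fun y => g y * K x y)) =
  Int (fun y => g y * Int (fun x => f x * K x y)).
Proof.
move=> f1 g1 mK KC.
have C0 : 0 <= C by apply: le_trans (KC 0 0).
have mf := L1_meas f1; have mg := L1_meas g1.
have gK x : L1 (fun y => g y * K x y).
  by apply: L1M_bounded g1 => //; exact: jmeasurable_l.
have fK y : L1 (fun x => f x * K x y).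
  by apply: (L1M_bounded (k := K ^~ y)) f1 => //; exact: (jmeasurable_l _ (jmeasurableC mK)).
pose H x y := f x * (g y * K x y).
have mH : jmeasurable H.
  apply: measurable_funM; first exact: measurableT_comp.
  by apply: measurable_funM => //; exact: measurableT_comp.
have [|_ _ E] := Fubini_Int mH.
  apply: (@le_lt_trans _ _ (\int[mu]_(x in setT) (`|f x| * (C * Int (fun y => `|g y|)))%:E)%E).
    apply: ge0_le_integral => //.
    - by move=> x _; apply: integral_ge0 => y _; rewrite lee_fin.
    - exact: measurable_Int_norm mH.
    - by apply/measurable_EFinP; apply: measurable_funM => //; exact: measurableT_comp.
    - move=> x _; rewrite -EFin_Int; last first.
        by apply: L1_norm; exact: L1Zl.
      rewrite lee_fin -IntZl; last exact: L1_norm.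
      rewrite -IntZl; last by apply/L1Zl/L1_norm.
      apply: le_Int => //.
      + by apply/L1_norm/L1Zl.
      + by apply/L1Zl/L1Zl/L1_norm.
      + by move=> y; rewrite /H !normrM ler_wpM2l// mulrC ler_wpM2r.
  rewrite -EFin_Int ?ltry//.
  under eq_fun do rewrite mulrC.
  by apply/L1Zl/L1_norm.
rewrite (eq_Int (g := fun x => Int (H x))); last by move=> x; rewrite -IntZl.
rewrite E; apply: eq_Int => y; rewrite -IntZl//; apply: eq_Int => x.
by rewrite /H mulrCA.
Qed.

End fubini_Int.

(** The squared [L2] norm. Estimates stay squared throughout, and [n2D] stands in for the triangle
    inequality. *)
Notation n2 f := (Int (fun x => f x ^+ 2)).

Section L2_calculus.
Context {R : realType}.
Implicit Types f g k : R -> R.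
Local Notation mu := (@lebesgue_measure R).

Lemma L2_meas f : L2 f -> measurable_fun setT f.
Proof. by case. Qed.

Lemma L2P f : L2 f <-> measurable_fun setT f /\ L1 (fun x => f x ^+ 2).
Proof.
split=> -[mf f2]; split=> //.
- apply: L1P; first exact: measurable_funX.
  by under eq_integral do rewrite ger0_norm ?sqr_ge0//.
- by rewrite -EFin_Int// ltry.
Qed.

Lemma L2_sqr f : L2 f -> L1 (fun x => f x ^+ 2).
Proof. by move=> /L2P[]. Qed.

Lemma L2_le f g : measurable_fun setT f -> (forall x, `|f x| <= `|g x|) ->
  L2 g -> L2 f.
Proof.
move=> mf fg /L2P[_ g2]; apply/L2P; split => //; apply: L1_le g2.
- exact: measurable_funX.
- by move=> x; rewrite ger0_norm ?sqr_ge0// -real_normK ?num_real// -[leRHS]real_normK ?num_real// lerXn2r ?nnegrE.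
Qed.

Lemma L2_mul f g : L2 f -> L2 g -> L1 (fun x => f x * g x).
Proof.
move=> /L2P[mf f2] /L2P[mg g2].
apply: (@L1_le _ _ (fun x => f x ^+ 2 + g x ^+ 2)).
- exact: measurable_funM.
- move=> x; rewrite ler_norml; apply/andP; split; nra.
- exact: L1D.
Qed.

Lemma L2D f g : L2 f -> L2 g -> L2 (fun x => f x + g x).
Proof.
move=> /[dup] f2 /L2P[mf f1] /[dup] g2 /L2P[mg g1].
apply/L2P; split; first exact: measurable_funD.
under eq_fun do rewrite sqrrD -mulr_natl.
by apply: L1D => //; apply: L1D => //; apply: L1Zl; exact: L2_mul.
Qed.

Lemma L2Zl (c : R) f : L2 f -> L2 (fun x => c * f x).
Proof.
move=> /L2P[mf f1]; apply/L2P; split; first exact: measurable_funM.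
by under eq_fun do rewrite exprMn; exact: L1Zl.
Qed.

Lemma L2_neg f : L2 f -> L2 (fun x => - f x).
Proof. by move=> /(L2Zl (-1)); under eq_fun do rewrite mulN1r. Qed.

Lemma L2B f g : L2 f -> L2 g -> L2 (fun x => f x - g x).
Proof. by move=> f2 /L2_neg; exact: L2D. Qed.

Lemma L2M_bounded f k (C : R) : measurable_fun setT k ->
  (forall x, `|k x| <= C) -> L2 f -> L2 (fun x => f x * k x).
Proof.
move=> mk kC f2; apply: L2_le (L2Zl C f2).
  by apply: measurable_funM => //; exact: L2_meas.
move=> x; rewrite normrM normrM mulrC ler_wpM2r//.
by rewrite (le_trans (kC x))// ler_norm.
Qed.

Lemma L2_norm f : L2 f -> L2 (fun x => `|f x|).
Proof.
move=> f2; apply: (L2_le _ _ f2) => [|x]; last by rewrite normr_id.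
by apply: measurableT_comp => //; exact: L2_meas.
Qed.

Lemma n2_ge0 f : 0 <= n2 f.
Proof. by apply: Int_ge0 => x; exact: sqr_ge0. Qed.

Lemma L2_opp f : L2 f -> L2 (fun x => f (- x)).
Proof.
move=> /L2P[mf f1]; apply/L2P; split; first exact: measurableT_comp.
exact: (L1_opp f1).
Qed.

Lemma n2_opp f : measurable_fun setT f -> n2 (fun x => f (- x)) = n2 f.
Proof. by move=> mf; rewrite (Int_opp (f := fun x => f x ^+ 2))//; exact: measurable_funX. Qed.

(* The quadratic polynomial [n2 (f - t * g)] in [t] is nonnegative. *)
Lemma cauchy_schwarz f g : L2 f -> L2 g ->
  (Int (fun x => f x * g x)) ^+ 2 <= n2 f * n2 g.
Proof.
move=> f2 g2; set b := Int _.
have fg := L2_mul f2 g2; have ff := L2_sqr f2; have gg := L2_sqr g2.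
have H t : 0 <= n2 f - 2 * t * b + t ^+ 2 * n2 g.
  have <- : n2 (fun x => f x - t * g x) = n2 f - 2 * t * b + t ^+ 2 * n2 g.
    rewrite /b -IntZl// -IntZl// -IntB//; last exact: L1Zl.
    rewrite -IntD//; [|by apply: L1B => //; exact: L1Zl|exact: L1Zl].
    by apply: eq_Int => x; ring.
  exact: n2_ge0.
have := n2_ge0 g; rewrite le_eqVlt => /predU1P[g0|g0].
  rewrite -g0 mulr0; have [->|b0] := eqVneq b 0; first by rewrite expr0n.
  (* If [n2 g = 0] the polynomial is affine in [t], and at this [t] it equals -1. *)
  have := H ((n2 f + 1) / (2 * b)); rewrite -g0 mulr0 addr0.
  have -> : 2 * ((n2 f + 1) / (2 * b)) * b = n2 f + 1 by field.
  lra.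
have := H (b / n2 g).
have -> : n2 f - 2 * (b / n2 g) * b + (b / n2 g) ^+ 2 * n2 g = n2 f - b ^+ 2 / n2 g.
  by field; rewrite gt_eqF.
by rewrite subr_ge0 ler_pdivrMr.
Qed.

Lemma n2D f g : L2 f -> L2 g -> n2 (fun x => f x + g x) <= 2 * n2 f + 2 * n2 g.
Proof.
move=> f2 g2; have ff := L2_sqr f2; have gg := L2_sqr g2.
rewrite -IntZl// -IntZl// -IntD//; [|exact: L1Zl|exact: L1Zl].
apply: le_Int.
- by apply: L2_sqr; exact: L2D.
- by apply: L1D; exact: L1Zl.
- by move=> x; rewrite -subr_ge0 (_ : _ - _ = (f x - g x) ^+ 2) ?sqr_ge0//; ring.
Qed.

Lemma le_n2 f g : L2 f -> L2 g -> (forall x, `|f x| <= `|g x|) -> n2 f <= n2 g.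
Proof.
move=> f2 g2 fg; apply: le_Int => [||x]; try exact: L2_sqr.
by rewrite -real_normK ?num_real// -[leRHS]real_normK ?num_real// lerXn2r ?nnegrE.
Qed.

Lemma ae_eq_L2 f g : measurable_fun setT g ->
  {ae mu, forall x, f x = g x} -> L2 f -> L2 g.
Proof.
move=> mg fg /L2P[mf f2]; apply/L2P; split => //.
apply: ae_eq_L1 f2; first exact: measurable_funX.
by apply: (ae_imp fg) => x ->.
Qed.

Lemma L2_indic_itv (x y : R) : L2 (\1_`[x, y] : R -> R).
Proof.
apply/L2P; split; first exact: measurable_indic.
apply: L1_le (L1_indic_itv x y).
- by apply: measurable_funX; exact: measurable_indic.
- by move=> z; rewrite indicE; case: (_ \in _); rewrite ?expr1n ?expr0n ?normr1 ?normr0.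
Qed.

Lemma L2_integrable_itv f (x y : R) : L2 f -> L1 (fun t => f t * \1_`[x, y] t).
Proof. by move=> f2; apply: L2_mul => //; exact: L2_indic_itv. Qed.

End L2_calculus.

Section fundamental_theorem.
Context {R : realType}.
Local Notation mu := (@lebesgue_measure R).

Lemma eq_Int_set (D : set R) (f g : R -> R) : {in D, f =1 g} ->
  \int[mu]_(x in D) f x = \int[mu]_(x in D) g x.
Proof. by move=> fg; apply: eq_Rintegral => x xD; exact: fg. Qed.

Lemma FTC_itv (F f : R -> R) (a b : R) : a <= b -> continuous f ->
  (forall x : R, is_derive x 1 F (f x)) ->
  \int[mu]_(x in `[a, b]) f x = F b - F a.
Proof.
move=> ab cf dF; move: ab; rewrite le_eqVlt => /predU1P[<-|ab].
  by rewrite set_itv1 Rintegral_set1 subrr.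
rewrite /Rintegral (continuous_FTC2 (F := F) ab) //.
- exact: continuous_subspaceT.
- have cF x : {for x, continuous F} by apply: differentiable_continuous; apply/derivable1_diffP; exact: ex_derive.
  split => [x _||]; first exact: ex_derive.
  + by apply: cvg_at_right_filter; exact: cF.
  + by apply: cvg_at_left_filter; exact: cF.
- by move=> x _; rewrite derive1E; exact: derive_val.
Qed.

Lemma continuous_is_derive (f f' : R -> R) :
  (forall x : R, is_derive x 1 f (f' x)) -> continuous f.
Proof.
move=> df x; apply: differentiable_continuous; apply/derivable1_diffP.
exact: ex_derive.
Qed.

End fundamental_theorem.

(** * Improper integrals of even functions *)

Section half_line.
Context {R : realType}.
Local Notation mu := (@lebesgue_measure R).
Implicit Types f g : R -> R.

Lemma truncation_cvg (x : R) : \1_(`[- n%:R, n%:R]%classic : set R) x @[n --> \oo] --> (1 : R).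
Proof.
apply: cvg_near_cst; near=> n.
rewrite indicE mem_set//= in_itv/= -ler_norml.
by near: n; exact: nbhs_infty_ger.
Unshelve. all: by end_near. Qed.

(* [0, n] and its mirror image [-n, 0[ exhaust the line. *)
Let half f (n : nat) (x : R) := f x * \1_(`[0, n%:R]%classic : set R) x + f x * \1_(`]0, n%:R]%classic : set R) (- x).

Let half_cvg f x : half f n x @[n --> \oo] --> f x.
Proof.
apply: cvg_near_cst; near=> n.
have xn : `|x| <= n%:R by near: n; exact: nbhs_infty_ger.
move: xn; rewrite /half !indicE !mem_setE/= !in_itv/= ler_norml lerNl => /andP[x1 x2].
by rewrite x1 x2 !andbT oppr_gt0; case: ltP; rewrite ?mulr1 ?mulr0 ?addr0 ?add0r.
Unshelve. all: by end_near. Qed.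

Let half_meas f n : measurable_fun setT f -> measurable_fun setT (half f n).
Proof.
move=> mf; apply: measurable_funD; apply: measurable_funM => //.
by apply: measurableT_comp => //; exact: measurable_indic.
Qed.

Let half_Int f n : continuous f -> (forall x, f (- x) = f x) ->
  L1 (half f n) /\ Int (half f n) = 2 * \int[mu]_(x in `[0, n%:R]) f x.
Proof.
move=> cf ef; have mf := continuous_measurable_fun cf.
have i1 : mu.-integrable `[0, n%:R] (EFin \o f).
  apply: continuous_compact_integrable; first exact: segment_compact.
  exact: continuous_subspaceT.
have i2 : mu.-integrable `]0, n%:R] (EFin \o f).
  by apply: integrableS i1 => //; move=> x; rewrite /= !in_itv/= => /andP[/ltW -> ->].
have l1 : L1 (fun x => f x * \1_(`[0, n%:R]%classic : set R) x).
  exact: ((integrable_indicE f (measurable_itv _)).1 i1).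
have l2 : L1 (fun x => f x * \1_(`]0, n%:R]%classic : set R) x).
  exact: ((integrable_indicE f (measurable_itv _)).1 i2).
have l2' : L1 (fun x => f x * \1_(`]0, n%:R]%classic : set R) (- x)).
  by have := L1_opp l2; under eq_fun do rewrite ef.
split; first exact: L1D.
rewrite IntD// -Rintegral_indic.
rewrite -(Int_opp (L1_meas l2')).
under [X in _ + X]eq_Int do rewrite ef opprK.
rewrite -Rintegral_indic Rintegral_itv_obnd_cbnd//.
by rewrite mulr_natl mulr2n.
Qed.

(** Primitives are evaluated on [[0, n]]; Fatou along [half] carries the bound to the line and
    doubles it. *)
Lemma even_ge0_L1 f (C : R) : continuous f -> (forall x, f (- x) = f x) ->
  (forall x, 0 <= f x) ->
  (forall n : nat, \int[mu]_(x in `[0, n%:R]) f x <= C) ->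
  L1 f /\ Int f <= 2 * C.
Proof.
move=> cf ef f0 fC; apply: (fatou_Int (f_ := half f)).
- by move=> n; have [] := half_Int n cf ef.
- by move=> n x; rewrite /half addr_ge0// mulr_ge0.
- exact: half_cvg.
- by move=> n; have [_ ->] := half_Int n cf ef; rewrite ler_wpM2l.
Qed.

(** Once integrability is known, the same exhaustion with dominated convergence gives the value and
    not only a bound. *)
Lemma even_Int f (l : R) : continuous f -> (forall x, f (- x) = f x) -> L1 f ->
  (\int[mu]_(x in `[0, n%:R]) f x) @[n --> \oo] --> l -> Int f = 2 * l.
Proof.
move=> cf ef f1 fl.
have [||||_ h] := @dominated_Int _ (half f) f (fun x => 2 * `|f x|).
- by move=> n; apply: half_meas; exact: continuous_measurable_fun.
- exact: half_cvg.
- exact/L1Zl/L1_norm.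
- move=> n x; rewrite /half (le_trans (ler_normD _ _))// mulr_natl mulr2n.
  by rewrite lerD// normrM ler_piMr// indicE; case: (_ \in _); rewrite ?normr1 ?normr0.
- have h2 : Int (half f n) @[n --> \oo] --> 2 * l.
    rewrite (_ : (fun n => _) = fun n => 2 * \int[mu]_(x in `[0, n%:R]) f x).
      by apply: cvgM => //; exact: cvg_cst.
    by apply: funext => n; exact: (half_Int n cf ef).2.
  exact: cvg_unique h h2.
Qed.

End half_line.

(** * The Poisson kernel *)

Section poisson_kernel.
Context {R : realType}.
Local Notation mu := (@lebesgue_measure R).

Implicit Types e s t p x y : R.

Definition abel (e p : R) : R := expR (- (e * `|p|)).
(** The Poisson kernel without its usual factor [1 / (2 pi)], hence of mass [2 pi]. *)
Definition poisson (e t : R) : R := 2 * e / (e ^+ 2 + t ^+ 2).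

Lemma continuous_abel e : continuous (abel e).
Proof.
move=> x; apply: continuous_comp; last exact: continuous_expR.
apply: continuousN; apply: continuousM; first exact: cvg_cst.
exact: norm_continuous.
Qed.

Lemma abel_le1 e p : 0 < e -> 0 <= abel e p <= 1.
Proof.
move=> e0; rewrite expR_ge0/= -expR0 ler_expR oppr_le0 mulr_ge0//.
exact: ltW.
Qed.

Lemma abel_cvg (p : R) : abel (n.+1%:R^-1) p @[n --> \oo] --> (1 : R).
Proof.
rewrite -[X in _ --> X]expR0; apply: continuous_cvg; first exact: continuous_expR.
rewrite -oppr0; apply: cvgN; rewrite -[X in _ --> X](mul0r `|p|).
apply: cvgM; last exact: cvg_cst.
exact: cvg_harmonic.
Qed.

Let denom_neq0 (e t : R) : 0 < e -> e ^+ 2 + t ^+ 2 != 0.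
Proof. by move=> e0; rewrite gt_eqF// ltr_pwDl ?sqr_ge0// exprn_gt0. Qed.

(** Real part of the primitive in [p] of [exp (- (e - i t) p)]. *)
Let prim (e t p : R) : R :=
  expR (- (e * p)) * (t * sin (p * t) - e * cos (p * t)) / (e ^+ 2 + t ^+ 2).

Let is_derive_prim (e t p : R) : 0 < e ->
  is_derive p 1 (prim e t) (expR (- (e * p)) * cos (p * t)).
Proof.
move=> e0; rewrite /prim.
apply: is_derive_eq.
rewrite /GRing.scale/=; have := denom_neq0 t e0 => h.
by field.
Qed.

Let cos_int (e t : R) (n : nat) : 0 < e ->
  \int[mu]_(p in `[0, n%:R]) (abel e p * cos (p * t)) = prim e t n%:R - prim e t 0.
Proof.
move=> e0.
have cf : continuous (fun p : R => expR (- (e * p)) * cos (p * t)).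
  apply: (@continuous_is_derive _ _ (fun p => expR (- (e * p)) * (- sin (p * t) * t) + cos (p * t) * (expR (- (e * p)) * - e))) => p.
  by apply: is_derive_eq; rewrite /GRing.scale/=; ring.
rewrite -(FTC_itv (ler0n _ n) cf (fun p => is_derive_prim t p e0)).
by apply: eq_Int_set => p; rewrite inE/= in_itv/= => /andP[p0 _]; rewrite /abel ger0_norm.
Qed.

Let prim0 (e t : R) : prim e t 0 = - (e / (e ^+ 2 + t ^+ 2)).
Proof. by rewrite /prim mulr0 oppr0 expR0 mul0r sin0 cos0 mulr0 sub0r mulr1 mul1r mulNr. Qed.

Let expR_nat_cvg (e : R) : 0 < e -> expR (- (e * n%:R)) @[n --> \oo] --> (0 : R).
Proof.
move=> e0; apply: (cvg_comp (fun n : nat => e * n%:R) (fun x : R => expR (- x))); last exact: cvgr_expR.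
apply/cvgryPge => A; near=> n.
rewrite -ler_pdivrMl//; near: n; exact: nbhs_infty_ger.
Unshelve. all: by end_near. Qed.

Let prim_cvg (e t : R) : 0 < e -> prim e t n%:R @[n --> \oo] --> (0 : R).
Proof.
move=> e0; pose C := (`|t| + e) / (e ^+ 2 + t ^+ 2).
apply/cvgr0Pnorm_le => eps eps0.
have h := expR_nat_cvg e0.
have {}h : C * expR (- (e * n%:R)) @[n --> \oo] --> (0 : R).
  by rewrite -(mulr0 C); apply: cvgM => //; exact: cvg_cst.
move/cvgr0Pnorm_le : h => /(_ _ eps0); apply: filterS => n; apply: le_trans.
have D0 : 0 < e ^+ 2 + t ^+ 2 by rewrite ltr_pwDl ?sqr_ge0// exprn_gt0.
have -> : `|C * expR (- (e * n%:R))| = expR (- (e * n%:R)) * (`|t| + e) / (e ^+ 2 + t ^+ 2).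
  have C0 : 0 <= C by rewrite divr_ge0 ?addr_ge0 ?sqr_ge0 ?(ltW e0).
  by rewrite (ger0_norm (mulr_ge0 C0 (expR_ge0 _))) mulrC mulrA.
rewrite /prim 2!normrM (ger0_norm (expR_ge0 _)) normfV (gtr0_norm D0).
rewrite ler_wpM2r ?invr_ge0 ?(ltW D0)// ler_wpM2l ?expR_ge0//.
rewrite (le_trans (ler_normB _ _))// !normrM (gtr0_norm e0).
by rewrite lerD ?ler_piMr ?(ltW e0)//; [exact: sin_max|exact: cos_max].
Qed.

Lemma L1_abel e : 0 < e -> L1 (abel e).
Proof.
move=> e0; have [||||//] := @even_ge0_L1 _ (abel e) e^-1.
- exact: continuous_abel.
- by move=> x; rewrite /abel normrN.
- by move=> x; exact: expR_ge0.
(* The case [t = 0] of [cos_int]: the boundary term at [n] is nonpositive, and the one at 0 gives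
   [1 / e]. *)
- move=> n; rewrite (eq_Int_set (g := fun p => abel e p * cos (p * 0))); last first.
    by move=> x _; rewrite mulr0 cos0 mulr1.
  rewrite cos_int// prim0 /prim mul0r sub0r mulr0 cos0 mulr1.
  rewrite expr0n addr0 opprK.
  have -> : e / e ^+ 2 = e^-1 by field; rewrite gt_eqF.
  rewrite addrC gerDl mulrN mulNr oppr_le0 -mulrA mulr_ge0 ?expR_ge0//.
  by rewrite divr_ge0// ?ltW// exprn_gt0.
Qed.

Lemma Int_abel_cos e t : 0 < e ->
  Int (fun p => abel e p * cos (p * t)) = poisson e t.
Proof.
move=> e0; have cc : continuous (fun p : R => cos (p * t)).
  by apply: (@continuous_is_derive _ _ (fun p => - sin (p * t) * t)) => p; apply: is_derive_eq; rewrite /GRing.scale/=; ring.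
have cf : continuous (fun p : R => abel e p * cos (p * t)).
  by move=> x; apply: continuousM; [exact: continuous_abel|exact: cc].
rewrite (even_Int (l := e / (e ^+ 2 + t ^+ 2)))//.
- by rewrite /poisson mulrA.
- by move=> x; rewrite /abel normrN mulNr cosN.
- apply: L1M_bounded (L1_abel e0); first exact: continuous_measurable_fun.
  by move=> x; exact: cos_max.
- under eq_fun do rewrite cos_int// prim0 opprK.
  have := cvgD (prim_cvg t e0) (cvg_cst (e / (e ^+ 2 + t ^+ 2))).
  by rewrite add0r; apply.
Qed.

Lemma Int_abel_sin e t : 0 < e -> Int (fun p => abel e p * sin (p * t)) = 0.
Proof.
move=> e0; have cc : continuous (fun p : R => sin (p * t)).
  by apply: (@continuous_is_derive _ _ (fun p => cos (p * t) * t)) => p; apply: is_derive_eq; rewrite /GRing.scale/=; ring.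
have cf : continuous (fun p : R => abel e p * sin (p * t)).
  by move=> x; apply: continuousM; [exact: continuous_abel|exact: cc].
have f1 : L1 (fun p => abel e p * sin (p * t)).
  apply: L1M_bounded (L1_abel e0); first exact: continuous_measurable_fun.
  by move=> x; exact: sin_max.
have := Int_opp (continuous_measurable_fun cf).
under eq_Int do rewrite /abel normrN mulNr sinN mulrN -mulN1r.
rewrite IntZl//; move/eqP; rewrite mulN1r eq_sym -subr_eq0 opprK.
by rewrite -mulr2n mulrn_eq0/= => /eqP.
Qed.

Let is_derive_poisson (e s t : R) : 0 < e ->
  is_derive t 1 (fun t => 2 * atan ((t - s) / e)) (poisson e (t - s)).
Proof.
move=> e0; have e0' : e != 0 by rewrite gt_eqF.
have D0 := denom_neq0 (t - s) e0.
apply: is_derive_eq; rewrite /GRing.scale/= /poisson.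
have D1 : 1 + ((t - s) / e) ^+ 2 != 0 by rewrite gt_eqF// ltr_pwDl ?sqr_ge0.
by field; apply/andP.
Qed.

Lemma continuous_poisson e : 0 < e -> continuous (poisson e).
Proof.
move=> e0; apply: (@continuous_is_derive _ _ (fun t => - (4 * e * t) / (e ^+ 2 + t ^+ 2) ^+ 2)) => t.
have D0 := denom_neq0 t e0.
by apply: is_derive_eq; rewrite /GRing.scale/=; field.
Qed.

Lemma poisson_ge0 e t : 0 < e -> 0 <= poisson e t.
Proof. by move=> e0; rewrite divr_ge0 ?addr_ge0 ?sqr_ge0// mulr_ge0// ltW. Qed.

Lemma poissonN e t : poisson e (- t) = poisson e t.
Proof. by rewrite /poisson sqrrN. Qed.

Lemma poisson_itv e s x y : 0 < e -> x <= y ->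
  \int[mu]_(t in `[x, y]) poisson e (s - t) = 2 * atan ((y - s) / e) - 2 * atan ((x - s) / e).
Proof.
move=> e0 xy; rewrite (eq_Int_set (g := fun t : R => poisson e (t - s))); last first.
  by move=> t _; rewrite -poissonN opprB.
have cf : continuous (fun t : R => poisson e (t - s)).
  move=> t; apply: (continuous_comp (f := fun t => t - s) (g := poisson e)); last exact: continuous_poisson.
  by apply: continuousB => //; exact: cvg_cst.
by rewrite (FTC_itv xy cf (fun t => is_derive_poisson s t e0)).
Qed.

Lemma L1_poisson e : 0 < e -> L1 (poisson e) /\ Int (poisson e) <= 2 * pi.
Proof.
move=> e0; apply: even_ge0_L1.
- exact: continuous_poisson.
- exact: poissonN.
- by move=> x; exact: poisson_ge0.
- move=> n; rewrite (eq_Int_set (g := fun t : R => poisson e (0 - t))); last first.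
    by move=> t _; rewrite sub0r poissonN.
  rewrite poisson_itv// !subr0 mul0r atan0 mulr0 subr0.
  have := atan_ltpi2 (n%:R / e); lra.
Qed.

End poisson_kernel.

Section joint_measurability.
Context {R : realType}.
Implicit Types (f : R -> R) (K : R -> R -> R).

Lemma jmeasurable_fst f : measurable_fun setT f -> jmeasurable (fun x _ => f x).
Proof. by move=> mf; exact: measurableT_comp. Qed.

Lemma jmeasurable_snd f : measurable_fun setT f -> jmeasurable (fun _ y => f y).
Proof. by move=> mf; exact: measurableT_comp. Qed.

Lemma jmeasurable_sub f : measurable_fun setT f -> jmeasurable (fun x y => f (x - y)).
Proof. by move=> mf; apply: measurableT_comp => //; exact: measurable_funB. Qed.

Lemma jmeasurable_mul f : measurable_fun setT f -> jmeasurable (fun x y => f (x * y)).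
Proof. by move=> mf; apply: measurableT_comp => //; exact: measurable_funM. Qed.

Lemma jmeasurableM K1 K2 : jmeasurable K1 -> jmeasurable K2 ->
  jmeasurable (fun x y => K1 x y * K2 x y).
Proof. by move=> m1 m2; exact: measurable_funM. Qed.

End joint_measurability.

(** * Convolution *)

Section convolution.
Context {R : realType}.
Local Notation mu := (@lebesgue_measure R).
Implicit Types f g G : R -> R.

Lemma Int_reflect (c : R) f : measurable_fun setT f ->
  Int (fun x => f (c - x)) = Int f.
Proof.
move=> mf; rewrite -(Int_shift c mf) -[RHS]Int_opp.
  by apply: eq_Int => x; rewrite addrC.
by apply: measurableT_comp => //; exact: measurable_funD.
Qed.

Definition cv G f (x : R) : R := Int (fun y => G (x - y) * f y).

Lemma eq_L1 f g : f =1 g -> L1 f -> L1 g.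
Proof. by move=> /funext ->. Qed.

Lemma ae_le_L1 f g : measurable_fun setT f -> (forall x, 0 <= f x) ->
  (forall x, 0 <= g x) -> {ae mu, forall x, f x <= g x} -> L1 g ->
  L1 f /\ Int f <= Int g.
Proof.
move=> mf f0 g0 fg g1; apply: ge0_L1 => //; rewrite EFin_Int//.
apply: ae_ge0_le_integral => //.
- by move=> x _; rewrite lee_fin.
- exact/measurable_EFinP.
- by move=> x _; rewrite lee_fin.
- by apply/measurable_EFinP; exact: L1_meas.
- by apply: (ae_imp fg) => x + _; rewrite lee_fin.
Qed.

Lemma jmeasurable_cv G f : measurable_fun setT G -> measurable_fun setT f ->
  jmeasurable (fun x y => G (x - y) * f y).
Proof.
by move=> mG mf; apply: jmeasurableM; [exact: jmeasurable_sub|exact: jmeasurable_snd].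
Qed.

Lemma measurable_cv G f : measurable_fun setT G -> measurable_fun setT f ->
  measurable_fun setT (cv G f).
Proof. by move=> mG mf; apply: measurable_Int; exact: jmeasurable_cv. Qed.

Lemma tonelli_cv G f : L1 G -> L1 f ->
  (\int[mu]_(x in setT) \int[mu]_(y in setT) `|G (x - y) * f y|%:E < +oo)%E.
Proof.
move=> G1 f1; have mG := L1_meas G1; have mf := L1_meas f1.
have mK := jmeasurable_cv mG mf.
rewrite (fubini_tonelli (m1 := mu) (m2 := mu) (fun z : R * R => `|G (z.1 - z.2) * f z.2|%:E)%E)//; last first.
  by apply/measurable_EFinP; apply: measurableT_comp.
apply: (@le_lt_trans _ _ (\int[mu]_(y in setT) (Int (fun x => `|G x|) * `|f y|)%:E)%E); last first.
  by rewrite -EFin_Int ?ltry//; apply/L1Zl/L1_norm.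
apply: ge0_le_integral => //.
- by move=> y _; apply: integral_ge0 => x _; rewrite lee_fin.
- by apply: (measurable_Int_norm (K := fun y x => G (x - y) * f y)); exact: (jmeasurableC mK).
- by apply/measurable_EFinP; apply: measurable_funM => //; exact: measurableT_comp.
- move=> y _; have Gy : L1 (fun x => G (x - y)) by exact: L1_shift.
  under eq_integral do rewrite /= normrM mulrC.
  rewrite -EFin_Int; last by apply/L1Zl/L1_norm.
  rewrite lee_fin IntZl; last exact: L1_norm.
  rewrite (Int_shift (- y) (f := fun x => `|G x|))//; last exact: measurableT_comp.
  by rewrite mulrC.
Qed.

Lemma young1 G f : L1 G -> L1 f ->
  L1 (cv G f) /\ {ae mu, forall x, L1 (fun y => G (x - y) * f y)}.
Proof.
move=> G1 f1; have mK := jmeasurable_cv (L1_meas G1) (L1_meas f1).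
by have [] := Fubini_Int mK (tonelli_cv G1 f1).
Qed.

(** Write [|G| |f|] as [|G|^(1/2)] times [|G|^(1/2) |f|], apply Cauchy-Schwarz at almost every [x],
    and integrate: what remains is the convolution of the integrable functions [|G|] and [f ^ 2]. *)
Lemma young2 G f : L1 G -> L2 f ->
  [/\ L2 (cv G f), n2 (cv G f) <= (Int (fun x => `|G x|)) ^+ 2 * n2 f &
      {ae mu, forall x, L1 (fun y => G (x - y) * f y)}].
Proof.
move=> G1 f2; have mG := L1_meas G1; have mf := L2_meas f2.
have Gn := L1_norm G1; have ff := L2_sqr f2.
have mGn := L1_meas Gn; have mff := L1_meas ff.
have mK := jmeasurable_cv mGn mff.
have [M1 aeM IM] := Fubini_Int mK (tonelli_cv Gn ff).
have {}IM : Int (cv (fun x => `|G x|) (fun y => f y ^+ 2)) = Int (fun x => `|G x|) * n2 f.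
  rewrite /cv IM -IntZl//; apply: eq_Int => y.
  under eq_Int do rewrite mulrC.
  rewrite IntZl; last exact: (L1_shift (- y) Gn).
  by rewrite (Int_shift (- y) mGn) mulrC.
(* Since [|f| <= 1 + f ^ 2], integrability of [|G| f ^ 2] passes to [G f]. *)
have GL1 x : L1 (fun y => `|G (x - y)| * f y ^+ 2) -> L1 (fun y => G (x - y) * f y).
  move=> h; have Gx : L1 (fun y => `|G (x - y)|) by exact: (L1_reflect x Gn).
  apply: L1_le (L1D Gx h).
    apply: measurable_funM => //; apply: measurableT_comp => //; exact: measurable_funB.
  move=> y; rewrite normrM -[X in _ <= X + _]mulr1 -mulrDr ler_wpM2l//.
  rewrite -(real_normK (num_real (f y))); have := normr_ge0 (f y); nra.
have ae1 : {ae mu, forall x, L1 (fun y => G (x - y) * f y)} by apply: (ae_imp aeM) => x /GL1.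
have mcv := measurable_cv mG mf.
have ae2 : {ae mu, forall x, cv G f x ^+ 2 <= Int (fun x => `|G x|) * cv (fun x => `|G x|) (fun y => f y ^+ 2) x}.
  apply: (ae_imp aeM) => x h; have Gx : L1 (fun y => `|G (x - y)|) by exact: (L1_reflect x Gn).
  have Gxf := GL1 _ h.
  pose r (y : R) : R := Num.sqrt `|G (x - y)|.
  have mr : measurable_fun setT r.
    apply: (@measurableT_comp _ _ _ _ _ _ (@Num.sqrt R)) => //; last exact: (L1_meas Gx).
    by apply: continuous_measurable_fun; exact: sqrt_continuous.
  have r2 y : r y ^+ 2 = `|G (x - y)| by rewrite /r sqr_sqrtr.
  have l1 : L2 r by apply/L2P; split => //; apply: (eq_L1 _ Gx) => y; rewrite r2.
  have l2 : L2 (fun y => r y * `|f y|).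
    apply/L2P; split; first by apply: measurable_funM => //; exact: measurableT_comp.
    by apply: (eq_L1 _ h) => y; rewrite exprMn r2 real_normK ?num_real.
  have := cauchy_schwarz l1 l2.
  under eq_Int do rewrite mulrA -expr2 r2 -normrM.
  under [X in _ <= X * _ -> _]eq_Int do rewrite r2.
  under [X in _ <= _ * X -> _]eq_Int do rewrite exprMn r2 real_normK ?num_real//.
  rewrite (Int_reflect x mGn) => /(le_trans _); apply.
  have -> : cv G f x = Int (fun y => G (x - y) * f y) by [].
  rewrite -[leLHS]real_normK ?num_real// lerXn2r ?nnegrE ?Int_ge0//.
  exact: norm_Int.
have [||||l i] := ae_le_L1 _ _ _ ae2.
- exact: measurable_funX.
- by move=> x; exact: sqr_ge0.
- by move=> x; rewrite mulr_ge0 ?Int_ge0// => y; rewrite mulr_ge0 ?sqr_ge0.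
- exact: L1Zl.
split => //; first by apply/L2P; split.
by rewrite (le_trans i)// IntZl// IM mulrA -expr2.
Qed.

(** Linearity is claimed only almost everywhere, because for [f] in [L2] the convolution integral
    may diverge on a null set. *)
Lemma cvB G f g : L1 G -> L2 f -> L2 g ->
  {ae mu, forall x, cv G (fun y => f y - g y) x = cv G f x - cv G g x}.
Proof.
move=> G1 f2 g2; have [_ _ af] := young2 G1 f2; have [_ _ ag] := young2 G1 g2.
apply: (ae_imp2 af ag) => x fx gx; rewrite /cv -IntB//.
by apply: eq_Int => y; rewrite mulrBr.
Qed.

End convolution.

(** * The Hartley transform *)

Section hartley.
Context {R : realType}.
Local Notation mu := (@lebesgue_measure R).
Implicit Types f g G w : R -> R.

Lemma le_of_sqr (a b : R) : 0 <= b -> a ^+ 2 <= b ^+ 2 -> a <= b.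
Proof. by move=> b0 h; rewrite leNgt; apply/negP => ab; nra. Qed.

(* [hart f] is [Re \hat f - Im \hat f]. *)
Definition cas (x : R) : R := cos x + sin x.
Definition hart f (p : R) : R := (Num.sqrt (2 * pi))^-1 * Int (fun x => f x * cas (p * x)).

Lemma measurable_cas : measurable_fun setT cas.
Proof.
by apply: measurable_funD; apply: continuous_measurable_fun; [exact: continuous_cos|exact: continuous_sin].
Qed.

Lemma norm_cas x : `|cas x| <= 2.
Proof.
by rewrite (le_trans (ler_normD _ _))// (_ : 2 = 1 + 1 :> R) ?lerD ?cos_max ?sin_max.
Qed.

Lemma jmeasurable_cas : jmeasurable (fun x y => cas (x * y)).
Proof. exact: (jmeasurable_mul measurable_cas). Qed.

Lemma jmeasurable_casC : jmeasurable (fun x y => cas (y * x)).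
Proof. exact: (jmeasurableC jmeasurable_cas). Qed.

(** Against an even weight in the frequency, the cosine of the difference produces the Poisson
    kernel, while the sine of the sum integrates to zero. *)
Lemma cas_mul x y : cas x * cas y = cos (x - y) + sin (x + y).
Proof. by rewrite /cas cosB sinD; ring. Qed.

Lemma casD x y : cas (x + y) = cos x * cas y + sin x * cas (- y).
Proof. by rewrite /cas cosD sinD cosN sinN; ring. Qed.

Lemma sqrt2pi_gt0 : 0 < Num.sqrt (2 * pi) :> R.
Proof. by rewrite sqrtr_gt0 mulr_gt0// pi_gt0. Qed.

Lemma sqr_sqrt2piV : (Num.sqrt (2 * pi))^-1 ^+ 2 = (2 * pi)^-1 :> R.
Proof. by rewrite exprVn sqr_sqrtr// mulr_ge0// pi_ge0. Qed.

Lemma L1_cas f p : L1 f -> L1 (fun x => f x * cas (p * x)).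
Proof.
move=> f1; apply: L1M_bounded f1; last by move=> x; exact: norm_cas.
by apply: measurableT_comp; [exact: measurable_cas|exact: measurable_funM].
Qed.

Lemma measurable_hart f : measurable_fun setT f -> measurable_fun setT (hart f).
Proof.
move=> mf; apply: measurable_funM => //; apply: measurable_Int.
by apply: jmeasurableM; [exact: jmeasurable_snd|exact: jmeasurable_cas].
Qed.

Let hr f (p : R) := Int (fun x => f x * cas (p * x)).

Let norm_hr f p : L1 f -> `|hr f p| <= 2 * Int (fun x => `|f x|).
Proof.
move=> f1; rewrite (le_trans (norm_Int _))//; first exact: L1_cas.
rewrite -IntZl; last exact: L1_norm.
apply: le_Int; [exact/L1_norm/L1_cas|exact/L1Zl/L1_norm|].
by move=> x; rewrite normrM mulrC ler_wpM2r ?norm_cas.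
Qed.

Lemma norm_hart f p : L1 f ->
  `|hart f p| <= (Num.sqrt (2 * pi))^-1 * (2 * Int (fun x => `|f x|)).
Proof.
move=> f1; rewrite normrM ger0_norm ?invr_ge0 ?sqrtr_ge0//.
by rewrite ler_wpM2l ?invr_ge0 ?sqrtr_ge0// norm_hr.
Qed.

Let measurable_hr f : measurable_fun setT f -> measurable_fun setT (hr f).
Proof.
move=> mf; apply: measurable_Int.
by apply: jmeasurableM; [exact: jmeasurable_snd|exact: jmeasurable_cas].
Qed.

(* Fubini against the integrable weight [abel e], whose cosine transform is
   the Poisson kernel. *)
Lemma hart_abel f g (e : R) : 0 < e -> L1 f -> L1 g ->
  L1 (fun p => hart f p * hart g p * abel e p) /\
  Int (fun p => hart f p * hart g p * abel e p) =
  (2 * pi)^-1 * Int (fun s => f s * Int (fun t => g t * poisson e (s - t))).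
Proof.
move=> e0 f1 g1; have A1 := L1_abel e0.
have mhf := measurable_hr (L1_meas f1); have mhg := measurable_hr (L1_meas g1).
have Ag1 : L1 (fun p => abel e p * hr g p).
  by apply: (L1M_bounded mhg _ A1) => p; exact: norm_hr.
have Agf1 : L1 (fun p => abel e p * hr g p * hr f p).
  by apply: (L1M_bounded mhf _ Ag1) => p; exact: norm_hr.
have -> : (fun p => hart f p * hart g p * abel e p) =
    (fun p => (2 * pi)^-1 * (abel e p * hr g p * hr f p)).
  by apply: funext => p; rewrite -sqr_sqrt2piV /hart -/(hr f p) -/(hr g p); ring.
split; first exact: L1Zl.
rewrite IntZl//; congr (_ * _).
rewrite (Fubini_bounded Ag1 f1 jmeasurable_cas (fun x y => norm_cas _)).
apply: eq_Int => s; congr (_ * _).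
have Ac1 : L1 (fun p => abel e p * cas (p * s)).
  apply: (L1M_bounded _ _ A1); last by move=> p; exact: norm_cas.
  by apply: measurableT_comp; [exact: measurable_cas|exact: measurable_funM].
transitivity (Int (fun p => abel e p * cas (p * s) * hr g p)).
  by apply: eq_Int => p; rewrite mulrAC.
rewrite (Fubini_bounded Ac1 g1 jmeasurable_cas (fun x y => norm_cas _)).
apply: eq_Int => t; congr (_ * _).
rewrite -Int_abel_cos//.
have mc x : measurable_fun setT (fun p : R => cos (p * x)).
  by apply: measurableT_comp; [apply: continuous_measurable_fun; exact: continuous_cos|exact: measurable_funM].
have ms x : measurable_fun setT (fun p : R => sin (p * x)).
  by apply: measurableT_comp; [apply: continuous_measurable_fun; exact: continuous_sin|exact: measurable_funM].
have i1 : L1 (fun p => abel e p * cos (p * (s - t))).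
  by apply: (L1M_bounded (mc _) _ A1) => p; exact: cos_max.
have i2 : L1 (fun p => abel e p * sin (p * (s + t))).
  by apply: (L1M_bounded (ms _) _ A1) => p; exact: sin_max.
rewrite -[RHS]addr0 -(Int_abel_sin (s + t) e0) -IntD//.
by apply: eq_Int => p; rewrite -mulrA cas_mul -mulrDr -mulrBr -mulrDr.
Qed.

(** With the weight, the left side is [(2 pi)^-1] times the inner product of [f] with its Poisson
    convolution. Cauchy-Schwarz and Young bound it by [n2 f], as the kernel has mass at most [2 pi];
    Fatou removes the weight along [e = 1 / (n + 1)]. *)
Lemma L2_bessel f : L1 f -> L2 f -> L2 (hart f) /\ n2 (hart f) <= n2 f.
Proof.
move=> f1 f2; have mh := measurable_hart (L1_meas f1).
have E n : (0 : R) < n.+1%:R^-1 by [].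
have [||||l i] := @fatou_Int _ (fun n p => hart f p * hart f p * abel n.+1%:R^-1 p) (fun p => hart f p ^+ 2) (n2 f).
- by move=> n; have [] := hart_abel (E n) f1 f1.
- move=> n x; rewrite -expr2 mulr_ge0 ?sqr_ge0//.
  by case/andP: (abel_le1 x (E n)).
- move=> x; have := cvgM (cvg_cst (hart f x * hart f x)) (abel_cvg x).
  by rewrite mulr1 -expr2; apply.
- move=> n; have [_ ->] := hart_abel (E n) f1 f1.
  have [P1 Ppi] := L1_poisson (E n).
  have [c2 c2f _] := young2 P1 f2.
  have P0 x : 0 <= poisson n.+1%:R^-1 x := poisson_ge0 x (E n).
  have nP : Int (fun x : R => `|poisson n.+1%:R^-1 x|) = Int (poisson n.+1%:R^-1).
    by apply: eq_Int => x; rewrite ger0_norm.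
  have pi0 : 0 < 2 * pi :> R by rewrite mulr_gt0// pi_gt0.
  rewrite ler_pdivrMl//.
  set I := Int _.
  have -> : I = Int (fun s => f s * cv (poisson n.+1%:R^-1) f s).
    by apply: eq_Int => s; congr (_ * _); apply: eq_Int => t; rewrite mulrC.
  have h := cauchy_schwarz f2 c2.
  have n0 := n2_ge0 f.
  apply: le_of_sqr; first by rewrite mulr_ge0// ltW.
  apply: (le_trans h); rewrite exprMn expr2 [leRHS]mulrC -[leRHS]mulrA ler_wpM2l// mulrC.
  rewrite (le_trans c2f)// nP ler_wpM2r// lerXn2r ?nnegrE ?(ltW pi0)//.
  exact: Int_ge0.
- by split => //; apply/L2P; split.
Qed.

(** [costr G - i sintr G] is [sqrt (2 pi)] times the Fourier transform of [G]. *)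
Definition costr G (p : R) := Int (fun x => G x * cos (p * x)).
Definition sintr G (p : R) := Int (fun x => G x * sin (p * x)).

Let mcosM p : measurable_fun setT (fun x : R => cos (p * x)).
Proof.
by apply: measurableT_comp; [apply: continuous_measurable_fun; exact: continuous_cos|exact: measurable_funM].
Qed.

Let msinM p : measurable_fun setT (fun x : R => sin (p * x)).
Proof.
by apply: measurableT_comp; [apply: continuous_measurable_fun; exact: continuous_sin|exact: measurable_funM].
Qed.

Lemma L1_cos G p : L1 G -> L1 (fun x => G x * cos (p * x)).
Proof. by move=> G1; apply: (L1M_bounded (mcosM p) _ G1) => x; exact: cos_max. Qed.

Lemma L1_sin G p : L1 G -> L1 (fun x => G x * sin (p * x)).
Proof. by move=> G1; apply: (L1M_bounded (msinM p) _ G1) => x; exact: sin_max. Qed.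

(** By [casD] a shift by [y] mixes the kernels at [p] and [- p]. The right side is the real form of
    multiplying the Fourier transform of [f] by [costr G - i sintr G]. *)
Lemma hart_cv G f p : L1 G -> L1 f ->
  hart (cv G f) p = costr G p * hart f p + sintr G p * hart f (- p).
Proof.
move=> G1 f1; have mG := L1_meas G1; have mf := L1_meas f1.
have [_ aeL] := young1 G1 f1.
pose K x y := G (x - y) * f y * cas (p * x).
have mK : jmeasurable K.
  apply: jmeasurableM; first exact: jmeasurable_cv.
  by apply: jmeasurable_fst; apply: measurableT_comp; [exact: measurable_cas|exact: measurable_funM].
have [|_ aeK EK] := Fubini_Int mK.
  have := tonelli_cv (L1Zl 2 G1) f1; apply: le_lt_trans.
  apply: ge0_le_integral => //.
  - by move=> x _; apply: integral_ge0 => y _; rewrite lee_fin.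
  - exact: measurable_Int_norm.
  - apply: (measurable_Int_norm (K := fun x y => 2 * G (x - y) * f y)).
    by apply: (jmeasurable_cv (G := fun x => 2 * G x)) => //; exact: measurable_funM.
  - move=> x _; apply: ge0_le_integral => //.
    + by apply/measurable_EFinP; apply: measurableT_comp => //; exact: jmeasurable_l.
    + apply/measurable_EFinP; apply: measurableT_comp => //.
      apply: (jmeasurable_l (K := fun x y => 2 * G (x - y) * f y)).
      by apply: (jmeasurable_cv (G := fun x => 2 * G x)) => //; exact: measurable_funM.
    + move=> y _; rewrite lee_fin /K -[X in _ <= `|X|]mulrA !normrM mulrC.
      by rewrite ler_wpM2r ?mulr_ge0// (le_trans (norm_cas _))// ler_norm.
have -> : hart (cv G f) p = (Num.sqrt (2 * pi))^-1 * Int (fun x => Int (K x)).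
  congr (_ * _); apply: ae_eq_Int.
  - apply: measurable_funM; first exact: measurable_cv.
    by apply: measurableT_comp; [exact: measurable_cas|exact: measurable_funM].
  - exact: measurable_Int.
  - apply: (ae_imp aeL) => x hx; rewrite mulrC -IntZl//.
    by apply: eq_Int => y; rewrite mulrC.
rewrite EK /hart [costr G p * _]mulrCA [sintr G p * _]mulrCA -mulrDr; congr (_ * _).
have fp := L1_cas p f1; have fn := L1_cas (- p) f1.
rewrite -(IntZl (costr G p) fp) -(IntZl (sintr G p) fn).
rewrite -(IntD (L1Zl (costr G p) fp) (L1Zl (sintr G p) fn)).
apply: eq_Int => y.
rewrite /costr /sintr.
transitivity (f y * Int (fun x => G x * cas (p * (x + y)))).
  rewrite -IntZl; last first.
    have := L1_shift y (L1_cas p (L1_shift (- y) G1)).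
    by apply: eq_L1 => x; rewrite addrK.
  rewrite -(Int_shift y); last first.
    apply: measurable_funM; last by apply: measurableT_comp; [exact: measurable_cas|exact: measurable_funM].
    by apply: measurable_funM => //; apply: measurableT_comp => //; exact: measurable_funB.
  by apply: eq_Int => x; rewrite /K addrK; ring.
have -> : Int (fun x => G x * cas (p * (x + y))) =
    Int (fun x => G x * cos (p * x)) * cas (p * y) + Int (fun x => G x * sin (p * x)) * cas (- p * y).
  have Gc := L1_cos p G1; have Gs := L1_sin p G1.
  rewrite ![Int _ * _]mulrC -(IntZl (cas (p * y)) Gc) -(IntZl (cas (- p * y)) Gs).
  rewrite -(IntD (L1Zl _ Gc) (L1Zl _ Gs)).
  by apply: eq_Int => x; rewrite [p * (x + y)]mulrDr casD mulNr; ring.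
by ring.
Qed.

Lemma ae_neq (x : R) : {ae mu, forall s, s != x}.
Proof.
exists [set x]; split => //; first exact: lebesgue_measure_set1.
by move=> s /= /negP; rewrite negbK => /eqP.
Qed.

Let atan_cvg (a : R) : atan (a / n.+1%:R^-1) @[n --> \oo] --> Num.sg a * (pi / 2).
Proof.
have pos (b : R) : 0 < b -> atan (b / n.+1%:R^-1) @[n --> \oo] --> pi / 2.
  move=> b0; apply: (cvg_comp (fun n : nat => b / n.+1%:R^-1) (@atan R)); last exact: cvgy_atan.
  apply/cvgryPge => A; near=> n.
  rewrite invrK -ler_pdivrMl// (@le_trans _ _ n%:R)// ?ler_nat//; near: n; exact: nbhs_infty_ger.
have [a0|a0|->] := ltgtP a 0.
- rewrite ltr0_sg// mulN1r.
  rewrite (_ : (fun n => _) = fun n : nat => - atan (- a / n.+1%:R^-1)).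
    by apply: cvgN; apply: pos; rewrite oppr_gt0.
  by apply: funext => n; rewrite mulNr atanN opprK.
- by rewrite gtr0_sg// mul1r; exact: pos.
- by rewrite sgr0 mul0r; apply: cvg_near_cst; apply: nearW => n; rewrite mul0r atan0.
Unshelve. all: by end_near. Qed.

(** With the Abel weight inserted, [w] is paired with the Poisson convolution of the indicator, an
    explicit difference of arctangents that tends to [2 pi] times the indicator away from the
    endpoints. Bessel supplies the dominating function for removing the weight. *)
Lemma parseval_indic w x y : L1 w -> L2 w -> x <= y ->
  Int (fun p => hart w p * hart (\1_`[x, y]) p) = \int[mu]_(t in `[x, y]) w t.
Proof.
move=> w1 w2 xy; pose i : R -> R := \1_`[x, y].
have i1 : L1 i by exact: L1_indic_itv. have i2 : L2 i by exact: L2_indic_itv.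
have [hw2 _] := L2_bessel w1 w2; have [hi2 _] := L2_bessel i1 i2.
have mhw := L2_meas hw2; have mhi := L2_meas hi2.
have E n : (0 : R) < n.+1%:R^-1 by [].
have c1 : Int (fun p => hart w p * hart i p * abel n.+1%:R^-1 p) @[n --> \oo] --> Int (fun p => hart w p * hart i p).
  apply: (dominated_Int (f_ := fun n p => hart w p * hart i p * abel n.+1%:R^-1 p) (g := fun p => `|hart w p * hart i p|) _ _ _ _).2.
  - move=> n; apply: measurable_funM; first exact: measurable_funM.
    by apply: continuous_measurable_fun; exact: continuous_abel.
  - move=> p; have := cvgM (cvg_cst (hart w p * hart i p)) (abel_cvg p).
    by rewrite mulr1; apply.
  - exact/L1_norm/L2_mul.
  - move=> n p; rewrite normrM ler_piMr//.
    by have /andP[? ?] := abel_le1 p (E n); rewrite ger0_norm.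
pose J n s : R := 2 * atan ((y - s) / n.+1%:R^-1) - 2 * atan ((x - s) / n.+1%:R^-1).
have EJ n : Int (fun p => hart w p * hart i p * abel n.+1%:R^-1 p) = (2 * pi)^-1 * Int (fun s => w s * J n s).
  rewrite (hart_abel (E n) w1 i1).2; congr (_ * _); apply: eq_Int => s; congr (_ * _).
  rewrite /J -poisson_itv// [RHS]Rintegral_indic; apply: eq_Int => t; exact: mulrC.
have mJ n : measurable_fun setT (J n).
  by apply: measurable_funB; apply: measurable_funM => //; apply: measurableT_comp => //;
    [apply: continuous_measurable_fun; exact: continuous_atan|apply: measurable_funM => //; exact: measurable_funB|apply: continuous_measurable_fun; exact: continuous_atan|apply: measurable_funM => //; exact: measurable_funB].
pose L s : R := 2 * (Num.sg (y - s) * (pi / 2)) - 2 * (Num.sg (x - s) * (pi / 2)).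
have [||||wL1 c2] := @dominated_Int _ (fun n s => w s * J n s) (fun s => w s * L s) (fun s => 2 * pi * `|w s|).
- by move=> n; apply: measurable_funM => //; exact: L1_meas.
- move=> s; apply: cvgM; first exact: cvg_cst.
  by apply: cvgB; (apply: cvgM; [exact: cvg_cst|exact: atan_cvg]).
- exact/L1Zl/L1_norm.
- move=> n s; rewrite normrM mulrC ler_wpM2r// /J ler_norml.
  have := atan_ltpi2 ((y - s) / n.+1%:R^-1); have := atan_ltpi2 ((x - s) / n.+1%:R^-1).
  have := atan_gtNpi2 ((y - s) / n.+1%:R^-1); have := atan_gtNpi2 ((x - s) / n.+1%:R^-1).
  by move=> ? ? ? ?; apply/andP; split; lra.
have {}c2 : Int (fun p => hart w p * hart i p * abel n.+1%:R^-1 p) @[n --> \oo] --> (2 * pi)^-1 * Int (fun s => w s * L s).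
  rewrite (_ : (fun n => _) = fun n => (2 * pi)^-1 * Int (fun s => w s * J n s)); last exact: funext.
  by apply: cvgM => //; exact: cvg_cst.
rewrite (cvg_unique _ c1 c2)// [RHS]Rintegral_indic.
have pi0 : pi != 0 :> R by rewrite gt_eqF// pi_gt0.
have wi1 : L1 (fun s => w s * i s) by apply: L2_mul.
rewrite (_ : Int (fun s => w s * L s) = Int (fun s => 2 * pi * (w s * i s))).
  by rewrite IntZl// mulrA mulVf ?mul1r// mulf_neq0.
apply: ae_eq_Int; [exact: L1_meas|exact: (L1_meas (L1Zl _ wi1))|].
apply: (ae_imp2 (ae_neq x) (ae_neq y)) => s sx sy.
rewrite mulrCA mulrA mulrAC -mulrA; congr (_ * _).
rewrite /L /i indicE mem_setE/= in_itv/=.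
move: sx sy; rewrite !neq_lt => /orP[sx|sx] /orP[sy|sy].
- by rewrite !gtr0_sg ?subr_gt0// leNgt sx/= subrr mul0r.
- by move: xy; rewrite leNgt (lt_trans sy sx).
- by rewrite gtr0_sg ?subr_gt0// ltr0_sg ?subr_lt0// !ltW//=; field.
- by rewrite !ltr0_sg ?subr_lt0// [s <= y]leNgt sy andbF subrr mul0r.
Qed.

End hartley.

(** * The linear equation *)

Section linear_solver.
Context {R : realType}.
Local Notation mu := (@lebesgue_measure R).
Implicit Types (f g G A B phi psi Phi Psi : R -> R) (x y p : R).

(** The kernel [cas (p * t)] is symmetric, so integrating a transform over an interval amounts to
    testing the function against the transform of the indicator. *)
Lemma Rintegral_hart Phi x y : L1 Phi -> x <= y ->
  \int[mu]_(t in `[x, y]) hart Phi t = Int (fun p => Phi p * hart (\1_`[x, y]) p).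
Proof.
move=> P1 xy; have i1 := L1_indic_itv x y; have c0 := sqrt2pi_gt0 (R := R).
have mh : L1 (fun t => \1_`[x, y] t * Int (fun p => Phi p * cas (t * p))).
  apply: (L1M_bounded (C := 2 * Int (fun x => `|Phi x|)) _ _ i1).
    by apply: measurable_Int; apply: jmeasurableM; [exact: (jmeasurable_snd (L1_meas P1))|exact: jmeasurable_cas].
  move=> t; rewrite (le_trans (norm_Int (L1_cas t P1)))// -IntZl; last exact: L1_norm.
  apply: le_Int; [exact/L1_norm/L1_cas|exact/L1Zl/L1_norm|].
  by move=> p; rewrite normrM mulrC ler_wpM2r ?norm_cas.
have mh' : L1 (fun p => Phi p * Int (fun t => \1_`[x, y] t * cas (t * p))).
  apply: (L1M_bounded (C := 2 * Int (fun t => `|\1_`[x, y] t|)) _ _ P1).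
    by apply: measurable_Int; apply: jmeasurableM; [exact: (jmeasurable_snd (L1_meas i1))|exact: jmeasurable_casC].
  move=> t; have ic : L1 (fun s => \1_`[x, y] s * cas (s * t)).
    by apply: eq_L1 (L1_cas t i1) => s; rewrite (mulrC t).
  rewrite (le_trans (norm_Int ic))// -IntZl; last exact: L1_norm.
  apply: le_Int; [exact/L1_norm|exact/L1Zl/L1_norm|].
  by move=> p; rewrite normrM mulrC ler_wpM2r ?norm_cas.
rewrite Rintegral_indic /hart.
transitivity ((Num.sqrt (2 * pi))^-1 * Int (fun t => \1_`[x, y] t * Int (fun p => Phi p * cas (t * p)))).
  by rewrite -IntZl//; apply: eq_Int => t; rewrite mulrC mulrCA.
rewrite (Fubini_bounded i1 P1 jmeasurable_cas (fun x y => norm_cas _)) -IntZl//.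
by apply: eq_Int => p; rewrite mulrCA; congr (_ * (_ * _)); apply: eq_Int => t; rewrite (mulrC p).
Qed.

(** In [t], the function [p * cas (p * t)] has primitive [sin (p * t) - cos (p * t)]; keeping the
    factor [p] avoids a division at 0. *)
Lemma mul_hart_indic x y p : x <= y ->
  p * hart (\1_`[x, y]) p = (Num.sqrt (2 * pi))^-1 * (cas (- (p * x)) - cas (- (p * y))).
Proof.
move=> xy; rewrite /hart mulrCA; congr (_ * _).
have -> : Int (fun t => \1_`[x, y] t * cas (p * t)) = \int[mu]_(t in `[x, y]) cas (p * t).
  by rewrite [RHS]Rintegral_indic; apply: eq_Int => t; exact: mulrC.
have cc : continuous (fun t : R => p * cas (p * t)).
  apply: (@continuous_is_derive _ _ (fun t => p * (p * (cos (p * t) - sin (p * t))))) => t.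
  by rewrite /cas; apply: is_derive_eq; rewrite /GRing.scale/=; ring.
have dF (t : R) : is_derive t 1 (fun t => sin (p * t) - cos (p * t)) (p * cas (p * t)).
  by rewrite /cas; apply: is_derive_eq; rewrite /GRing.scale/=; ring.
have := FTC_itv xy cc dF.
rewrite RintegralZl//; last first.
  apply/(integrable_indicE (fun t => cas (p * t)) (measurable_itv _)).
  apply: eq_L1 (L1_cas p (L1_indic_itv x y)) => t; exact: mulrC.
by move=> ->; rewrite /cas !cosN !sinN; ring.
Qed.

(** Integrated form of the rule that the derivative of [hart Phi] is the transform of
    [p |-> - p * Phi (- p)]. In this form it can be used twice, although [p ^ 2 * Phi] need not be
    integrable. *)
Lemma hart_sub Phi x y : L1 Phi -> x <= y ->
  hart Phi y - hart Phi x = Int (fun p => - p * Phi (- p) * hart (\1_`[x, y]) p).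
Proof.
move=> P1 xy; have Py := L1_cas y P1; have Px := L1_cas x P1.
rewrite /hart -mulrBr -IntB// -IntZl; last exact: L1B.
rewrite -Int_opp; last by apply: L1_meas; apply: L1Zl; exact: L1B.
apply: eq_Int => p; rewrite -/(hart _ p).
rewrite mulrAC mulNr mul_hart_indic// !mulrN -mulrBr.
by rewrite ![p * _]mulrC; ring.
Qed.

Lemma sqrD_le (x y : R) : (x + y) ^+ 2 <= 2 * x ^+ 2 + 2 * y ^+ 2.
Proof. by rewrite -subr_ge0 (_ : _ - _ = (x - y) ^+ 2) ?sqr_ge0//; ring. Qed.

(** Cauchy-Schwarz on each product. The 8 is [2 ^ 2] from [|cas| <= 2] times 2 from [sqrD_le]; the
    [2 pi] is the normalisation of the transform. *)
Lemma sqr_hart_le A B phi psi p : L2 A -> L2 B -> L2 phi -> L2 psi ->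
  hart (fun p => A p * phi p + B p * psi p) p ^+ 2 <=
  8 / (2 * pi) * (n2 A * n2 phi + n2 B * n2 psi).
Proof.
move=> A2 B2 f2 g2.
have Af := L2_mul A2 f2; have Bg := L2_mul B2 g2; have S1 := L1D Af Bg.
have aux C phi' : L2 C -> L2 phi' -> Int (fun x => `|C x * phi' x|) ^+ 2 <= n2 C * n2 phi'.
  move=> C2 p2; have := cauchy_schwarz (L2_norm C2) (L2_norm p2).
  under eq_Int do rewrite -normrM.
  under [X in _ <= X * _ -> _]eq_Int do rewrite real_normK ?num_real//.
  by under [X in _ <= _ * X -> _]eq_Int do rewrite real_normK ?num_real//.
pose N := Int (fun x => `|A x * phi x + B x * psi x|).
have N0 : 0 <= N by exact: Int_ge0.
have NS : N ^+ 2 <= 2 * (n2 A * n2 phi + n2 B * n2 psi).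
  have h1 := aux _ _ A2 f2; have h2 := aux _ _ B2 g2.
  have h3 : N <= Int (fun x => `|A x * phi x|) + Int (fun x => `|B x * psi x|).
    rewrite -IntD; [|exact: L1_norm|exact: L1_norm].
    apply: le_Int; [exact: L1_norm|by apply: L1D; exact: L1_norm|].
    by move=> x; exact: ler_normD.
  rewrite (@le_trans _ _ ((Int (fun x => `|A x * phi x|) + Int (fun x => `|B x * psi x|)) ^+ 2))//.
    by rewrite lerXn2r ?nnegrE// addr_ge0// Int_ge0.
  rewrite (le_trans (sqrD_le _ _))// mulrDr lerD// ler_pM2l//.
have c0 := sqrt2pi_gt0 (R := R).
have h := norm_hart p S1; rewrite -/N in h.
rewrite -real_normK ?num_real// (@le_trans _ _ (((Num.sqrt (2 * pi))^-1 * (2 * N)) ^+ 2))//.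
  by rewrite lerXn2r ?nnegrE// mulr_ge0 ?invr_ge0 ?sqrtr_ge0// mulr_ge0.
rewrite -[leRHS]mulrA [leRHS]mulrCA exprMn sqr_sqrt2piV ler_wpM2l//.
  by rewrite invr_ge0 mulr_ge0// pi_ge0.
by rewrite exprMn; move: NS; lra.
Qed.

(** [poisson 1] serves here as an integrable majorant of order [1 / (1 + p ^ 2)] whose mass is
    already bounded. *)
Lemma L2_weight A (M : R) : measurable_fun setT A ->
  (forall p, A p ^+ 2 <= M * poisson 1 p) -> L2 A /\ n2 A <= M * (2 * pi).
Proof.
move=> mA h; have [P1 P2] := L1_poisson (ltr01 (R := R)).
have M0 : 0 <= M.
  have := le_trans (sqr_ge0 _) (h 0); rewrite pmulr_lge0//.
  by rewrite /poisson expr1n expr0n addr0 divr1 mulr1.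
have L : L1 (fun p => A p ^+ 2).
  apply: L1_le (L1Zl M P1) => [|p]; first exact: measurable_funX.
  by rewrite ger0_norm ?sqr_ge0.
split; first by apply/L2P.
rewrite (@le_trans _ _ (Int (fun p => M * poisson 1 p)))//; first by apply: le_Int => //; exact: L1Zl.
by rewrite IntZl// ler_wpM2l.
Qed.

Section multiplier.
Variables (A B : R -> R) (M : R).
Hypotheses (mA : measurable_fun setT A) (mB : measurable_fun setT B).
Hypotheses (evenA : forall p, A (- p) = A p) (oddB : forall p, B (- p) = - B p).
Hypothesis bound0 : forall p, A p ^+ 2 + B p ^+ 2 <= M.
Hypothesis bound4 : forall p, p ^+ 4 * (A p ^+ 2 + B p ^+ 2) <= M.

(* The real form of the Fourier multiplier [A - i B]. *)
Definition hmul phi (p : R) : R := A p * phi p + B p * phi (- p).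

Let M0 : 0 <= M.
Proof. by apply: le_trans (bound0 0); rewrite addr_ge0 ?sqr_ge0. Qed.

(** The bounds with weights 1 and [p ^ 4] imply the one with [p ^ 2], so [A ^ 2 + B ^ 2] decays like
    [1 / (1 + p ^ 2)] even after multiplication by [p ^ 2]. Hence [A], [B], [p A] and [p B] are in
    [L2], the source of the pointwise bounds on [u] and [u']. *)
Let weight p : (A p ^+ 2 + B p ^+ 2 <= (2 * M) * poisson 1 p) /\
  (p ^+ 2 * (A p ^+ 2 + B p ^+ 2) <= (2 * M) * poisson 1 p).
Proof.
have b0 := bound0 p; have b4 := bound4 p; have q0 := sqr_ge0 p.
have Q0 : 0 <= A p ^+ 2 + B p ^+ 2 by rewrite addr_ge0 ?sqr_ge0.
rewrite (_ : p ^+ 4 = p ^+ 2 * p ^+ 2) in b4; last by rewrite -exprD.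
rewrite /poisson expr1n mulr1.
move: (p ^+ 2) (A p ^+ 2 + B p ^+ 2) q0 Q0 b0 b4 => q Q q0 Q0 b0 b4.
have b2 : q * Q <= M.
  have [q1|q1] := lerP q 1; first by apply: le_trans b0; rewrite ler_piMl.
  apply: le_trans b4; by rewrite ler_wpM2r// ler_peMl// ltW.
have d0 : 0 < 1 + q by rewrite ltr_pwDl.
by rewrite mulrA; split; rewrite ler_pdivlMr//; nra.
Qed.

Let wA p : A p ^+ 2 <= (2 * M) * poisson 1 p.
Proof. by have [h _] := weight p; apply: le_trans h; rewrite lerDl sqr_ge0. Qed.

Let wB p : B p ^+ 2 <= (2 * M) * poisson 1 p.
Proof. by have [h _] := weight p; apply: le_trans h; rewrite lerDr sqr_ge0. Qed.

Let wpA p : (p * A p) ^+ 2 <= (2 * M) * poisson 1 p.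
Proof.
have [_ h] := weight p; apply: le_trans h.
by rewrite exprMn ler_wpM2l ?sqr_ge0// lerDl sqr_ge0.
Qed.

Let wpB p : (p * B p) ^+ 2 <= (2 * M) * poisson 1 p.
Proof.
have [_ h] := weight p; apply: le_trans h.
by rewrite exprMn ler_wpM2l ?sqr_ge0// lerDr sqr_ge0.
Qed.

Let measurable_idM f : measurable_fun setT f -> measurable_fun setT (fun p => p * f p).
Proof. by move=> mf; exact: measurable_funM. Qed.

Let LA := L2_weight mA wA.
Let LB := L2_weight mB wB.
Let LpA := L2_weight (measurable_idM mA) wpA.
Let LpB := L2_weight (measurable_idM mB) wpB.

Lemma L1_hmul phi : L2 phi -> L1 (hmul phi).
Proof.
move=> p2; apply: L1D; first exact: L2_mul LA.1 p2.
exact: L2_mul LB.1 (L2_opp p2).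
Qed.

(** On the pair [(phi p, phi (- p))] the multiplier acts as the matrix with rows [(A, B)] and
    [(- B, A)], a rotation scaled by [sqrt (A ^ 2 + B ^ 2)]. Adding the values at [p] and [- p] thus
    loses nothing in the constant [M], which enters the contraction. *)
Lemma L2_hmul phi : L2 phi -> L2 (hmul phi) /\ n2 (hmul phi) <= M * n2 phi.
Proof.
move=> p2; have p2' := L2_opp p2.
have mh : measurable_fun setT (hmul phi).
  by apply: measurable_funD; apply: measurable_funM => //; exact: L2_meas.
have le p : hmul phi p ^+ 2 + hmul phi (- p) ^+ 2 <= M * (phi p ^+ 2 + phi (- p) ^+ 2).
  rewrite /hmul evenA oddB opprK.
  rewrite (_ : _ + _ = (A p ^+ 2 + B p ^+ 2) * (phi p ^+ 2 + phi (- p) ^+ 2)); last by ring.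
  by rewrite ler_wpM2r// addr_ge0 ?sqr_ge0.
have R1 : L1 (fun p => M * (phi p ^+ 2 + phi (- p) ^+ 2)).
  by apply: L1Zl; apply: L1D; [exact: L2_sqr|exact: (L2_sqr p2')].
have h2 : L2 (hmul phi).
  apply/L2P; split => //; apply: L1_le R1 => [|p]; first exact: measurable_funX.
  by rewrite ger0_norm ?sqr_ge0// (le_trans _ (le p))// lerDl sqr_ge0.
split => //.
have h2' : L1 (fun p => hmul phi (- p) ^+ 2) := L2_sqr (L2_opp h2).
have pp : L1 (fun p => phi (- p) ^+ 2) := L2_sqr p2'.
have := le_Int (L1D (L2_sqr h2) h2') R1 le.
rewrite (IntD (L2_sqr h2) h2') (IntZl M (L1D (L2_sqr p2) pp)) (IntD (L2_sqr p2) pp).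
rewrite (n2_opp mh) (n2_opp (L2_meas p2)); lra.
Qed.

Let dhmul phi p : - p * hmul phi (- p) = - (p * A p) * phi (- p) + (p * B p) * phi p.
Proof. by rewrite /hmul evenA oddB opprK; ring. Qed.

Let dhmulE phi : (fun p => - p * hmul phi (- p)) = (fun p => - (p * A p) * phi (- p) + (p * B p) * phi p).
Proof. by apply: funext => p; exact: dhmul. Qed.

Lemma L1_dhmul phi : L2 phi -> L1 (fun p => - p * hmul phi (- p)).
Proof.
move=> p2; rewrite dhmulE; apply: L1D; first exact: L2_mul (L2_neg LpA.1) (L2_opp p2).
exact: L2_mul LpB.1 p2.
Qed.

(** Each frequency is estimated separately, which costs the factor 2. This norm only has to be
    finite: the contraction is measured on [u] alone. *)
Lemma L2_dhmul phi : L2 phi ->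
  L2 (fun p => - p * hmul phi (- p)) /\ n2 (fun p => - p * hmul phi (- p)) <= 2 * M * n2 phi.
Proof.
move=> p2; have p2' := L2_opp p2.
have m1 := L1_meas (L1_dhmul p2).
have R1 : L1 (fun p => M * (phi p ^+ 2 + phi (- p) ^+ 2)).
  by apply: L1Zl; apply: L1D; [exact: L2_sqr|exact: (L2_sqr p2')].
have le p : (- p * hmul phi (- p)) ^+ 2 <= M * (phi p ^+ 2 + phi (- p) ^+ 2).
  have b0 := bound0 p; have b4 := bound4 p; have q0 := sqr_ge0 p.
  have Q0 : 0 <= A p ^+ 2 + B p ^+ 2 by rewrite addr_ge0 ?sqr_ge0.
  have b2 : p ^+ 2 * (A p ^+ 2 + B p ^+ 2) <= M.
    have [q1|q1] := lerP (p ^+ 2) 1; first by apply: le_trans b0; rewrite ler_piMl.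
    apply: le_trans b4; rewrite ler_wpM2r// (_ : p ^+ 4 = p ^+ 2 * p ^+ 2); last by rewrite -exprD.
    by rewrite ler_peMl// ltW.
  rewrite dhmul (@le_trans _ _ (p ^+ 2 * (A p ^+ 2 + B p ^+ 2) * (phi p ^+ 2 + phi (- p) ^+ 2)))//; last first.
    by rewrite ler_wpM2r// addr_ge0 ?sqr_ge0.
  rewrite -subr_ge0.
  rewrite (_ : _ - _ = (p * A p * phi p + p * B p * phi (- p)) ^+ 2) ?sqr_ge0//; ring.
have L : L1 (fun p => (- p * hmul phi (- p)) ^+ 2).
  apply: L1_le R1 => [|p]; first exact: measurable_funX.
  by rewrite ger0_norm ?sqr_ge0.
split; first by apply/L2P.
have pp : L1 (fun p => phi (- p) ^+ 2) := L2_sqr p2'.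
have := le_Int L R1 le; rewrite (IntZl M (L1D (L2_sqr p2) pp)) (IntD (L2_sqr p2) pp).
rewrite (n2_opp (L2_meas p2)); lra.
Qed.

(** [8 / (2 * pi)] is the constant of [sqr_hart_le]; each of the two multipliers adds
    [2 * M * (2 * pi)] by [L2_weight]. *)
Let C := 8 / (2 * pi) * (2 * (2 * M * (2 * pi))).

Let fold_bound (x y z : R) : 0 <= z -> x <= 2 * M * (2 * pi) -> y <= 2 * M * (2 * pi) ->
  8 / (2 * pi) * (x * z + y * z) <= C * z.
Proof.
move=> z0 xM yM; rewrite /C -[leRHS]mulrA ler_wpM2l ?divr_ge0 ?mulr_ge0 ?pi_ge0//.
by rewrite -mulrDl ler_wpM2r// (mulrC 2) mulr_natr mulr2n lerD.
Qed.

Lemma sup_hmul phi x : L2 phi -> hart (hmul phi) x ^+ 2 <= C * n2 phi.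
Proof.
move=> p2; apply: le_trans (sqr_hart_le x LA.1 LB.1 p2 (L2_opp p2)) _.
by rewrite (n2_opp (L2_meas p2)); apply: fold_bound; [exact: n2_ge0|exact: LA.2|exact: LB.2].
Qed.

Lemma sup_dhmul phi x : L2 phi -> hart (fun p => - p * hmul phi (- p)) x ^+ 2 <= C * n2 phi.
Proof.
move=> p2; rewrite dhmulE; apply: le_trans (sqr_hart_le x (L2_neg LpA.1) LpB.1 (L2_opp p2) p2) _.
rewrite (n2_opp (L2_meas p2)); apply: fold_bound; [exact: n2_ge0| |exact: LpB.2].
by under eq_Int do rewrite sqrrN; exact: LpA.2.
Qed.

End multiplier.

(** The last two hypotheses are the real and imaginary parts of [(p ^ 2 - a - i b p) (A - i B) =
    costr G - i sintr G]. The solution is [hart (hmul A B (hart f))], and its equation is verified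
    after integration over [[x, y]]. Taking [f] in both [L1] and [L2] puts [cv G f] in both, as
    [parseval_indic] requires. *)
Lemma solve_L1L2 G A B (a b M : R) :
  L1 G -> measurable_fun setT A -> measurable_fun setT B ->
  (forall p, A (- p) = A p) -> (forall p, B (- p) = - B p) ->
  (forall p, A p ^+ 2 + B p ^+ 2 <= M) ->
  (forall p, p ^+ 4 * (A p ^+ 2 + B p ^+ 2) <= M) ->
  {ae mu, forall p, (p ^+ 2 - a) * A p - b * p * B p = costr G p} ->
  {ae mu, forall p, (p ^+ 2 - a) * B p + b * p * A p = sintr G p} ->
  exists C, forall f, L1 f -> L2 f -> exists u u1,
    [/\ is_H2 u u1 (fun x => - b * u1 x - a * u x - cv G f x),
        n2 u <= M * n2 f, n2 u1 <= 2 * M * n2 f,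
        (forall x, u x ^+ 2 <= C * n2 f) & (forall x, u1 x ^+ 2 <= C * n2 f)].
Proof.
move=> G1 mA mB eA oB b0 b4 eqc eqs.
have M0 : 0 <= M by apply: le_trans (b0 0); rewrite addr_ge0 ?sqr_ge0.
pose C : R := 8 / (2 * pi) * (2 * (2 * M * (2 * pi))).
exists C => f f1 f2; have C0 : 0 <= C.
  have p0 : 0 <= 2 * pi :> R by rewrite mulr_ge0// pi_ge0.
  by apply: mulr_ge0; [exact: divr_ge0|apply: mulr_ge0 => //; apply: mulr_ge0 => //; exact: mulr_ge0].
have [phi2 phile] := L2_bessel f1 f2.
set phi := hart f in phi2 phile.
pose Phi := hmul A B phi; pose Psi (p : R) : R := - p * Phi (- p).
have Phi1 : L1 Phi := L1_hmul mA mB b0 b4 phi2.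
have [Phi2 Phile] : L2 Phi /\ _ := L2_hmul mA mB eA oB b0 phi2.
have Psi1 : L1 Psi := L1_dhmul mA mB eA oB b0 b4 phi2.
have [Psi2 Psile] : L2 Psi /\ _ := L2_dhmul mA mB eA oB b0 b4 phi2.
have [u2 ule] := L2_bessel Phi1 Phi2; have [v2 vle] := L2_bessel Psi1 Psi2.
have [w2 _ _] := young2 G1 f2; have [w1 _] := young1 G1 f1.
exists (hart Phi), (hart Psi); split.
- have intu1 x y : mu.-integrable `[x, y] (fun t => (hart Psi t)%:E).
    apply/(integrable_indicE (hart Psi) (measurable_itv _)); exact: L2_integrable_itv.
  have U2 : L2 (fun x => - b * hart Psi x - a * hart Phi x - cv G f x).
    by apply: L2B => //; apply: L2B; exact: L2Zl.
  split => //.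
  + by move=> x y xy; split => //; rewrite Rintegral_hart// hart_sub.
  + move=> x y xy; split.
      apply/(integrable_indicE (fun x => - b * hart Psi x - a * hart Phi x - cv G f x) (measurable_itv _)).
      exact: L2_integrable_itv.
    pose h := hart (\1_`[x, y] : R -> R).
    have i1 := L1_indic_itv x y; have i2 := L2_indic_itv x y.
    have [h2 _] := L2_bessel i1 i2.
    have i f' : L2 f' -> mu.-integrable `[x, y] (fun t => (f' t)%:E).
      move=> f'2; apply/(integrable_indicE f' (measurable_itv _)); exact: L2_integrable_itv.
    rewrite RintegralB//; [|by apply: i; apply: L2B; exact: L2Zl|exact: i].
    rewrite RintegralB//; [|by apply: i; exact: L2Zl|by apply: i; exact: L2Zl].
    have Z c f' : L2 f' -> \int[mu]_(t in `[x, y]) (c * f' t) = c * \int[mu]_(t in `[x, y]) f' t.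
      by move=> f'2; apply: RintegralZl => //; exact: i.
    rewrite (Z _ _ v2) (Z _ _ u2).
    rewrite !Rintegral_hart// -(parseval_indic w1 w2 xy) hart_sub//.
    have l1 : L1 (fun p => Psi p * h p) by exact: L2_mul.
    have l2 : L1 (fun p => Phi p * h p) by exact: L2_mul.
    have [hw2 _] := L2_bessel w1 w2.
    have l3 : L1 (fun p => hart (cv G f) p * h p) by exact: L2_mul.
    rewrite -/h -IntZl// -IntZl// -IntB; [|exact: L1Zl|exact: L1Zl].
    rewrite -IntB//; last by apply: L1B; exact: L1Zl.
    have mPhi := L1_meas Phi1; have mPsi := L1_meas Psi1; have mh := L2_meas h2.
    apply: ae_eq_Int.
    * apply: measurable_funM => //; apply: measurable_funM; first exact: measurable_funN.
      exact: measurableT_comp.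
    * by apply: L1_meas; apply: L1B => //; apply: L1B; exact: L1Zl.
    (* On the frequency side the equation is an algebraic identity between [A], [B] and the values
       of [phi] at [p] and [- p]. *)
    apply: (ae_imp2 eqc eqs) => p ec es.
    rewrite hart_cv// -ec -es -/phi /Psi opprK.
    rewrite /Phi /hmul opprK eA oB; ring.
- by rewrite (le_trans ule)// (le_trans Phile)// ler_wpM2l.
- by rewrite (le_trans vle)// (le_trans Psile)// ler_wpM2l ?mulr_ge0.
- move=> x; apply: (le_trans (sup_hmul mA mB b0 b4 x phi2)).
  by rewrite -/C ler_wpM2l.
- move=> x; apply: (le_trans (sup_dhmul mA mB eA oB b0 b4 x phi2)).
  by rewrite -/C ler_wpM2l.
Qed.

End linear_solver.

(** * Functions in H^2 and the homogeneous equation *)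

Section H2_theory.
Context {R : realType}.
Local Notation mu := (@lebesgue_measure R).
Implicit Types (f g u v : R -> R) (x y z : R).

Lemma integrable_itv_L2 f x y : L2 f -> mu.-integrable `[x, y] (fun t => (f t)%:E).
Proof.
by move=> f2; apply/(integrable_indicE f (measurable_itv _)); exact: L2_integrable_itv.
Qed.

Lemma sqr_Rintegral_itv f x y : L2 f -> x <= y ->
  (\int[mu]_(t in `[x, y]) f t) ^+ 2 <= (y - x) * n2 f.
Proof.
move=> f2 xy; rewrite Rintegral_indic.
have := cauchy_schwarz f2 (L2_indic_itv x y).
rewrite (_ : n2 (\1_`[x, y] : R -> R) = y - x) 1?mulrC// -Int_indic_itv//.
by apply: eq_Int => t; rewrite indicE; case: (_ \in _); rewrite ?expr1n ?expr0n.
Qed.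

(** Cauchy-Schwarz makes [f] Hölder continuous of exponent 1/2. The [+ 1] added to [n2 g] keeps the
    divisor positive when [g] vanishes. *)
Lemma primitive_continuous f g : L2 g ->
  (forall x y, x <= y -> f y - f x = \int[mu]_(t in `[x, y]) g t) -> continuous f.
Proof.
move=> g2 fg x.
have g0 : 0 <= n2 g by exact: n2_ge0.
have le y : (f x - f y) ^+ 2 <= `|x - y| * (n2 g + 1).
  apply: (@le_trans _ _ (`|x - y| * n2 g)); last by rewrite ler_wpM2l// lerDl.
  have [xy|yx] := leP x y.
    by rewrite -sqrrN opprB fg// distrC ger0_norm ?subr_ge0// sqr_Rintegral_itv.
  have yx' := ltW yx.
  by rewrite (fg _ _ yx') ger0_norm ?subr_ge0// sqr_Rintegral_itv.
apply/cvgrPdist_lt => e e0; near=> y.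
have : `|x - y| < e ^+ 2 / (n2 g + 1).
  near: y; apply: (@cvgr_dist_lt _ _ _ (nbhs x) _ id x) => //.
  by rewrite divr_gt0 ?exprn_gt0// ltr_wpDl.
rewrite ltr_pdivlMr ?ltr_wpDl// => h.
have := le_lt_trans (le y) h.
by rewrite -real_normK ?num_real// ltr_pXn2r ?nnegrE// ltW.
Unshelve. all: by end_near. Qed.

Lemma primitive_is_derive f g x : continuous g ->
  (forall x y, x <= y -> f y - f x = \int[mu]_(t in `[x, y]) g t) ->
  is_derive x 1 f (g x).
Proof.
move=> cg fg.
have xu : x < x + 1 by rewrite ltrDl.
have ax : x - 1 < x by rewrite ltrBlDr ltrDl.
have ig : mu.-integrable `[x - 1, x + 1] (EFin \o g).
  by apply: continuous_compact_integrable; [exact: segment_compact|exact: continuous_subspaceT].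
have [dF F'] := continuous_FTC1_closed xu ig ax (cg x).
pose F z := \int[mu]_(t in `[x - 1, z]) g t.
have dF1 : is_derive x 1 F (g x) by move/derivableP : dF; rewrite -derive1E F'.
have dF2 : is_derive x 1 (fun z => F z + f (x - 1)) (g x).
  by apply: is_derive_eq; rewrite addr0.
apply: near_eq_is_derive dF2; near=> z.
rewrite /F -fg ?subrK//.
by near: z; exact: (cvgr_ge x).
Unshelve. all: by end_near. Qed.

(** A positive value at [x] would persist on [[x, x + n]] and force [Int f >= n * f x] for every
    [n]. *)
Lemma nondecreasing_L1_eq0 f : {homo f : x y / x <= y} -> (forall x, 0 <= f x) ->
  L1 f -> forall x, f x = 0.
Proof.
move=> ndf f0 f1 x; apply/eqP; rewrite eq_le f0 andbT leNgt; apply/negP => fx.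
have h (n : nat) : n%:R * f x <= Int f.
  have xn : x <= x + n%:R by rewrite lerDl.
  have i1 := L1_indic_itv x (x + n%:R).
  rewrite (_ : n%:R = (x + n%:R) - x); last by rewrite addrAC subrr add0r.
  rewrite -Int_indic_itv// mulrC -IntZl//; apply: le_Int => //; first exact: L1Zl.
  move=> t; rewrite indicE; case: (boolP (t \in _)) => [|_]; last by rewrite mulr0.
  by rewrite mem_setE/= in_itv/= mulr1 => /andP[xt _]; exact: ndf.
have := h (Num.bound (Int f / f x)); apply/negP; rewrite -ltNge -ltr_pdivrMr//.
by apply: le_lt_trans (archi_boundP _); rewrite ?divr_ge0 ?Int_ge0.
Qed.

Lemma monotone_L1_eq0 f (f' : R -> R) : (forall x, is_derive x 1 f (f' x)) ->
  (forall x, 0 <= f' x) \/ (forall x, f' x <= 0) -> (forall x, 0 <= f x) ->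
  L1 f -> forall x, f x = 0.
Proof.
move=> df sgn f0 f1.
have cf := continuous_is_derive df.
have mvt x y : x <= y -> exists c, f y - f x = f' c * (y - x).
  rewrite le_eqVlt => /predU1P[->|xy]; first by exists y; rewrite !subrr mulr0.
  have [c _ E] := MVT xy (fun z _ => df z) (continuous_subspaceT cf).
  by exists c.
case: sgn => sgn.
  apply: nondecreasing_L1_eq0 => // x y xy; rewrite -subr_ge0.
  by have [c ->] := mvt _ _ xy; rewrite mulr_ge0// subr_ge0.
suff h x : f (- x) = 0 by move=> x; rewrite -(opprK x).
move: x; apply: (nondecreasing_L1_eq0 (f := fun x => f (- x))) => //; last exact: L1_opp.
move=> x y xy; rewrite -subr_le0.
have [|c ->] := mvt (- y) (- x); first by rewrite lerN2.
by rewrite mulr_le0_ge0// opprK addrC subr_ge0.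
Qed.

(* The energy [u1 ^ 2 + a u ^ 2] has derivative [- 2 b u1 ^ 2]: it is monotone
   and integrable, hence zero. *)
Lemma H2_homogeneous u u1 u2 (a b : R) : 0 <= a -> is_H2 u u1 u2 ->
  {ae mu, forall x, u2 x = - b * u1 x - a * u x} ->
  forall x, u x = 0 /\ u1 x = 0.
Proof.
move=> a0 [Lu Lu1 Lu2 du du1] ode.
have cu : continuous u by apply: (primitive_continuous Lu1) => x y /du[].
have cu1 : continuous u1 by apply: (primitive_continuous Lu2) => x y /du1[].
pose w x := - b * u1 x - a * u x.
have cw : continuous w.
  by move=> x; apply: cvgB; (apply: cvgM; [exact: cvg_cst|]); [exact: cu1|exact: cu].
have Du x : is_derive x 1 u (u1 x).
  by apply: primitive_is_derive => // y z /du[].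
(* Under the integral the equation replaces [u2] by the continuous [w], so [u1] is differentiable at
   every point. *)
have Du1 x : is_derive x 1 u1 (w x).
  apply: primitive_is_derive => // y z /du1[_ ->].
  rewrite [LHS]Rintegral_indic [RHS]Rintegral_indic; apply: ae_eq_Int.
  - by apply: measurable_funM => //; exact: L2_meas.
  - by apply: measurable_funM => //; exact: continuous_measurable_fun.
  - by apply: (ae_imp ode) => t ->.
have E0 : forall x, u1 x ^+ 2 + a * u x ^+ 2 = 0.
  apply: (monotone_L1_eq0 (f := fun x => u1 x ^+ 2 + a * u x ^+ 2) (f' := fun x => - (2 * b) * u1 x ^+ 2)).
  - move=> x; have Dux := Du x; have Du1x := Du1 x.
    by apply: is_derive_eq; rewrite /GRing.scale/= /w; ring.
  - have [b0|b0] := leP b 0; [left|right] => x.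
      by rewrite mulr_ge0 ?sqr_ge0// oppr_ge0 mulr_ge0_le0.
    by rewrite mulr_le0_ge0 ?sqr_ge0// oppr_le0 mulr_ge0// ltW.
  - by move=> x; rewrite addr_ge0 ?sqr_ge0// mulr_ge0 ?sqr_ge0.
  - by apply: L1D; [exact: L2_sqr|apply: L1Zl; exact: L2_sqr].
have u10 x : u1 x = 0.
  have h := E0 x; have h1 := sqr_ge0 (u1 x).
  have h2 : 0 <= a * u x ^+ 2 by rewrite mulr_ge0 ?sqr_ge0.
  by apply/eqP; rewrite -sqrf_eq0; apply/eqP; lra.
(* When [a = 0] the energy only yields [u1 = 0]; but [u ^ 2] is then constant and integrable, hence
   zero. *)
have usq : forall x, u x ^+ 2 = 0.
  have Du2 y : is_derive y 1 (fun x => u x ^+ 2) 0.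
    have Duy := Du y.
    by apply: is_derive_eq; rewrite u10 /GRing.scale/=; ring.
  apply: (monotone_L1_eq0 Du2).
  - by left.
  - by move=> x; exact: sqr_ge0.
  - exact: L2_sqr.
by move=> x; split => //; apply/eqP; rewrite -sqrf_eq0 usq.
Qed.

Lemma is_H2B u u1 u2 v v1 v2 : is_H2 u u1 u2 -> is_H2 v v1 v2 ->
  is_H2 (fun x => u x - v x) (fun x => u1 x - v1 x) (fun x => u2 x - v2 x).
Proof.
move=> [Lu Lu1 Lu2 du du1] [Lv Lv1 Lv2 dv dv1]; split; try exact: L2B.
- move=> x y xy; split; first by apply: integrable_itv_L2; exact: L2B.
  rewrite RintegralB//; [|exact: integrable_itv_L2|exact: integrable_itv_L2].
  by rewrite -(du _ _ xy).2 -(dv _ _ xy).2; ring.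
- move=> x y xy; split; first by apply: integrable_itv_L2; exact: L2B.
  rewrite RintegralB//; [|exact: integrable_itv_L2|exact: integrable_itv_L2].
  by rewrite -(du1 _ _ xy).2 -(dv1 _ _ xy).2; ring.
Qed.

Lemma is_H2_ext u u1 u2 v2 : measurable_fun setT v2 ->
  {ae mu, forall x, u2 x = v2 x} -> is_H2 u u1 u2 -> is_H2 u u1 v2.
Proof.
move=> mv uv [Lu Lu1 Lu2 du du1]; have Lv2 := ae_eq_L2 mv uv Lu2.
split => // x y xy; split; first exact: integrable_itv_L2.
rewrite (du1 _ _ xy).2 [LHS]Rintegral_indic [RHS]Rintegral_indic; apply: ae_eq_Int.
- by apply: measurable_funM => //; exact: L2_meas.
- by apply: measurable_funM.
- by apply: (ae_imp uv) => t ->.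
Qed.

End H2_theory.

Section geometric_limits.
Context {R : realType}.

Lemma cvg_of_sqr_dist (s r : nat -> R) :
  (forall n m, (n <= m)%N -> (s m - s n) ^+ 2 <= r n) -> r n @[n --> \oo] --> (0 : R) ->
  exists l, s n @[n --> \oo] --> l /\ forall n, (l - s n) ^+ 2 <= r n.
Proof.
move=> h r0.
have /cvg_ex[l sl] : cvgn s.
  apply/cauchy_cvgP; apply: cauchy_exP => e e0.
  have e2 : 0 < e ^+ 2 by rewrite exprn_gt0.
  have /cvgr0Pnorm_lt/(_ _ e2)[N _ HN] := r0.
  exists (s N); exists N => // m /= Nm; rewrite -ball_normE/= distrC.
  rewrite -(ltr_pXn2r (n := 2)) ?nnegrE// ?(ltW e0)// real_normK ?num_real//.
  by apply: le_lt_trans (h _ _ Nm) _; apply: le_lt_trans (ler_norm _) _; exact: HN (leqnn N).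
exists l; split => // n.
have c1 : (s m - s n) ^+ 2 @[m --> \oo] --> (l - s n) ^+ 2.
  by apply: cvgM; apply: cvgB => //; exact: cvg_cst.
apply: (ler_cvg_to c1 (cvg_cst (r n))).
by exists n => // m /= nm; exact: h.
Qed.

Lemma cvg_sqr_dist (s r : nat -> R) (l : R) : (forall n, (l - s n) ^+ 2 <= r n) ->
  r n @[n --> \oo] --> (0 : R) -> s n @[n --> \oo] --> l.
Proof.
move=> le r0; apply/cvgrPdist_lt => e e0.
have e2 : 0 < e ^+ 2 by rewrite exprn_gt0.
have /cvgr0Pnorm_lt/(_ _ e2)[N _ HN] := r0.
exists N => // n /= Nn.
rewrite -(ltr_pXn2r (n := 2)) ?nnegrE// ?(ltW e0)// real_normK ?num_real//.
by apply: le_lt_trans (le n) _; apply: le_lt_trans (ler_norm _) _; exact: HN _ Nn.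
Qed.

End geometric_limits.

(** * From integrable data to square-integrable data *)

Section truncation.
Context {R : realType}.
Local Notation mu := (@lebesgue_measure R).
Implicit Types f g : R -> R.

Definition trunc f (n : nat) (x : R) : R := f x * \1_(`[- n%:R, n%:R]%classic : set R) x.

Lemma indic01 (D : set R) (x : R) : \1_D x = 0 :> R \/ \1_D x = 1 :> R.
Proof. by rewrite indicE; case: (_ \in _); [right|left]. Qed.

Lemma L1_trunc f n : L2 f -> L1 (trunc f n).
Proof. exact: L2_integrable_itv. Qed.

Lemma L2_trunc f n : L2 f -> L2 (trunc f n).
Proof.
move=> f2; apply: (L2M_bounded (C := 1)) f2; first exact: measurable_indic.
by move=> x; have [->|->] := indic01 `[- n%:R, n%:R]%classic x; rewrite ?normr0 ?normr1.
Qed.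

Lemma n2_trunc_le f n : L2 f -> n2 (trunc f n) <= n2 f.
Proof.
move=> f2; apply: le_n2 => //; first exact: L2_trunc.
move=> x; rewrite normrM ler_piMr//.
by have [->|->] := indic01 `[- n%:R, n%:R]%classic x; rewrite ?normr0 ?normr1.
Qed.

Lemma n2_trunc_dist f n m : L2 f -> (n <= m)%N ->
  n2 (fun x => trunc f m x - trunc f n x) <= n2 (fun x => f x - trunc f n x).
Proof.
move=> f2 nm; apply: le_n2; [by apply: L2B; exact: L2_trunc|by apply: L2B => //; exact: L2_trunc|].
move=> x; rewrite /trunc.
have [xn|xn] := boolP (x \in (`[- n%:R, n%:R]%classic : set R)).
  have xm : x \in (`[- m%:R, m%:R]%classic : set R).
    move: xn; rewrite !mem_setE/= !in_itv/= => /andP[x1 x2].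
    have nm' : (n%:R : R) <= m%:R by rewrite ler_nat.
    by rewrite (le_trans x2 nm') (le_trans _ x1)// lerN2.
  by rewrite !indicE xn xm !mulr1 subrr.
rewrite [X in _ - _ * X]indicE [in X in _ <= X]indicE (negbTE xn) mulr0 !subr0 normrM ler_piMr//.
by have [->|->] := indic01 `[- m%:R, m%:R]%classic x; rewrite ?normr0 ?normr1.
Qed.

Lemma trunc_cvg f : L2 f ->
  n2 (fun x => f x - trunc f n x) @[n --> \oo] --> (0 : R).
Proof.
move=> f2; have mf := L2_meas f2.
have [||||_ h] := @dominated_Int _ (fun n x => (f x - trunc f n x) ^+ 2) (fun x => 0) (fun x => f x ^+ 2).
- by move=> n; apply: measurable_funX; apply: measurable_funB => //; exact: L2_meas (L2_trunc n f2).
- move=> x.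
  have c : trunc f n x @[n --> \oo] --> f x * 1.
    by apply: cvgM; [exact: cvg_cst|exact: truncation_cvg].
  have c0 : f x - trunc f n x @[n --> \oo] --> f x - f x * 1.
    by apply: cvgB => //; exact: cvg_cst.
  rewrite mulr1 subrr in c0.
  have c1 : (f x - trunc f n x) ^+ 2 @[n --> \oo] --> (0 * 0 : R) by exact: cvgM.
  by rewrite mulr0 in c1.
- exact: L2_sqr.
- move=> n x; rewrite ger0_norm ?sqr_ge0// -[leLHS]real_normK ?num_real// -[leRHS]real_normK ?num_real//.
  rewrite lerXn2r ?nnegrE// /trunc.
  by have [->|->] := indic01 `[- n%:R, n%:R]%classic x; rewrite ?mulr0 ?mulr1 ?subr0 ?subrr ?normr0.
- by rewrite Int0 in h.
Qed.

End truncation.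

Section solve_in_L2.
Context {R : realType}.
Local Notation mu := (@lebesgue_measure R).
Implicit Types f g u v : R -> R.
Context (G : R -> R) (a b M : R).
Hypotheses (G1 : L1 G) (a0 : 0 <= a) (M0 : 0 <= M).

(** The second derivative is prescribed by the equation itself, so membership in H^2 carries the
    whole statement and no almost everywhere clause is left. *)
Definition solution f u u1 := is_H2 u u1 (fun x => - b * u1 x - a * u x - cv G f x).

Lemma solution_unique f u u1 v v1 :
  solution f u u1 -> solution f v v1 -> forall x, u x = v x /\ u1 x = v1 x.
Proof.
move=> su sv x.
have ode : {ae mu, forall y,
    (- b * u1 y - a * u y - cv G f y) - (- b * v1 y - a * v y - cv G f y) =
    - b * (u1 y - v1 y) - a * (u y - v y)} by apply: ae_all => y; ring.
have [d0 d1] := H2_homogeneous a0 (is_H2B su sv) ode x.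
by split; apply/eqP; rewrite -subr_eq0; apply/eqP.
Qed.

Lemma solutionB f g u u1 v v1 : L2 f -> L2 g ->
  solution f u u1 -> solution g v v1 ->
  solution (fun x => f x - g x) (fun x => u x - v x) (fun x => u1 x - v1 x).
Proof.
move=> f2 g2 su sv; have := is_H2B su sv; apply: is_H2_ext.
  case: su => Lu Lu1 _ _ _; case: sv => Lv Lv1 _ _ _.
  have [c2 _ _] := young2 G1 (L2B f2 g2).
  by apply: L2_meas; apply: L2B => //; apply: L2B; apply: L2Zl; exact: L2B.
by apply: (ae_imp (cvB G1 f2 g2)) => x ->; ring.
Qed.

Context (C : R).
Hypothesis solve : forall f, L1 f -> L2 f -> exists u u1,
  [/\ solution f u u1, n2 u <= M * n2 f, n2 u1 <= 2 * M * n2 f,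
      (forall x, u x ^+ 2 <= C * n2 f) & (forall x, u1 x ^+ 2 <= C * n2 f)].

(** Let [u_ n] solve the equation for the truncated data. By uniqueness [u_ m - u_ n] is the
    solution given by [solve] for the difference of the data, so the pointwise bounds make [u_ n]
    and its derivative Cauchy at every point. Norm bounds pass to the limit by Fatou, integrals over
    intervals by dominated convergence, and the convolution term by Young. *)
Lemma solve_L2 f : L2 f -> exists u u1,
  [/\ solution f u u1, n2 u <= M * n2 f & (forall x, u x ^+ 2 <= `|C| * n2 f)].
Proof.
move=> f2.
have C0 : 0 <= `|C| by []. have nf0 := n2_ge0 f.
have CC g : C * n2 g <= `|C| * n2 g by rewrite ler_wpM2r ?n2_ge0// ler_norm.
have solve' n := solve (L1_trunc n f2) (L2_trunc n f2).
have [u_ /choice[v_ suv]] := choice solve'.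
pose r n := `|C| * n2 (fun x => f x - trunc f n x).
have r0 : r n @[n --> \oo] --> (0 : R).
  by rewrite -(mulr0 `|C|); apply: cvgM; [exact: cvg_cst|exact: trunc_cvg].
have dist n m : (n <= m)%N -> forall x,
    (u_ m x - u_ n x) ^+ 2 <= r n /\ (v_ m x - v_ n x) ^+ 2 <= r n.
  move=> nm x; have Ln := L2_trunc n f2; have Lm := L2_trunc m f2.
  have [su _ _ _ _] := suv n; have [su' _ _ _ _] := suv m.
  have sd := solutionB Lm Ln su' su.
  have [w [w1 [sw _ _ bw bw1]]] := solve (L1B (L1_trunc m f2) (L1_trunc n f2)) (L2B Lm Ln).
  have [-> ->] := solution_unique sd sw x.
  have le : `|C| * n2 (fun x => trunc f m x - trunc f n x) <= r n.
    by rewrite ler_wpM2l// n2_trunc_dist.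
  by split; [apply: le_trans (bw x) _|apply: le_trans (bw1 x) _]; exact: le_trans (CC _) le.
have [u hu] := choice (fun x => cvg_of_sqr_dist (fun n m nm => (dist n m nm x).1) r0).
have [v hv] := choice (fun x => cvg_of_sqr_dist (fun n m nm => (dist n m nm x).2) r0).
exists u, v.
have Lu_ n : L2 (u_ n) by have [[]] := suv n.
have Lv_ n : L2 (v_ n) by have [[]] := suv n.
have mu_ : measurable_fun setT u.
  by apply: (@measurable_fun_cvg _ _ _ _ u_) => [n|x _]; [exact: L2_meas|exact: (hu x).1].
have mv_ : measurable_fun setT v.
  by apply: (@measurable_fun_cvg _ _ _ _ v_) => [n|x _]; [exact: L2_meas|exact: (hv x).1].
have [Iu nu] : L1 (fun x => u x ^+ 2) /\ n2 u <= M * n2 f.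
  apply: (fatou_Int (f_ := fun n x => u_ n x ^+ 2)).
  - by move=> n; exact: L2_sqr.
  - by move=> n x; exact: sqr_ge0.
  - by move=> x; apply: cvgM; exact: (hu x).1.
  - move=> n; have [_ le _ _ _] := suv n.
    by rewrite (le_trans le)// ler_wpM2l// n2_trunc_le.
have [Iv _] : L1 (fun x => v x ^+ 2) /\ n2 v <= 2 * M * n2 f.
  apply: (fatou_Int (f_ := fun n x => v_ n x ^+ 2)).
  - by move=> n; exact: L2_sqr.
  - by move=> n x; exact: sqr_ge0.
  - by move=> x; apply: cvgM; exact: (hv x).1.
  - move=> n; have [_ _ le _ _] := suv n.
    by rewrite (le_trans le)// ler_wpM2l ?mulr_ge0// n2_trunc_le.
have Lu : L2 u by apply/L2P.
have Lv : L2 v by apply/L2P.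
have bu_ n x : u_ n x ^+ 2 <= `|C| * n2 f.
  have [_ _ _ le _] := suv n.
  by rewrite (le_trans (le x))// (le_trans (CC _))// ler_wpM2l// n2_trunc_le.
have bv_ n x : v_ n x ^+ 2 <= `|C| * n2 f.
  have [_ _ _ _ le] := suv n.
  by rewrite (le_trans (le x))// (le_trans (CC _))// ler_wpM2l// n2_trunc_le.
have lim_int (w_ : nat -> R -> R) w x y : (forall n, L2 (w_ n)) ->
    (forall z, w_ n z @[n --> \oo] --> w z) ->
    (forall n z, w_ n z ^+ 2 <= `|C| * n2 f) ->
    \int[mu]_(t in `[x, y]) w_ n t @[n --> \oo] --> \int[mu]_(t in `[x, y]) w t.
  move=> Lw ww bw; rewrite Rintegral_indic.
  rewrite (_ : (fun n => _) = fun n => Int (fun t => w_ n t * \1_`[x, y] t)); last first.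
    by apply: funext => n; rewrite Rintegral_indic.
  have := @dominated_Int _ (fun n t => w_ n t * \1_`[x, y] t) (fun t => w t * \1_`[x, y] t)
    (fun t => Num.sqrt (`|C| * n2 f) * \1_`[x, y] t).
  case=> //.
  - by move=> n; apply: measurable_funM => //; exact: L2_meas.
  - by move=> z; apply: cvgM; [exact: ww|exact: cvg_cst].
  - by apply: L1Zl; exact: L1_indic_itv.
  - move=> n z; have [->|->] := indic01 `[x, y]%classic z; first by rewrite !mulr0 normr0.
    by rewrite !mulr1 -sqrtr_sqr ler_wsqrtr.
have [Lc _ _] := young2 G1 f2.
split => //; last first.
  move=> x; apply: (ler_cvg_to (cvgM (hu x).1 (hu x).1) (cvg_cst (`|C| * n2 f))).
  by apply: nearW => n; exact: bu_.
split => //.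
- by apply: L2B => //; apply: L2B; exact: L2Zl.
- move=> x y xy; split; first exact: integrable_itv_L2.
  have c1 : u_ n y - u_ n x @[n --> \oo] --> u y - u x.
    by apply: cvgB; [exact: (hu y).1|exact: (hu x).1].
  suff c2 : u_ n y - u_ n x @[n --> \oo] --> \int[mu]_(t in `[x, y]) v t by exact: cvg_unique c1 c2.
  rewrite (_ : (fun n => _) = fun n => \int[mu]_(t in `[x, y]) v_ n t).
    by apply: lim_int => // z; exact: (hv z).1.
  by apply: funext => n; have [[_ _ _ /(_ _ _ xy)[]]] := suv n.
- move=> x y xy; split; first by apply: integrable_itv_L2; apply: L2B => //; apply: L2B; exact: L2Zl.
  have E (w w1 w2 : R -> R) : L2 w -> L2 w1 -> L2 w2 ->
      \int[mu]_(t in `[x, y]) (- b * w1 t - a * w t - w2 t) =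
      - b * \int[mu]_(t in `[x, y]) w1 t - a * \int[mu]_(t in `[x, y]) w t - \int[mu]_(t in `[x, y]) w2 t.
    move=> Lw Lw1 Lw2.
    have Z c f' : L2 f' -> \int[mu]_(t in `[x, y]) (c * f' t) = c * \int[mu]_(t in `[x, y]) f' t.
      by move=> f'2; apply: RintegralZl => //; exact: integrable_itv_L2.
    rewrite RintegralB//; [|by apply: integrable_itv_L2; apply: L2B; exact: L2Zl|exact: integrable_itv_L2].
    rewrite RintegralB//; [|by apply: integrable_itv_L2; exact: L2Zl|by apply: integrable_itv_L2; exact: L2Zl].
    by rewrite (Z _ _ Lw) (Z _ _ Lw1).
  rewrite E//.
  have Lcn n : L2 (cv G (trunc f n)) by have [] := young2 G1 (L2_trunc n f2).
  have c1 : v_ n y - v_ n x @[n --> \oo] --> v y - v x.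
    by apply: cvgB; [exact: (hv y).1|exact: (hv x).1].
  suff c2 : v_ n y - v_ n x @[n --> \oo] --> - b * \int[mu]_(t in `[x, y]) v t - a * \int[mu]_(t in `[x, y]) u t - \int[mu]_(t in `[x, y]) cv G f t.
    exact: cvg_unique c1 c2.
  rewrite (_ : (fun n => _) = fun n => - b * \int[mu]_(t in `[x, y]) v_ n t - a * \int[mu]_(t in `[x, y]) u_ n t - \int[mu]_(t in `[x, y]) cv G (trunc f n) t); last first.
    by apply: funext => n; have [[_ _ _ _ /(_ _ _ xy)[_ ->]]] := suv n; rewrite E.
  apply: cvgB; first apply: cvgB.
  + by apply: cvgM; [exact: cvg_cst|apply: lim_int => // z; exact: (hv z).1].
  + by apply: cvgM; [exact: cvg_cst|apply: lim_int => // z; exact: (hu z).1].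
  + pose q n := (y - x) * ((Int (fun x => `|G x|)) ^+ 2 * n2 (fun x => f x - trunc f n x)).
    have q0 : q n @[n --> \oo] --> (0 : R).
      rewrite -(mulr0 (y - x)); apply: cvgM; first exact: cvg_cst.
      rewrite -(mulr0 (Int (fun x => `|G x|) ^+ 2)); apply: cvgM; [exact: cvg_cst|exact: trunc_cvg].
    have le n : (\int[mu]_(t in `[x, y]) cv G f t - \int[mu]_(t in `[x, y]) cv G (trunc f n) t) ^+ 2 <= q n.
      rewrite -RintegralB//; [|exact: integrable_itv_L2|exact: integrable_itv_L2].
      apply: (le_trans (sqr_Rintegral_itv (L2B Lc (Lcn n)) xy)).
      rewrite ler_wpM2l ?subr_ge0//.
      have [Ld d _] := young2 G1 (L2B f2 (L2_trunc n f2)).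
      rewrite (le_trans _ d)// le_eqVlt; apply/orP; left; apply/eqP.
      apply: ae_eq_Int; [by apply: measurable_funX; exact: L2_meas (L2B Lc (Lcn n))|by apply: measurable_funX; exact: L2_meas|].
      by apply: (ae_imp (cvB G1 f2 (L2_trunc n f2))) => t ->.
    exact: cvg_sqr_dist le q0.
Qed.

End solve_in_L2.

(** * Bounded multipliers *)

Section multiplier_from_ratio.
Context {R : realType}.
Local Notation mu := (@lebesgue_measure R).
Implicit Types (G : R -> R) (p : R).

(** The inverse is the limit of the continuous functions [x / (x ^ 2 + 1 / (n + 1))] at every point,
    including 0, where it is 0 by convention. *)
Lemma measurable_inv : measurable_fun setT (fun x : R => x^-1).
Proof.
pose h (n : nat) (x : R) := x * (x ^+ 2 + n.+1%:R^-1)^-1.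
have d0 n (x : R) : x ^+ 2 + n.+1%:R^-1 != 0.
  by rewrite gt_eqF// ltr_wpDl ?sqr_ge0.
apply: (@measurable_fun_cvg _ _ _ _ h) => [n|x _].
  apply: continuous_measurable_fun => x; apply: cvgM; first exact: cvg_id.
  apply: cvgV; first exact: d0.
  by apply: cvgD; [exact: exprn_continuous|exact: cvg_cst].
have [->|x0] := eqVneq x 0.
  by rewrite invr0; apply: cvg_near_cst; apply: nearW => n; rewrite /h mul0r.
rewrite (_ : x^-1 = x * (x ^+ 2 + 0)^-1); last by field.
apply: cvgM; first exact: cvg_cst.
apply: cvgV; first by rewrite addr0 sqrf_eq0.
by apply: cvgD; [exact: cvg_cst|exact: cvg_harmonic].
Qed.

Lemma measurable_costr G : measurable_fun setT G -> measurable_fun setT (costr G).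
Proof.
move=> mG; apply: measurable_Int; apply: jmeasurableM; first exact: jmeasurable_snd.
by apply: jmeasurable_mul; apply: continuous_measurable_fun; exact: continuous_cos.
Qed.

Lemma measurable_sintr G : measurable_fun setT G -> measurable_fun setT (sintr G).
Proof.
move=> mG; apply: measurable_Int; apply: jmeasurableM; first exact: jmeasurable_snd.
by apply: jmeasurable_mul; apply: continuous_measurable_fun; exact: continuous_sin.
Qed.

Lemma costrN G p : costr G (- p) = costr G p.
Proof. by apply: eq_Int => x; rewrite mulNr cosN. Qed.

Lemma sintrN G p : L1 G -> sintr G (- p) = - sintr G p.
Proof.
move=> G1; rewrite /sintr -[RHS]mulN1r -(IntZl (-1) (L1_sin p G1)).
by apply: eq_Int => x; rewrite mulNr sinN mulrN mulN1r.
Qed.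

Lemma sqr_FTabs G p : FTabs G p ^+ 2 = (2 * pi)^-1 * (costr G p ^+ 2 + sintr G p ^+ 2).
Proof.
rewrite /FTabs sqr_sqrtr ?addr_ge0 ?sqr_ge0//.
by rewrite /FTre /FTim -/(costr G p) -/(sintr G p) sqrrN !exprMn sqr_sqrt2piV -mulrDr.
Qed.

(** [A0 - i B0] is the quotient of [costr G - i sintr G] by [p ^ 2 - a - i b p], and [2 * pi]
    converts [FTabs] to the unnormalised integrals. The quotient is bounded only almost everywhere,
    whereas the solver needs bounds at every [p], so it is set to 0 on an exceptional null set. *)
Lemma multiplier_exists G (a b q : R) : L1 G -> 0 <= q ->
  {ae mu, forall p, FTabs G p / Num.sqrt ((p ^+ 2 - a) ^+ 2 + (b * p) ^+ 2) <= q} ->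
  {ae mu, forall p, p ^+ 2 * (FTabs G p / Num.sqrt ((p ^+ 2 - a) ^+ 2 + (b * p) ^+ 2)) <= q} ->
  exists A B : R -> R, [/\ measurable_fun setT A /\ measurable_fun setT B,
    (forall p, A (- p) = A p) /\ (forall p, B (- p) = - B p),
    (forall p, A p ^+ 2 + B p ^+ 2 <= 2 * pi * q ^+ 2) /\
    (forall p, p ^+ 4 * (A p ^+ 2 + B p ^+ 2) <= 2 * pi * q ^+ 2),
    {ae mu, forall p, (p ^+ 2 - a) * A p - b * p * B p = costr G p} &
    {ae mu, forall p, (p ^+ 2 - a) * B p + b * p * A p = sintr G p}].
Proof.
move=> G1 q0 r0 r2; have mG := L1_meas G1.
have mc := measurable_costr mG; have ms := measurable_sintr mG.
set M := 2 * pi * q ^+ 2.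
have M0 : 0 <= M by rewrite !mulr_ge0 ?pi_ge0 ?sqr_ge0.
pose D p : R := (p ^+ 2 - a) ^+ 2 + (b * p) ^+ 2.
pose A0 p : R := ((p ^+ 2 - a) * costr G p + b * p * sintr G p) / D p.
pose B0 p : R := ((p ^+ 2 - a) * sintr G p - b * p * costr G p) / D p.
pose Q p : R := A0 p ^+ 2 + B0 p ^+ 2.
have D0 p : 0 <= D p by rewrite addr_ge0 ?sqr_ge0.
have QE p : D p != 0 -> Q p = (costr G p ^+ 2 + sintr G p ^+ 2) / D p.
  move=> Dp; rewrite /Q /A0 /B0 /D; rewrite /D in Dp; field.
  exact: Dp.
have QQ p : Q p = 2 * pi * (FTabs G p / Num.sqrt (D p)) ^+ 2.
  have p0 : 2 * pi != 0 :> R by rewrite gt_eqF// mulr_gt0// pi_gt0.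
  rewrite exprMn exprVn (sqr_sqrtr (D0 p)) sqr_FTabs mulrA [_ * (_^-1 * _)]mulrA mulfV// mul1r.
  have [Dp|/QE//] := eqVneq (D p) 0.
  by rewrite /Q /A0 /B0 Dp invr0 !mulr0 expr0n addr0.
have eD p : D (- p) = D p by rewrite /D mulrN !sqrrN.
have eA p : A0 (- p) = A0 p by rewrite /A0 eD costrN sintrN//; congr (_ / _); ring.
have oB p : B0 (- p) = - B0 p.
  by rewrite /B0 eD costrN sintrN// -[RHS]mulNr; congr (_ / _); ring.
have eQ p : Q (- p) = Q p by rewrite /Q eA oB sqrrN.
pose S p := (Q p <= M) && (p ^+ 4 * Q p <= M).
have eS p : S (- p) = S p by rewrite /S eQ -[4%N]/(2 * 2)%N !exprM sqrrN.
have mD : measurable_fun setT D.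
  apply: measurable_funD; apply: measurable_funX; last exact: measurable_funM.
  by apply: measurable_funB => //; exact: measurable_funX.
have mp2 : measurable_fun setT (fun p : R => p ^+ 2 - a).
  by apply: measurable_funB => //; exact: measurable_funX.
have mbp : measurable_fun setT (fun p : R => b * p) by exact: measurable_funM.
have mDV : measurable_fun setT (fun p => (D p)^-1).
  exact: (measurableT_comp measurable_inv).
have mA0 : measurable_fun setT A0.
  by apply: measurable_funM => //; apply: measurable_funD; exact: measurable_funM.
have mB0 : measurable_fun setT B0.
  by apply: measurable_funM => //; apply: measurable_funB; exact: measurable_funM.
have mQ : measurable_fun setT Q by apply: measurable_funD; exact: measurable_funX.
have mS : measurable_fun setT S.
  apply: measurable_and; apply: measurable_fun_ler => //.
  by apply: measurable_funM => //; exact: measurable_funX.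
exists (fun p => if S p then A0 p else 0), (fun p => if S p then B0 p else 0).
have aeS : {ae mu, forall p, S p}.
  apply: (ae_imp2 r0 r2) => p h0 h2; rewrite /S QQ.
  have F0 : 0 <= FTabs G p / Num.sqrt (D p) by rewrite divr_ge0 ?sqrtr_ge0.
  have le (x : R) : 0 <= x -> x <= q -> 2 * pi * x ^+ 2 <= M.
    by move=> x0 xq; rewrite ler_wpM2l ?mulr_ge0 ?pi_ge0// lerXn2r ?nnegrE.
  rewrite le//=.
  rewrite mulrCA (_ : p ^+ 4 * _ = (p ^+ 2 * (FTabs G p / Num.sqrt (D p))) ^+ 2).
    by rewrite le// mulr_ge0 ?sqr_ge0.
  by rewrite [RHS]exprMn -exprM.
(* [D p = 0] forces [p ^ 2 = a], which leaves at most two points. *)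
have aeD : {ae mu, forall p, D p != 0}.
  apply: (ae_imp2 (ae_neq (Num.sqrt a)) (ae_neq (- Num.sqrt a))) => p p1 p2.
  apply/eqP => /eqP; rewrite paddr_eq0 ?sqr_ge0// sqrf_eq0 subr_eq0 => /andP[/eqP pa _].
  move: p1 p2; rewrite -pa sqrtr_sqr; by case: ger0P => p0; rewrite ?opprK eqxx.
split.
- by split; apply: measurable_fun_ifT.
- by split => p; rewrite eS; case: ifP => _; rewrite ?oppr0.
- by split => p; case: ifPn => [/andP[]//|_]; rewrite expr0n addr0 ?mulr0.
- apply: (ae_imp2 aeS aeD) => p -> Dp.
  by rewrite /A0 /B0; move: Dp; rewrite /D => Dp; field.
- apply: (ae_imp2 aeS aeD) => p -> Dp.
  by rewrite /A0 /B0; move: Dp; rewrite /D => Dp; field.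
Qed.

(** Passage from the extended [Qconst] to a real [q]: the strict inequality excludes [+oo], and a
    negative value is replaced by 0. *)
Lemma ratio_bound (N K : nat) (G : 'I_N -> R -> R) (a b : 'I_N -> R) (L : R) :
  0 < L -> ((2 * Num.sqrt pi * L)%:E * Qconst K G a b < 1)%E ->
  exists2 q, 0 <= q /\ 2 * Num.sqrt pi * L * q < 1 &
    forall k, {ae mu, forall p, Defs.ratio K G a b k p <= q} /\
              {ae mu, forall p, p ^+ 2 * Defs.ratio K G a b k p <= q}.
Proof.
move=> L0 h; set c := 2 * Num.sqrt pi * L in h *.
have c0 : 0 < c by rewrite !mulr_gt0// sqrtr_gt0 pi_gt0.
have [q [q0 cq Qq]] : exists q : R, [/\ 0 <= q, c * q < 1 & (Qconst K G a b <= q%:E)%E].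
  move: h; case: (Qconst K G a b) => [r||].
  - rewrite -EFinM lte_fin => cr; have [r0|r0] := leP 0 r; first by exists r.
    by exists 0; split => //; [rewrite mulr0 ltr01|rewrite lee_fin ltW].
  - by rewrite gt0_muley ?lte_fin// ltNge leey.
  - by move=> _; exists 0; split => //; [rewrite mulr0 ltr01|rewrite leNye].
exists q => // k.
have hk : (NMk K G a b k <= q%:E)%E by apply: le_trans Qq; exact: le_bigmax.
move: hk; rewrite /NMk ge_max => /andP[h1 h2].
have := ess_sup_ge mu (fun p => (Defs.ratio K G a b k p)%:E).
have := ess_sup_ge mu (fun p => (p ^+ 2 * Defs.ratio K G a b k p)%:E).
move=> e2 e1; split.
- by apply: (ae_imp e1) => p /le_trans/(_ h1); rewrite lee_fin.
- by apply: (ae_imp e2) => p /le_trans/(_ h2); rewrite lee_fin.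
Qed.

(** With drift 0 for [k >= K], the two families of equations become a single one. *)
Lemma ratioE (N K : nat) (G : 'I_N -> R -> R) (a b : 'I_N -> R) k p :
  Defs.ratio K G a b k p = FTabs (G k) p /
    Num.sqrt ((p ^+ 2 - a k) ^+ 2 + ((if (k < K)%N then b k else 0) * p) ^+ 2).
Proof.
by rewrite /Defs.ratio; case: ifP => // _; rewrite mul0r expr0n addr0 sqrtr_sqr.
Qed.

End multiplier_from_ratio.

(** * The nonlinear system *)

Section vector_functions.
Context {R : realType} {N : nat}.
Local Notation mu := (@lebesgue_measure R).
Implicit Types (u v w : R -> 'I_N -> R).

Lemma Int_sum (g : 'I_N -> R -> R) : (forall k, L1 (g k)) ->
  L1 (fun x => \sum_(k < N) g k x) /\
  Int (fun x => \sum_(k < N) g k x) = \sum_(k < N) Int (g k).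
Proof.
move=> g1; elim: (index_enum _) => [|k s [IH1 IH2]].
  rewrite big_nil; under eq_Int do rewrite big_nil.
  split; last exact: Int0.
  apply: (eq_L1 (f := fun=> 0)); first by move=> x; rewrite big_nil.
  exact: integrable0.
rewrite big_cons -IH2 -IntD//; split; last by apply: eq_Int => x; rewrite big_cons.
by apply: eq_L1 (L1D (g1 k) IH1) => x; rewrite big_cons.
Qed.

Lemma sqr_enorm (z : 'I_N -> R) : enorm z ^+ 2 = \sum_(k < N) z k ^+ 2.
Proof. by rewrite sqr_sqrtr// sumr_ge0// => k _; exact: sqr_ge0. Qed.

Lemma enorm_ge0 (z : 'I_N -> R) : 0 <= enorm z.
Proof. exact: sqrtr_ge0. Qed.

Lemma sqr_le_enorm (z : 'I_N -> R) k : z k ^+ 2 <= enorm z ^+ 2.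
Proof.
rewrite sqr_enorm (bigD1 k)//= lerDl.
by apply: sumr_ge0 => j _; exact: sqr_ge0.
Qed.

Lemma norm_le_enorm (z : 'I_N -> R) k : `|z k| <= enorm z.
Proof.
apply: le_of_sqr; first exact: enorm_ge0.
by rewrite real_normK ?num_real// sqr_le_enorm.
Qed.

Lemma enorm_le (z : 'I_N -> R) (e : R) : 0 <= e -> (forall k, `|z k| <= e) ->
  enorm z ^+ 2 <= N%:R * e ^+ 2.
Proof.
move=> e0 ze; rewrite sqr_enorm mulr_natl -[X in _ *+ X]card_ord -sumr_const.
by apply: ler_sum => k _; rewrite -real_normK ?num_real// lerXn2r ?nnegrE.
Qed.

Definition L2N v := forall k, L2 (fun x => v x k).
Definition n2N v : R := \sum_(k < N) n2 (fun x => v x k).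

Lemma n2N_ge0 v : 0 <= n2N v.
Proof. by apply: sumr_ge0 => k _; exact: n2_ge0. Qed.

Lemma L2N_B v w : L2N v -> L2N w -> L2N (fun x k => v x k - w x k).
Proof. by move=> v2 w2 k; exact: L2B. Qed.

Lemma n2_le_n2N v k : n2 (fun x => v x k) <= n2N v.
Proof.
rewrite /n2N (bigD1 k)//= lerDl; apply: sumr_ge0 => j _; exact: n2_ge0.
Qed.

Lemma Int_sqr_enorm v : L2N v ->
  L1 (fun x => enorm (v x) ^+ 2) /\ Int (fun x => enorm (v x) ^+ 2) = n2N v.
Proof.
move=> v2; have [i e] := Int_sum (fun k => L2_sqr (v2 k)).
split; first by apply: eq_L1 i => x; rewrite sqr_enorm.
by rewrite /n2N -e; apply: eq_Int => x; rewrite sqr_enorm.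
Qed.

Lemma n2N_D v w : L2N v -> L2N w ->
  n2N (fun x k => v x k + w x k) <= 2 * n2N v + 2 * n2N w.
Proof.
move=> v2 w2; rewrite /n2N !mulr_sumr -big_split/=.
by apply: ler_sum => k _; exact: n2D.
Qed.

End vector_functions.

(** * The superposition operator *)

Section nemytskii.
Context {R : realType} {N : nat}.
Local Notation mu := (@lebesgue_measure R).
Implicit Types (v w : R -> 'I_N -> R).

Lemma measurable_floor_eq (m : int) (c : R) (f : R -> R) : measurable_fun setT f ->
  measurable [set y | Num.floor (f y * c) = m].
Proof.
move=> mf; rewrite (_ : [set _ | _] = (fun y => f y * c) @^-1` `[m%:~R, (m + 1)%:~R[%classic).
  by rewrite -[X in measurable X]setTI; apply: measurable_funM.
apply/seteqP; split => y /=; rewrite in_itv/= -floor_eq; first by move=> ->.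
by move/eqP.
Qed.

(* Approximate [v] by the countably-valued [floor (v * n) / n]. *)
Lemma measurable_nemytskii (F : ('I_N -> R) -> R -> R) (L : R) v :
  (forall u, measurable_fun setT (F u)) ->
  (forall (u w : 'I_N -> R) x, `|F u x - F w x| <= L * enorm (fun k => u k - w k)) ->
  (forall k, measurable_fun setT (fun x => v x k)) ->
  measurable_fun setT (fun x => F (v x) x).
Proof.
move=> mF lF mv.
pose z (n : nat) (y : R) : {ffun 'I_N -> int} := [ffun k => Num.floor (v y k * n.+1%:R)].
pose V (n : nat) (q : {ffun 'I_N -> int}) : 'I_N -> R := fun k => (q k)%:~R / n.+1%:R.
apply: (@measurable_fun_cvg _ _ _ _ (fun n y => F (V n (z n y)) y)) => [n|y _].
  move=> _ Y mY; rewrite setTI.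
  (* [z n] has countably many values, and on each of its level sets the first argument of [F] is
     constant. *)
  rewrite (_ : _ @^-1` _ = \bigcup_q ([set y | z n y = q] `&` F (V n q) @^-1` Y)); last first.
    apply/seteqP; split => y /=; first by move=> h; exists (z n y).
    by move=> [q _ [<-]].
  apply: countable_bigcupT_measurable => [|q]; first exact: countableP.
  apply: measurableI.
    rewrite (_ : [set y | _] = \bigcap_(k in [set: 'I_N]) [set y | Num.floor (v y k * n.+1%:R) = q k]).
      by apply: fin_bigcap_measurable => // k _; exact: measurable_floor_eq.
    apply/seteqP; split => y /= => [<- k _|h]; first by rewrite ffunE.
    by apply/ffunP => k; rewrite ffunE; exact: h.
  by rewrite -[X in measurable X]setTI; exact: mF.
have e0 n : (0 : R) <= n.+1%:R^-1 by [].
have le n : (F (v y) y - F (V n (z n y)) y) ^+ 2 <= L ^+ 2 * (N%:R * n.+1%:R^-1 ^+ 2).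
  rewrite -real_normK ?num_real// (@le_trans _ _ ((L * enorm (fun k => v y k - V n (z n y) k)) ^+ 2))//.
    by rewrite lerXn2r ?nnegrE//; exact: le_trans (lF _ _ y).
  rewrite exprMn ler_wpM2l ?sqr_ge0// enorm_le// => k.
  have n0 : (0 : R) < n.+1%:R by [].
  rewrite /V ffunE ger0_norm.
    have /andP[_ h] := floor_itv (v y k * n.+1%:R).
    rewrite lerBlDr -[X in _ <= X + _]div1r -mulrDl ler_pdivlMr//.
    by move: h; rewrite intrD mulr1z => /ltW; rewrite [X in _ <= X -> _]addrC.
  by rewrite subr_ge0 ler_pdivrMr// floor_le.
apply: cvg_sqr_dist le _.
have -> : (0 : R) = L ^+ 2 * (N%:R * (0 * 0)) by rewrite !mulr0.
apply: cvgM; first exact: cvg_cst.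
by apply: cvgM; [exact: cvg_cst|apply: cvgM; exact: cvg_harmonic].
Qed.

Context (F : 'I_N -> ('I_N -> R) -> R -> R) (cK L : R) (h : R -> R).
Hypothesis mF : forall k u, measurable_fun setT (F k u).
Hypotheses (cK0 : 0 < cK) (h0 : forall x, 0 <= h x) (h2 : L2 h) (L0 : 0 < L).
Hypothesis growth : forall u x, enorm (fun k => F k u x) <= cK * enorm u + h x.
Hypothesis lip : forall u1 u2 x,
  enorm (fun k => F k u1 x - F k u2 x) <= L * enorm (fun k => u1 k - u2 k).

Definition nem v (x : R) (k : 'I_N) : R := F k (v x) x.

(** Measurability comes from the Lipschitz condition, square integrability from the growth bound. *)
Lemma L2_nem v : L2N v -> L2N (nem v).
Proof.
move=> v2 k.
have mn : measurable_fun setT (fun x => nem v x k).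
  apply: (measurable_nemytskii (F := F k) (L := L)) => //.
  - by move=> u w x; apply: le_trans (lip u w x); exact: (norm_le_enorm (fun k => F k u x - F k w x) k).
  - by move=> j; exact: L2_meas.
have [e1 _] := Int_sqr_enorm v2.
apply/L2P; split => //.
apply: L1_le (L1D (L1Zl (2 * cK ^+ 2) e1) (L1Zl 2 (L2_sqr h2))).
  exact: measurable_funX.
move=> x; rewrite ger0_norm ?sqr_ge0//.
have g := growth (v x) x.
apply: (le_trans (sqr_le_enorm (fun k => F k (v x) x) k)).
apply: (@le_trans _ _ ((cK * enorm (v x) + h x) ^+ 2)).
  by rewrite lerXn2r ?nnegrE ?enorm_ge0// addr_ge0// mulr_ge0 ?enorm_ge0// ltW.
by apply: (le_trans (sqrD_le _ _)); rewrite exprMn mulrA.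
Qed.

Lemma n2N_nem v w : L2N v -> L2N w ->
  n2N (fun x k => nem v x k - nem w x k) <= L ^+ 2 * n2N (fun x k => v x k - w x k).
Proof.
move=> v2 w2.
have [d1 <-] := Int_sqr_enorm (L2N_B (L2_nem v2) (L2_nem w2)).
have [e1 <-] := Int_sqr_enorm (L2N_B v2 w2).
rewrite -IntZl//; apply: le_Int => //; first exact: L1Zl.
move=> x; rewrite -exprMn lerXn2r ?nnegrE ?enorm_ge0 ?mulr_ge0 ?enorm_ge0 ?(ltW L0)//.
exact: lip.
Qed.

End nemytskii.

(** * The fixed point of the solution map *)

Section fixed_point.
Context {R : realType} {N : nat}.
Local Notation mu := (@lebesgue_measure R).
Implicit Types (f g : R -> R) (u v w : R -> 'I_N -> R) (k : 'I_N).
Context (G : 'I_N -> R -> R) (a b : 'I_N -> R) (M C : R).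
Hypotheses (G1 : forall k, L1 (G k)) (a0 : forall k, 0 <= a k) (C0 : 0 <= C).
Hypothesis M0 : 0 <= M.
Hypothesis solve : forall k f, L2 f -> exists u u1 : R -> R,
  [/\ solution (G k) (a k) (b k) f u u1, n2 u <= M * n2 f & forall x, u x ^+ 2 <= C * n2 f].
Context (F : 'I_N -> ('I_N -> R) -> R -> R) (cK L : R) (h : R -> R).
Hypothesis mF : forall k (u : 'I_N -> R), measurable_fun setT (F k u).
Hypotheses (cK0 : 0 < cK) (h0 : forall x, 0 <= h x) (h2 : L2 h) (L0 : 0 < L).
Hypothesis growth : forall (u : 'I_N -> R) x, enorm (fun k => F k u x) <= cK * enorm u + h x.
Hypothesis lip : forall (u1 u2 : 'I_N -> R) x,
  enorm (fun k => F k u1 x - F k u2 x) <= L * enorm (fun k => u1 k - u2 k).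
Hypothesis contracting : M * L ^+ 2 < 2^-1.

Definition solves v u := forall k, exists u1 : R -> R,
  solution (G k) (a k) (b k) (fun x => nem F v x k) (fun x => u x k) u1.

Lemma L2N_solves v u : solves v u -> L2N u.
Proof. by move=> h' k; have [u1 []] := h' k. Qed.

Let rho := M * L ^+ 2.

Let rho0 : 0 <= rho. Proof. by rewrite mulr_ge0 ?sqr_ge0. Qed.

Let Lnem v : L2N v -> L2N (nem F v).
Proof. by move=> v2; exact: (L2_nem mF cK0 h0 h2 growth lip v2). Qed.

Lemma solves_exists v : L2N v -> exists u, solves v u.
Proof.
move=> v2.
have ex k : exists uu : (R -> R) * (R -> R), solution (G k) (a k) (b k) (fun x => nem F v x k) uu.1 uu.2.
  by have [u [u1 [s _ _]]] := solve k (Lnem v2 k); exists (u, u1).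
have [uu huu] := choice ex.
by exists (fun x k => (uu k).1 x) => k; exists (uu k).2; exact: huu.
Qed.

(** By linearity and uniqueness, [u - u'] is the solution that [solve] provides for the difference
    of the two nonlinear terms. The second estimate turns closeness of the data in [L2] into
    closeness of the solutions at every point. *)
Lemma solves_dist v w u u' : L2N v -> L2N w -> solves v u -> solves w u' ->
  n2N (fun x k => u x k - u' x k) <= rho * n2N (fun x k => v x k - w x k) /\
  forall x k, (u x k - u' x k) ^+ 2 <= C * L ^+ 2 * n2N (fun x k => v x k - w x k).
Proof.
move=> v2 w2 su su'.
have D k : n2 (fun x => u x k - u' x k) <= M * n2 (fun x => nem F v x k - nem F w x k) /\
    forall x, (u x k - u' x k) ^+ 2 <= C * n2 (fun x => nem F v x k - nem F w x k).
  have [u1 s] := su k; have [u1' s'] := su' k.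
  have sB := solutionB (G1 k) (Lnem v2 k) (Lnem w2 k) s s'.
  have [z [z1 [sz nz bz]]] := solve k (L2B (Lnem v2 k) (Lnem w2 k)).
  have E x := (solution_unique (a0 k) sB sz x).1.
  split; first by rewrite (eq_Int (g := fun x => z x ^+ 2))// => x; rewrite E.
  by move=> x; rewrite E.
have nn := n2N_nem mF cK0 h0 h2 L0 growth lip v2 w2.
split.
  rewrite /rho -mulrA (@le_trans _ _ (M * n2N (fun x k => nem F v x k - nem F w x k)))//.
    by rewrite /n2N mulr_sumr; apply: ler_sum => k _; exact: (D k).1.
  by rewrite ler_wpM2l.
move=> x k; apply: (le_trans ((D k).2 x)).
rewrite -mulrA ler_wpM2l// (le_trans _ nn)//.
exact: (n2_le_n2N (fun x k => nem F v x k - nem F w x k)).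
Qed.

Lemma solves_unique v u u' : L2N v -> solves v u -> solves v u' -> u = u'.
Proof.
move=> v2 su su'; apply: funext => x; apply: funext => k.
have [_ /(_ x k)] := solves_dist v2 v2 su su'.
rewrite (_ : n2N _ = 0) ?mulr0.
  by rewrite le_eqVlt ltNge sqr_ge0 orbF sqrf_eq0 subr_eq0 => /eqP.
rewrite /n2N big1// => j _; rewrite -[RHS](Int0 (R := R)).
by apply: eq_Int => y; rewrite subrr expr0n.
Qed.

(** Contraction makes the [L2] distance zero; the pointwise estimate upgrades equality almost
    everywhere to equality. *)
Lemma fixed_point_unique v w : solves v v -> solves w w -> v = w.
Proof.
move=> sv sw; have v2 := L2N_solves sv; have w2 := L2N_solves sw.
have [d1 d2] := solves_dist v2 w2 sv sw.
have n0 : n2N (fun x k => v x k - w x k) = 0.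
  have := n2N_ge0 (fun x k => v x k - w x k).
  by move: contracting d1; rewrite -/rho; nra.
apply: funext => x; apply: funext => k; have := d2 x k.
by rewrite n0 mulr0 le_eqVlt ltNge sqr_ge0 orbF sqrf_eq0 subr_eq0 => /eqP.
Qed.

(* Picard iteration. Since [rho < 1/2], the crude triangle inequality
   [|x + y|^2 <= 2 |x|^2 + 2 |y|^2] suffices, and the sup bound makes the
   iterates converge pointwise. *)
Lemma fixed_point_exists : exists v, solves v v.
Proof.
(* A total map is wanted for iteration; outside [L2N] the value is a dummy. *)
have exT v : exists u, L2N v -> solves v u.
  have [v2|nv2] := pselect (L2N v); last by exists v.
  by have [u su] := solves_exists v2; exists u.
have [T hT] := choice exT.
pose v_ n := iter n T (fun _ _ => 0).
have v2 n : L2N (v_ n).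
  elim: n => [k|n IH]; last exact: L2N_solves (hT _ IH).
  by apply/L2P; split => //; apply: (eq_L1 (f := fun=> 0)) => [x|]; [rewrite expr0n|exact: integrable0].
have sv n : solves (v_ n) (v_ n.+1) by exact: hT.
pose d := n2N (fun x k => v_ 1%N x k - v_ 0%N x k).
have d0 : 0 <= d by exact: n2N_ge0.
have step n : n2N (fun x k => v_ n.+1 x k - v_ n x k) <= rho ^+ n * d.
  elim: n => [|n IH]; first by rewrite expr0 mul1r.
  apply: (le_trans (solves_dist (v2 _) (v2 _) (sv n.+1) (sv n)).1).
  by rewrite exprS -mulrA ler_wpM2l.
have r2 : 0 < 1 - 2 * rho by move: contracting; rewrite -/rho; lra.
(* [B n] solves [B = 2 * rho * B + 2 * rho ^ n * d], exactly the recursion produced by splitting off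
   one step and contracting the rest, so the induction on [j] closes. This is where [2 * rho < 1] is
   used. *)
pose B n := 2 * (rho ^+ n * d) / (1 - 2 * rho).
have B0 n : 0 <= B n by rewrite divr_ge0 ?mulr_ge0 ?exprn_ge0// ltW.
have dist j n : n2N (fun x k => v_ (n + j)%N x k - v_ n x k) <= B n.
  elim: j n => [|j IH] n.
    rewrite addn0 (_ : n2N _ = 0)// /n2N big1// => k _; rewrite -[RHS](Int0 (R := R)).
    by apply: eq_Int => y; rewrite subrr expr0n.
  have E : (fun x k => v_ (n + j.+1)%N x k - v_ n x k) =
      (fun x k => (v_ (n + j).+1 x k - v_ n.+1 x k) + (v_ n.+1 x k - v_ n x k)).
    by apply: funext => x; apply: funext => k; rewrite addnS addrA subrK.
  rewrite E (le_trans (n2N_D (L2N_B (v2 _) (v2 _)) (L2N_B (v2 _) (v2 _))))//.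
  have d1 := (solves_dist (v2 _) (v2 _) (sv (n + j)%N) (sv n)).1.
  have d2 := step n; have ih := IH n.
  have d3 := le_trans d1 (ler_wpM2l rho0 ih).
  have EB : B n * (1 - 2 * rho) = 2 * (rho ^+ n * d) by rewrite /B divfK// gt_eqF.
  move: d2 d3 EB; move: (n2N _) (n2N _) (rho ^+ n * d) (B n) => x y z t; nra.
have rho_lt1 : `|rho| < 1 by rewrite ger0_norm//; move: contracting; rewrite -/rho; lra.
have Bcvg : B n @[n --> \oo] --> (0 : R).
  have -> : (0 : R) = 2 * (0 * d) / (1 - 2 * rho) by rewrite mul0r mulr0 mul0r.
  apply: cvgM; last exact: cvg_cst.
  apply: cvgM; first exact: cvg_cst.
  by apply: cvgM; [exact: cvg_expr|exact: cvg_cst].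
have CL0 : 0 <= C * L ^+ 2 by rewrite mulr_ge0 ?sqr_ge0.
pose r n := C * L ^+ 2 * B n.
have rcvg : r n @[n --> \oo] --> (0 : R).
  by rewrite -(mulr0 (C * L ^+ 2)); apply: cvgM => //; exact: cvg_cst.
(* The pointwise estimate concerns solutions, not data, hence the indices shifted by one. *)
have pdist x k n m : (n <= m)%N -> (v_ m.+1 x k - v_ n.+1 x k) ^+ 2 <= r n.
  move=> nm; have := (solves_dist (v2 _) (v2 _) (sv m) (sv n)).2 x k.
  move=> /le_trans; apply; rewrite ler_wpM2l//.
  by have := dist (m - n)%N n; rewrite subnKC.
have [V hV] := choice (fun xk : R * 'I_N => cvg_of_sqr_dist (pdist xk.1 xk.2) rcvg).
pose v (x : R) (k : 'I_N) : R := V (x, k).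
have vcvg x k : v_ n.+1 x k @[n --> \oo] --> v x k := (hV (x, k)).1.
have dv n k : L1 (fun x => (v x k - v_ n x k) ^+ 2) /\ n2 (fun x => v x k - v_ n x k) <= B n.
  apply: (fatou_Int (f_ := fun m x => (v_ (n + m).+1 x k - v_ n x k) ^+ 2)).
  - by move=> m; apply: L2_sqr; apply: L2B; exact: v2.
  - by move=> m x; exact: sqr_ge0.
  - move=> x; have c : v_ (n + m).+1 x k @[m --> \oo] --> v x k.
      have := vcvg x k; rewrite -(cvg_shiftn n).
      by under eq_fun do rewrite addnC.
    have c1 : v_ (n + m).+1 x k - v_ n x k @[m --> \oo] --> v x k - v_ n x k.
      by apply: cvgB => //; exact: cvg_cst.
    exact: (cvgM c1 c1).
  - move=> m; apply: le_trans (dist m.+1 n); rewrite addnS.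
    exact: (n2_le_n2N (fun x k => v_ (n + m).+1 x k - v_ n x k)).
have Lv : L2N v.
  move=> k; apply/L2P; split.
    apply: (@measurable_fun_cvg _ _ _ _ (fun n x => v_ n.+1 x k)) => [n|x _]; last exact: vcvg.
    exact: L2_meas (v2 n.+1 k).
  by apply: eq_L1 (dv 0%N k).1 => x; rewrite subr0.
have [u su] := solves_exists Lv.
(* [v_ n] tends to [v] in [L2], so the solutions [v_ n.+1] tend pointwise to the solution [u] with
   datum [v]; they also tend pointwise to [v]. *)
suff uv : u = v by exists v; rewrite -{2}uv.
apply: funext => x; apply: funext => k.
have le n : (u x k - v_ n.+1 x k) ^+ 2 <= C * L ^+ 2 * (N%:R * B n).
  apply: (le_trans ((solves_dist Lv (v2 n) su (sv n)).2 x k)).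
  rewrite ler_wpM2l// mulr_natl -[X in _ *+ X]card_ord -sumr_const.
  by apply: ler_sum => j _; exact: (dv n j).2.
have c : C * L ^+ 2 * (N%:R * B n) @[n --> \oo] --> (0 : R).
  have -> : (0 : R) = C * L ^+ 2 * (N%:R * 0) by rewrite !mulr0.
  by apply: cvgM; [exact: cvg_cst|apply: cvgM => //; exact: cvg_cst].
have c1 : v_ n.+1 x k @[n --> \oo] --> u x k by exact: cvg_sqr_dist le c.
have c2 := vcvg x k.
by rewrite -(cvg_lim (@Rhausdorff R) c1) (cvg_lim (@Rhausdorff R) c2).
Qed.

End fixed_point.

(** * Nontriviality *)

Section nontriviality.
Context {R : realType}.
Local Notation mu := (@lebesgue_measure R).
Implicit Types (f g w u : R -> R) (x y p : R).

(** The primitive is identically zero, and almost everywhere its derivative is the integrand.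
    Differentiation is applied to the truncations, which are integrable. *)
Lemma ae_eq0_itv w : L2 w ->
  (forall x y, x <= y -> \int[mu]_(t in `[x, y]) w t = 0) -> {ae mu, forall x, w x = 0}.
Proof.
move=> w2 w0.
have tr0 n y : \int[mu]_(t in `]-oo, y]) trunc w n t = 0.
  rewrite Rintegral_indic -[RHS](Int0 (R := R)).
  have [ny|yn] := leP (- n%:R) y; last first.
    apply: eq_Int => t; rewrite /trunc !indicE !mem_setE !in_itv/=.
    by case: (leP t y) => ty; rewrite ?mulr0// leNgt (le_lt_trans ty yn)/= mulr0 mul0r.
  have h : - n%:R <= Num.min y n%:R :> R.
    by rewrite le_min ny/= (@le_trans _ _ 0)// oppr_le0.
  rewrite Int0 -(w0 _ _ h) [RHS]Rintegral_indic; apply: eq_Int => t.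
  rewrite /trunc !indicE !mem_setE !in_itv/= le_min.
  by case: (_ <= t); case: (t <= y); case: (t <= n%:R); rewrite /= ?mulr1 ?mulr0 ?mul0r.
have ae_tr n : {ae mu, forall x, trunc w n x = 0}.
  have t1 : mu.-integrable setT (EFin \o trunc w n) by exact: L1_trunc.
  have ti y : mu.-integrable `]-oo, y] (EFin \o trunc w n).
    by apply: integrableS t1 => //; exact: measurable_itv.
  have := FTC1Ny ti (open_integrable_locally openT t1).
  move/ae_imp; apply => x [_ <-].
  rewrite (_ : (fun _ => _) = fun=> 0); last by apply: funext => y; exact: tr0.
  exact: derive1_cst.
apply: (ae_imp (ae_foralln ae_tr)) => x h.
have c : trunc w n x @[n --> \oo] --> w x * 1.
  by apply: cvgM; [exact: cvg_cst|exact: truncation_cvg].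
have c0 : trunc w n x @[n --> \oo] --> (0 : R).
  by apply: cvg_near_cst; apply: nearW.
rewrite mulr1 in c.
by rewrite -(cvg_lim (@Rhausdorff R) c) (cvg_lim (@Rhausdorff R) c0).
Qed.

(** The integral identities are read backwards: [u = 0] forces [u1 = 0] at every point, so [cv G f]
    has integral zero over every interval. *)
Lemma solution0_cv_eq0 G (a b : R) f u1 : L1 G -> L2 f ->
  solution G a b f (fun=> 0) u1 -> {ae mu, forall x, cv G f x = 0}.
Proof.
move=> G1 f2 [_ Lu1 Lu2 du du1]; have [c2 _ _] := young2 G1 f2.
have cu1 : continuous u1 by apply: (primitive_continuous Lu2) => x y /du1[].
have u10 x : u1 x = 0.
  have d : is_derive x 1 (fun=> 0) (u1 x).
    by apply: primitive_is_derive => // y z /du[].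
  by have /@derive_val := d; rewrite -derive1E derive1_cst.
apply: (ae_eq0_itv c2) => x y xy.
have [_] := du1 x y xy; rewrite !u10 subrr.
rewrite (_ : (fun _ => _) = fun t => -1 * cv G f t); last first.
  by apply: funext => t; rewrite u10; ring.
rewrite RintegralZl//; last exact: integrable_itv_L2.
by move/esym/eqP; rewrite mulN1r oppr_eq0 => /eqP.
Qed.

Lemma trFTreE f n p : trFTre f n p = (Num.sqrt (2 * pi))^-1 * costr (trunc f n) p.
Proof.
by rewrite /trFTre Rintegral_indic; congr (_ * _); apply: eq_Int => x; rewrite /trunc mulrAC.
Qed.

Lemma trFTimE f n p : trFTim f n p = - ((Num.sqrt (2 * pi))^-1 * sintr (trunc f n) p).
Proof.
by rewrite /trFTim Rintegral_indic; congr (- (_ * _)); apply: eq_Int => x; rewrite /trunc mulrAC.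
Qed.

Lemma hart_costr f p : L1 f ->
  hart f p = (Num.sqrt (2 * pi))^-1 * costr f p + (Num.sqrt (2 * pi))^-1 * sintr f p.
Proof.
move=> f1; rewrite -mulrDr -IntD; [|exact: L1_cos|exact: L1_sin].
by congr (_ * _); apply: eq_Int => x; rewrite mulrDr.
Qed.

Lemma sqr_FTabs_le G p : L1 G ->
  FTabs G p ^+ 2 <= (2 * pi)^-1 * (2 * Int (fun x => `|G x|) ^+ 2).
Proof.
move=> G1; rewrite sqr_FTabs ler_wpM2l ?invr_ge0 ?mulr_ge0 ?pi_ge0//.
have I0 : 0 <= Int (fun x => `|G x|) by exact: Int_ge0.
have le (g k : R -> R) : L1 g -> (forall x, g x = G x * k x) -> (forall x, `|k x| <= 1) ->
    Int g ^+ 2 <= Int (fun x => `|G x|) ^+ 2.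
  move=> g1 gE k1; rewrite -[leLHS]real_normK ?num_real// lerXn2r ?nnegrE//.
  apply: (le_trans (norm_Int g1)); apply: le_Int; [exact: L1_norm|exact: L1_norm|].
  by move=> x; rewrite gE normrM ler_piMr.
rewrite mulr_natl mulr2n; apply: lerD.
  by apply: (le _ _ (L1_cos p G1)) => // x; exact: cos_max.
by apply: (le _ _ (L1_sin p G1)) => // x; exact: sin_max.
Qed.

(** Adding the values at [p] and [- p] restores the modulus, since [(x - y) ^ 2 + (x + y) ^ 2 = 2 (x
    ^ 2 + y ^ 2)]. This 2, times the [2 pi] of the convolution rule for the squared modulus, gives
    [4 * pi]. *)
Lemma sqr_hart_cv G f n p : L1 G -> L2 f ->
  hart (cv G (trunc f n)) p ^+ 2 + hart (cv G (trunc f n)) (- p) ^+ 2 =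
  4 * pi * (FTabs G p ^+ 2 * (trFTre f n p ^+ 2 + trFTim f n p ^+ 2)).
Proof.
move=> G1 f2; have t1 := L1_trunc n f2.
rewrite !hart_cv// opprK costrN sintrN// !(hart_costr _ t1) costrN sintrN//.
rewrite trFTreE trFTimE sqr_FTabs; move: (Num.sqrt _)^-1 => c.
by move: (@pi R) (@pi_gt0 R) => P P0; field; rewrite gt_eqF.
Qed.

(** As the full convolution vanishes, convolving the truncation is minus convolving the tail, which
    Young makes small. *)
Lemma n2_cv_trunc G f n : L1 G -> L2 f -> {ae mu, forall x, cv G f x = 0} ->
  n2 (cv G (trunc f n)) <= Int (fun x => `|G x|) ^+ 2 * n2 (fun x => f x - trunc f n x).
Proof.
move=> G1 f2 cv0; have t2 := L2_trunc n f2; have d2 := L2B f2 t2.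
have [Ld ld _] := young2 G1 d2; apply: le_trans ld.
have [Lt _ _] := young2 G1 t2.
rewrite le_eqVlt; apply/orP; left; apply/eqP; apply: ae_eq_Int.
- by apply: measurable_funX; exact: L2_meas.
- by apply: measurable_funX; exact: L2_meas.
- by apply: (ae_imp2 cv0 (cvB G1 f2 t2)) => x -> ->; rewrite sub0r sqrrN.
Qed.

Lemma measurable_FTabs_sqr G : measurable_fun setT G ->
  measurable_fun setT (fun p => FTabs G p ^+ 2).
Proof.
move=> mG; under eq_fun do rewrite sqr_FTabs.
apply: measurable_funM => //; apply: measurable_funD; apply: measurable_funX.
  exact: measurable_costr.
exact: measurable_sintr.
Qed.

(** The convolution of [G] with truncations of [f] tends to 0 in [L2], so by Bessel the product of
    [FTabs G] with the truncated transforms does too. Those transforms converge to [(gr, gi)] in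
    [L2], and [FTabs G] is bounded, so the limit product has norm zero. *)
Lemma spectral_cv_eq0 G f (gr gi : R -> R) : L1 G -> L2 f -> FT2 f gr gi ->
  {ae mu, forall x, cv G f x = 0} ->
  {ae mu, forall p, FTabs G p ^+ 2 * (gr p ^+ 2 + gi p ^+ 2) = 0}.
Proof.
move=> G1 f2 [gr2 gi2 lim] cv0.
set I := Int (fun x => `|G x|).
pose K := (2 * pi)^-1 * (2 * I ^+ 2).
have pi0 := @pi_gt0 R.
have FK p : FTabs G p ^+ 2 <= K by exact: sqr_FTabs_le.
have K0 : 0 <= K := le_trans (sqr_ge0 _) (FK 0).
have mF := measurable_FTabs_sqr (L1_meas G1).
have mre n : measurable_fun setT (trFTre f n).
  rewrite (_ : trFTre f n = fun p => (Num.sqrt (2 * pi))^-1 * costr (trunc f n) p); last first.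
    by apply: funext => p; rewrite trFTreE.
  by apply: measurable_funM => //; apply: measurable_costr; exact: L1_meas (L1_trunc n f2).
have mim n : measurable_fun setT (trFTim f n).
  rewrite (_ : trFTim f n = fun p => - ((Num.sqrt (2 * pi))^-1 * sintr (trunc f n) p)); last first.
    by apply: funext => p; rewrite trFTimE.
  apply: measurableT_comp => //.
  by apply: measurable_funM => //; apply: measurable_sintr; exact: L1_meas (L1_trunc n f2).
pose e n p := FTabs G p ^+ 2 * (trFTre f n p ^+ 2 + trFTim f n p ^+ 2).
pose s n : R := (4 * pi)^-1 * (2 * (I ^+ 2 * n2 (fun x => f x - trunc f n x))).
have e1 n : L1 (e n) /\ Int (e n) <= s n.
  have t1 := L1_trunc n f2; have t2 := L2_trunc n f2.
  have [w1 _] := young1 G1 t1; have [w2 _ _] := young2 G1 t2.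
  have [h2 hn] := L2_bessel w1 w2.
  have h2' := L2_opp h2.
  have E p : e n p = (4 * pi)^-1 * (hart (cv G (trunc f n)) p ^+ 2 + hart (cv G (trunc f n)) (- p) ^+ 2).
    by rewrite sqr_hart_cv// mulKf// gt_eqF// mulr_gt0.
  have L1h := L1D (L2_sqr h2) (L2_sqr h2').
  split; first by apply: (eq_L1 _ (L1Zl (4 * pi)^-1 L1h)) => p; rewrite E.
  rewrite (eq_Int E) (IntZl _ L1h) /s ler_wpM2l ?invr_ge0 ?mulr_ge0 ?pi_ge0//.
  rewrite (IntD (L2_sqr h2) (L2_sqr h2')) (n2_opp (L2_meas h2)).
  have le := le_trans hn (n2_cv_trunc n G1 f2 cv0).
  by rewrite [leRHS]mulr_natl mulr2n; exact: (lerD le le).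
have scvg : s n @[n --> \oo] --> (0 : R).
  have -> : (0 : R) = (4 * pi)^-1 * (2 * (I ^+ 2 * 0)) by rewrite !mulr0.
  apply: cvgM; first exact: cvg_cst.
  apply: cvgM; first exact: cvg_cst.
  by apply: cvgM; [exact: cvg_cst|exact: trunc_cvg].
pose H p := FTabs G p ^+ 2 * (gr p ^+ 2 + gi p ^+ 2).
have mH : measurable_fun setT H.
  apply: measurable_funM => //; apply: measurable_funD; apply: measurable_funX.
    exact: L2_meas gr2.
  exact: L2_meas gi2.
have H0 p : 0 <= H p by rewrite mulr_ge0 ?addr_ge0 ?sqr_ge0.
pose D n p := (trFTre f n p - gr p) ^+ 2 + (trFTim f n p - gi p) ^+ 2.
have mD n : measurable_fun setT (D n).
  apply: measurable_funD; apply: measurable_funX; apply: measurable_funB => //.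
    exact: L2_meas gr2.
  exact: L2_meas gi2.
have K20 : 0 <= 2 * K by rewrite mulr_ge0.
have D0 n p : 0 <= D n p by rewrite addr_ge0 ?sqr_ge0.
have HD n p : H p <= 2 * e n p + 2 * K * D n p.
  have F0 := sqr_ge0 (FTabs G p); have := FK p.
  rewrite /H /e /D; move: (FTabs G p ^+ 2) F0 => c c0 cK.
  have k1 := ler_wpM2r (D0 n p) cK; rewrite /D in k1.
  have k2 : gr p ^+ 2 + gi p ^+ 2 <= 2 * (trFTre f n p ^+ 2 + trFTim f n p ^+ 2) +
     2 * ((trFTre f n p - gr p) ^+ 2 + (trFTim f n p - gi p) ^+ 2).
    have := sqr_ge0 (2 * trFTre f n p - gr p); have := sqr_ge0 (2 * trFTim f n p - gi p).
    nra.
  have k3 := ler_wpM2l c0 k2.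
  nra.
(* [J n] is kept extended: its convergence to 0 makes it finite only from some [n] on. *)
pose J n := (\int[mu]_(p in setT) (D n p)%:E)%E.
have le n : (\int[mu]_(p in setT) (H p)%:E <= (2 * s n)%:E + (2 * K)%:E * J n)%E.
  have [en1 en2] := e1 n.
  have e0 p : 0 <= e n p by rewrite mulr_ge0 ?addr_ge0 ?sqr_ge0.
  apply: (@le_trans _ _ (\int[mu]_(p in setT) ((2 * e n p)%:E + (2 * K)%:E * (D n p)%:E))%E).
    apply: ge0_le_integral => //.
    - by move=> p _; rewrite lee_fin.
    - exact/measurable_EFinP.
    - apply: emeasurable_funD; first by apply/measurable_EFinP; apply: measurable_funM => //; exact: L1_meas.
      by apply: measurable_funeM; apply/measurable_EFinP; exact: mD.
    - by move=> p _; rewrite -EFinM -EFinD lee_fin.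
  rewrite ge0_integralD//; first last.
  - by apply: measurable_funeM; apply/measurable_EFinP; exact: mD.
  - by move=> p _; rewrite -EFinM lee_fin (mulr_ge0 K20 (D0 n p)).
  - by apply/measurable_EFinP; apply: measurable_funM => //; exact: L1_meas.
  - by move=> p _; rewrite lee_fin (mulr_ge0 _ (e0 p)).
  rewrite ge0_integralZl//; first last.
  - by move=> p _; rewrite lee_fin; exact: D0.
  - by apply/measurable_EFinP; exact: mD.
  rewrite leeD2r// -(EFin_Int (L1Zl 2 en1)) lee_fin (IntZl 2 en1).
  by rewrite ler_wpM2l.
have lim0 : ((2 * s n)%:E + (2 * K)%:E * J n)%E @[n --> \oo] --> (0%E : \bar R).
  have -> : (0%E : \bar R) = ((2 * 0)%:E + (2 * K)%:E * 0)%E by rewrite mulr0 mule0 adde0.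
  apply: cvgeD => //.
    by apply: cvg_EFin; [exact: nearW|apply: cvgM => //; exact: cvg_cst].
  exact: cvgeZl.
have Hle : (\int[mu]_(p in setT) (H p)%:E <= 0%:E)%E.
  have c : cvgn (fun n => (2 * s n)%:E + (2 * K)%:E * J n)%E by apply/cvg_ex; exists 0%E.
  have := lime_ge c (nearW _ le).
  by rewrite (cvg_lim (@ereal_hausdorff R) lim0); apply.
have [H1 HI] := ge0_L1 mH H0 Hle.
by apply: Int_eq0 => //; apply/eqP; rewrite eq_le HI Int_ge0.
Qed.

(** The overlap is the set where the product [H] is nonzero, a measurable preimage, so vanishing
    almost everywhere gives measure zero. *)
Lemma spectral_overlap0 G f (gr gi : R -> R) : L1 G -> L2 f -> FT2 f gr gi ->
  {ae mu, forall x, cv G f x = 0} ->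
  mu ([set p | gr p != 0 \/ gi p != 0] `&` [set p | FTabs G p != 0]) = 0%E.
Proof.
move=> G1 f2 ft cv0; have ae0 := spectral_cv_eq0 G1 f2 ft cv0.
pose H p := FTabs G p ^+ 2 * (gr p ^+ 2 + gi p ^+ 2).
have mH : measurable_fun setT H.
  have [gr2 gi2 _] := ft.
  apply: measurable_funM; first exact: measurable_FTabs_sqr (L1_meas G1).
  by apply: measurable_funD; apply: measurable_funX; [exact: L2_meas gr2|exact: L2_meas gi2].
have E : [set p | gr p != 0 \/ gi p != 0] `&` [set p | FTabs G p != 0] =
    H @^-1` (~` [set 0]).
  apply/seteqP; split => p /=.
    move=> [g0 F0] /eqP; rewrite mulf_eq0 sqrf_eq0 (negbTE F0)/=.
    rewrite paddr_eq0 ?sqr_ge0// !sqrf_eq0 => /andP[r0 i0].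
    by case: g0 => /negP.
  move/eqP; rewrite mulf_eq0 sqrf_eq0 paddr_eq0 ?sqr_ge0// !sqrf_eq0 negb_or negb_and.
  by move=> /andP[F0 /orP].
rewrite E; apply: measure_negligible.
  by rewrite -[X in measurable X]setTI; apply: mH => //; exact: measurableC.
exact: ae0.
Qed.

End nontriviality.

(** * From the stated system to the abstract fixed point problem *)

Section bridge.
Context {R : realType} {N : nat} (K : nat) (G : 'I_N -> R -> R) (a b : 'I_N -> R).
Context (F : 'I_N -> ('I_N -> R) -> R -> R).
Local Notation mu := (@lebesgue_measure R).
Implicit Types v w : R -> 'I_N -> R.

Definition drift (k : 'I_N) : R := if (k < K)%N then b k else 0.

Lemma L2N_H2N v : H2N v -> L2N v.
Proof. by move=> h2 k; have [? [? []]] := h2 k. Qed.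

Lemma H2N_Tsys v w : Tsys K a b G F v w -> H2N w.
Proof. by move=> sw k; have [w1 [w2 [? _]]] := sw k; exists w1, w2. Qed.

Lemma Sys_Tsys w : Sys K a b G F w <-> Tsys K a b G F w w.
Proof.
split=> sw k; have [w1 [w2 [h2 ode]]] := sw k; exists w1, w2; split => //;
  by apply: (ae_imp ode) => x e; lra.
Qed.

Lemma conv_nem v k x : Defs.conv G F v k x = cv (G k) (fun y => nem F v y k) x.
Proof. by []. Qed.

(** [Tsys] allows any second derivative that satisfies the equation almost everywhere; [is_H2_ext]
    replaces it by the expression that the equation prescribes. *)
Lemma Tsys_solves v w : (forall k, L1 (G k)) -> L2N (nem F v) ->
  Tsys K a b G F v w <-> solves G a drift F v w.
Proof.
move=> G1 n2; split=> sw k.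
  have [w1 [w2 [h2 ode]]] := sw k; exists w1.
  have [Lw Lw1 _ _ _] := h2; have [c2 _ _] := young2 (G1 k) (n2 k).
  apply: (is_H2_ext _ _ h2).
    by apply: L2_meas; apply: L2B => //; apply: L2B; exact: L2Zl.
  apply: (ae_imp ode) => x; rewrite /drift conv_nem.
  by case: ifP => _ <-; ring.
have [w1 s] := sw k; exists w1, (fun x => - drift k * w1 x - a k * w x k - cv (G k) (fun y => nem F v y k) x).
split => //; apply: ae_all => x; rewrite /drift conv_nem.
by case: ifP => _; ring.
Qed.

(** The norm bound is the same for every component; the pointwise constants depend on [k], and their
    sum serves for all. *)
Lemma uniform_solve (q : R) : (forall k, L1 (G k)) -> (forall k, 0 <= a k) -> 0 <= q ->
  (forall k, {ae mu, forall p, Defs.ratio K G a b k p <= q} /\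
             {ae mu, forall p, p ^+ 2 * Defs.ratio K G a b k p <= q}) ->
  exists2 C : R, 0 <= C & forall k f, L2 f -> exists u u1 : R -> R,
    [/\ solution (G k) (a k) (drift k) f u u1, n2 u <= 2 * pi * q ^+ 2 * n2 f &
        forall x, u x ^+ 2 <= C * n2 f].
Proof.
move=> G1 a0 q0 rq.
have M0 : 0 <= 2 * pi * q ^+ 2 :> R by rewrite mulr_ge0 ?sqr_ge0// mulr_ge0// pi_ge0.
have ex k : exists C : R, forall f, L2 f -> exists u u1 : R -> R,
    [/\ solution (G k) (a k) (drift k) f u u1, n2 u <= 2 * pi * q ^+ 2 * n2 f &
        forall x, u x ^+ 2 <= `|C| * n2 f].
  have [r0 r2] := rq k.
  have r0' : {ae mu, forall p, FTabs (G k) p / Num.sqrt ((p ^+ 2 - a k) ^+ 2 + (drift k * p) ^+ 2) <= q}.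
    by apply: (ae_imp r0) => p; rewrite ratioE.
  have r2' : {ae mu, forall p, p ^+ 2 * (FTabs (G k) p / Num.sqrt ((p ^+ 2 - a k) ^+ 2 + (drift k * p) ^+ 2)) <= q}.
    by apply: (ae_imp r2) => p; rewrite ratioE.
  have [A [B [[mA mB] [eA oB] [b0 b4] eqc eqs]]] := multiplier_exists (G1 k) q0 r0' r2'.
  have [C hC] := solve_L1L2 (G1 k) mA mB eA oB b0 b4 eqc eqs.
  by exists C => f; exact: (solve_L2 (G1 k) (a0 k) M0 hC).
have [C hC] := choice ex.
exists (\sum_k `|C k|) => [|k f f2]; first exact: sumr_ge0.
have [u [u1 [s nu bu]]] := hC k f f2; exists u, u1; split => // x.
apply: (le_trans (bu x)); rewrite ler_wpM2r ?n2_ge0// (bigD1 k)//= lerDl.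
exact: sumr_ge0.
Qed.

End bridge.

(* Indices are 0-based: paper index k (1..N) corresponds to ordinal k-1. *)
Theorem theorem2p2 (R : realType) (N K l r : nat)
  (G : 'I_N -> R -> R) (a b : 'I_N -> R)
  (F : 'I_N -> ('I_N -> R) -> R -> R) (cK L : R) (h : R -> R) :
  (4 <= N)%N -> (2 <= K)%N -> (1 <= l <= K - 1)%N -> (K + 1 <= r <= N - 1)%N ->
  (forall k, L1 (G k)) ->
  (forall k, 0 <= a k) ->
  (forall k : 'I_N, (k < K)%N -> b k != 0) ->
  (forall k, caratheodory (F k)) ->
  0 < cK -> (forall x, 0 <= h x) -> L2 h ->
  (forall (u : 'I_N -> R) (x : R), enorm (fun k => F k u x) <= cK * enorm u + h x) ->
  0 < L ->
  (forall (u1 u2 : 'I_N -> R) (x : R),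
      enorm (fun k => F k u1 x - F k u2 x) <= L * enorm (fun k => u1 k - u2 k)) ->
  (* (a) *)
  (forall k : 'I_N, (k < l)%N -> 0 < a k) ->
  (* (b) *)
  (forall k : 'I_N, (l <= k < K)%N ->
     [/\ a k = 0, L1 (fun x => x * G k x) &
         \int[@lebesgue_measure R]_(x in setT) G k x = 0]) ->
  (* (c) : ∫ G_k(x) e^{∓ i √a_k x} dx = 0 for both signs *)
  (forall k : 'I_N, (K <= k < r)%N ->
     [/\ 0 < a k, L1 (fun x => x * G k x),
         \int[@lebesgue_measure R]_(x in setT) (G k x * cos (Num.sqrt (a k) * x)) = 0 &
         \int[@lebesgue_measure R]_(x in setT) (G k x * sin (Num.sqrt (a k) * x)) = 0]) ->
  (* (d) *)
  (forall k : 'I_N, (r <= k)%N ->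
     [/\ a k = 0, L1 (fun x => x ^+ 2 * G k x),
         \int[@lebesgue_measure R]_(x in setT) G k x = 0 &
         \int[@lebesgue_measure R]_(x in setT) (x * G k x) = 0]) ->
  ((2 * Num.sqrt pi * L)%:E * Qconst K G a b < 1)%E ->
  (* T_{a,b} is a well-defined map on H^2(R,R^N) *)
  (forall v : R -> 'I_N -> R, H2N v ->
     exists u, [/\ H2N u, Tsys K a b G F v u &
                forall u', H2N u' -> Tsys K a b G F v u' -> u' = u]) /\
  (* unique fixed point, the unique H^2 solution, nontrivial under the condition *)
  (exists v : R -> 'I_N -> R,
     [/\ H2N v, Tsys K a b G F v v,
         (forall w, H2N w -> Tsys K a b G F w w -> w = v),
         (forall w, H2N w -> (Sys K a b G F w <-> w = v)) &
         ((exists (k : 'I_N) (gr gi : R -> R),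
              FT2 (fun x => F k (fun _ => 0) x) gr gi /\
              @lebesgue_measure R
                ([set p | gr p != 0 \/ gi p != 0] `&` [set p | FTabs (G k) p != 0])
              != 0%E) ->
          v <> (fun _ _ => 0))]).
Proof.
move=> _ _ _ _ G1 a0 _ cF cK0 h0 h2 growth L0 lip _ _ _ _ Q1.
have mF k (u : 'I_N -> R) : measurable_fun setT (F k u) := (cF k).1 u.
have [q [q0 qL] rq] := ratio_bound L0 Q1.
have [C C0 solve] := uniform_solve G1 a0 q0 rq.
(* Squaring the hypothesis gives [4 * pi * q ^ 2 * L ^ 2 < 1], which is this bound doubled. *)
have contracting : 2 * pi * q ^+ 2 * L ^+ 2 < 2^-1.
  have t0 : 0 <= 2 * Num.sqrt pi * L * q.
    by rewrite mulr_ge0// mulr_ge0 ?(ltW L0)// mulr_ge0// sqrtr_ge0.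
  have : (2 * Num.sqrt pi * L * q) ^+ 2 < 1 by rewrite expr_lt1.
  by rewrite !exprMn sqr_sqrtr ?pi_ge0//; lra.
have M0 : 0 <= 2 * pi * q ^+ 2 :> R by rewrite mulr_ge0 ?sqr_ge0// mulr_ge0// pi_ge0.
have Ln v : L2N v -> L2N (nem F v) := L2_nem mF cK0 h0 h2 growth lip (v := v).
have TS v u : H2N v -> Tsys K a b G F v u <-> solves G a (drift K b) F v u.
  by move=> /L2N_H2N/Ln; exact: Tsys_solves.
split.
  move=> v v2; have Lv := L2N_H2N v2.
  have [u su] := solves_exists solve mF cK0 h0 h2 growth lip Lv.
  have Tu := (TS v u v2).2 su.
  exists u; split => //; first exact: H2N_Tsys Tu.
  move=> u' _ /(TS v u' v2).1 su'.
  exact: (solves_unique G1 a0 C0 M0 solve mF cK0 h0 h2 L0 growth lip Lv su' su).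
have [v sv] := fixed_point_exists G1 a0 C0 M0 solve mF cK0 h0 h2 L0 growth lip contracting.
have Lv : L2N v by exact: L2N_solves sv.
have Tv : Tsys K a b G F v v by apply/Tsys_solves => //; exact: Ln.
have v2 := H2N_Tsys Tv.
have uniq w : H2N w -> Tsys K a b G F w w -> w = v.
  move=> w2 /(TS w w w2).1 sw.
  exact: (fixed_point_unique G1 a0 C0 M0 solve mF cK0 h0 h2 L0 growth lip contracting sw sv).
exists v; split => //.
  by move=> w w2; split=> [/Sys_Tsys/(uniq w w2)//|->]; apply/Sys_Tsys.
move=> [k [gr [gi [ft /eqP]]]] pos v0; apply: pos.
move: Lv sv; rewrite v0 => Lv sv; have [u1 s] := sv k.
have f2 : L2 (fun x => F k (fun=> 0) x) := Ln _ Lv k.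
exact: (spectral_overlap0 (G1 k) f2 ft (solution0_cv_eq0 (G1 k) f2 s)).
Qed.
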